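(* Let $k$ be a field, $Q$ a finite acyclic quiver and $n\ge1$ an integer. The category $\mathcal{S}^{n\text{-filt}}$ is isomorphic to the category $\mathcal{T}^n_{k\mathcal{S}_0}(\mathcal{S})$, where $k\mathcal{S}_0$ denotes the discrete $k$-subcategory of $\mathcal{S}$ generated by all identity morphisms.
   Context: All categories are $k$-categories. Nakajima categories. $Q^{n\text{-fr}}$ is obtained from $Q$ (which has no frozen vertices) by adding, for each $i\in Q_0$, frozen vertices $i_1,\dots,i_n$ and arrows $i\to i_r$ ($1\le r\le n$). For a finite acyclic quiver $R$ with some frozen vertices, $\mathbb{Z}R$ has vertices $R_0\times\mathbb{Z}$ and, for each arrow $\alpha:i\to j$ and $p\in\mathbb{Z}$, arrows $(\alpha,p):(i,p)\to(j,p)$ and $\sigma(\alpha,p):(j,p-1)\to(i,p)$; $(i,p)$ is frozen iff $i$ is; $\sigma$ sends $(\alpha,p)\mapsto\sigma(\alpha,p)$ and $\sigma(\alpha,p)\mapsto(\alpha,p-1)$; $\tau(i,p)=(i,p-1)$. The mesh category $k(\mathbb{Z}R)$ is the quotient of the $k$-linear path category of $\mathbb{Z}R$ by the ideal generated by $\sum_{\beta:y\to x}\beta\circ\sigma(\beta):\tau(x)\to x$ for all non-frozen $x$. $\mathcal{R}^{n\text{-filt}}$ is the quotient of $k(\mathbb{Z}Q^{n\text{-fr}})$ by the smallest ideal containing all morphisms from a frozen vertex $(i_r,p)$ to a frozen vertex $(j_s,q)$ with $r>s$; $\mathcal{S}^{n\text{-filt}}$ is its full subcategory of frozen vertices. $\mathcal{S}=\mathcal{S}^{1\text{-filt}}$.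 The category $\mathcal{T}^n_{\mathcal{B}}(\mathcal{A})$, for a small $k$-category $\mathcal{A}$ and a $k$-subcategory $\mathcal{B}$ containing all objects: bimodules are $k$-linear functors $\mathcal{A}^{\mathrm{op}}\otimes\mathcal{A}\to\operatorname{Mod}k$, the regular bimodule $\mathcal{A}(-,?)$ is denoted $\mathcal{A}$, and $\otimes_{\mathcal{B}}$ is the usual tensor product of bimodules, $(X\otimes_{\mathcal{B}}Y)(c,a)=\operatorname{coker}\big(\bigoplus_{b_1,b_2}X(b_2,a)\otimes\mathcal{B}(b_1,b_2)\otimes Y(c,b_1)\to\bigoplus_bX(b,a)\otimes Y(c,b)\big)$, $x\otimes f\otimes y\mapsto xf\otimes y-x\otimes fy$. Let $\mu:\mathcal{A}\otimes_{\mathcal{B}}\mathcal{A}\to\mathcal{A}$ be induced by composition; $X_1=\mathcal{A}$ and $X_l=\ker(\mathrm{id}^{\otimes l-2}\otimes\mu:\mathcal{A}^{\otimes_{\mathcal{B}}l}\to\mathcal{A}^{\otimes_{\mathcal{B}}l-1})$ for $l\ge2$; $\mu_{l,l'}:X_l\otimes_{\mathcal{A}}X_{l'}\to X_{l+l'-1}$ multiplies the last factor of a pure tensor in $X_l$ with the first factor of a pure tensor in $X_{l'}$. Then $\mathcal{T}^n_{\mathcal{B}}(\mathcal{A})$ has as objects $x^i$ ($x\in\mathcal{A}$, $1\le i\le n$), morphism spaces $\mathcal{T}(x^j,y^i)=X_{i-j+1}(x,y)$ for $i\ge j$ and $0$ for $i<j$, and composition given by the maps $\mu_{l,l'}$.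 *)

(* Defs.v *)
From HB Require Import structures.
From mathcomp Require Import all_boot all_order all_algebra.
From mathcomp Require Import finmap.
From mathcomp.multinomials Require Import monalg.
From mathcomp.classical Require Import boolp.

Set Implicit Arguments.
Unset Strict Implicit.
Unset Printing Implicit Defensive.

Import GRing.Theory.
Local Open Scope ring_scope.
Local Open Scope quotient_scope.

#[local] Obligation Tactic := idtac.

Section LinearFacts.
Variables (k : fieldType) (U V : lmodType k) (f : U -> V).
Hypothesis lf : linear f.

Lemma lin0 : f 0 = 0.
Proof. by have := lf (-1) 0 0; rewrite !scaleN1r !addNr. Qed.

Lemma linD u v : f (u + v) = f u + f v.
Proof. by have := lf 1 u v; rewrite !scale1r. Qed.

Lemma linZ a u : f (a *: u) = a *: f u.
Proof. by have := lf a u 0; rewrite !addr0 lin0 addr0. Qed.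

Lemma linB u v : f (u - v) = f u - f v.
Proof. by rewrite linD -scaleN1r linZ scaleN1r. Qed.

Lemma lin_sum I (r : seq I) (E : I -> U) :
  f (\sum_(i <- r) E i) = \sum_(i <- r) f (E i).
Proof. by elim/big_rec2: _ => [|i y x _ <-]; rewrite ?lin0 // linD. Qed.

End LinearFacts.

Record submod (k : fieldType) (V : lmodType k) := Submod {
  smem :> V -> Prop;
  smem0 : smem 0;
  smem_lin : forall a u v, smem u -> smem v -> smem (a *: u + v)
}.

Inductive span_mem (k : fieldType) (V : lmodType k) (G : V -> Prop) :
    V -> Prop :=
| Span_gen u : G u -> span_mem G u
| Span_0 : span_mem G 0
| Span_lin a u v : span_mem G u -> span_mem G v -> span_mem G (a *: u + v).

Definition span (k : fieldType) (V : lmodType k) (G : V -> Prop) : submod V :=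
  Submod (@Span_0 k V G) (@Span_lin k V G).

Section Quotient.
Variables (k : fieldType) (V : lmodType k) (W : submod V).

Definition sub_pred : {pred V} := fun v => `[< W v >].

Fact sub_pred_zmod : zmod_closed sub_pred.
Proof.
split=> [|u v /asboolP Wu /asboolP Wv]; apply/asboolP; first exact: smem0.
by rewrite addrC -scaleN1r; apply: smem_lin.
Qed.
HB.instance Definition _ := GRing.isZmodClosed.Build V sub_pred sub_pred_zmod.

Definition lquot := Quotient.quot sub_pred.
HB.instance Definition _ := GRing.Zmodule.on lquot.

Definition lpi (v : V) : lquot := \pi_lquot v.

Lemma lpiP u v : lpi u = lpi v <-> W (u - v).
Proof.
split=> [/eqP|Wuv]; first by rewrite -Quotient.idealrBE => /asboolP.
by apply/eqP; rewrite -Quotient.idealrBE; apply/asboolP.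
Qed.

Lemma lpi_surj (q : lquot) : exists v, q = lpi v.
Proof. by exists (repr q); rewrite /lpi reprK. Qed.

Lemma lpi_repr v : W (repr (lpi v) - v).
Proof. by apply/lpiP; rewrite /lpi reprK. Qed.

Lemma lpiD u v : lpi (u + v) = lpi u + lpi v.
Proof. exact: raddfD. Qed.

Definition lqscale a (q : lquot) : lquot := lpi (a *: repr q).

Lemma smemZ a u : W u -> W (a *: u).
Proof. by move=> Wu; rewrite -[_ *: _]addr0; apply: smem_lin => //; exact: smem0. Qed.

Lemma lqscaleE a v : lqscale a (lpi v) = lpi (a *: v).
Proof. by apply/lpiP; rewrite -scalerBr; apply/smemZ/lpi_repr. Qed.

Fact lqscaleA a b q : lqscale a (lqscale b q) = lqscale (a * b) q.
Proof. by have [v ->] := lpi_surj q; rewrite !lqscaleE scalerA. Qed.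
Fact lqscale1 : left_id 1 lqscale.
Proof. by move=> q; have [v ->] := lpi_surj q; rewrite lqscaleE scale1r. Qed.
Fact lqscaleDr : right_distributive lqscale +%R.
Proof.
move=> a p q; have [u ->] := lpi_surj p; have [v ->] := lpi_surj q.
by rewrite -lpiD !lqscaleE -lpiD scalerDr.
Qed.
Fact lqscaleDl q : {morph lqscale^~ q : a b / a + b}.
Proof.
by move=> a b; have [u ->] := lpi_surj q; rewrite !lqscaleE -lpiD scalerDl.
Qed.

HB.instance Definition _ := GRing.Zmodule_isLmodule.Build k lquot
  lqscaleA lqscale1 lqscaleDr lqscaleDl.

Lemma lpiZ a v : lpi (a *: v) = a *: lpi v.
Proof. by rewrite -lqscaleE. Qed.

Lemma lpi_lin : linear lpi.
Proof. by move=> a u v; rewrite lpiD lpiZ. Qed.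

Lemma lpi0 v : W v -> lpi v = 0.
Proof. by rewrite -(lin0 lpi_lin) lpiP subr0. Qed.

(* The map induced on the quotient by a linear map that kills [W]. *)
Definition qlift (T : lmodType k) (h : V -> T) (q : lquot) : T := h (repr q).

Section Qlift.
Variables (T : lmodType k) (h : V -> T).
Hypotheses (lh : linear h) (h0 : forall v, W v -> h v = 0).

Lemma qliftE v : qlift h (lpi v) = h v.
Proof.
by apply/eqP; rewrite /qlift -subr_eq0 -(linB lh) h0 //; apply: lpi_repr.
Qed.

Lemma qlift_lin : linear (qlift h).
Proof.
move=> a p q; have [u ->] := lpi_surj p; have [v ->] := lpi_surj q.
by rewrite -lpi_lin !qliftE lh.
Qed.
End Qlift.
End Quotient.

Lemma span_ker (k : fieldType) (V T : lmodType k) (G : V -> Prop) (h : V -> T) :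
  linear h -> (forall v, G v -> h v = 0) -> forall v, span G v -> h v = 0.
Proof.
move=> lh h0 v; elim=> {v} [v /h0 //||a u v _ hu _ hv]; first exact: lin0.
by rewrite lh hu hv scaler0 addr0.
Qed.

Section Submodule.
Variables (k : fieldType) (V : lmodType k) (W : submod V).

Fact sub_pred_submod : submod_closed (sub_pred W).
Proof.
split=> [|a u v /asboolP Wu /asboolP Wv]; apply/asboolP; first exact: smem0.
exact: smem_lin.
Qed.
HB.instance Definition _ :=
  GRing.isSubmodClosed.Build k V (sub_pred W) sub_pred_submod.

Record subm := Subm { subm_val : V; _ : subm_val \in sub_pred W }.
HB.instance Definition _ := [isSub for subm_val].
HB.instance Definition _ := [Choice of subm by <:].
HB.instance Definition _ := [SubChoice_isSubLmodule of subm by <:].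

Definition smk (v : V) (Wv : W v) : subm :=
  Subm (introT (asboolP (W v)) Wv : v \in sub_pred W).

Lemma smkK v (Wv : W v) : val (smk Wv) = v. Proof. by []. Qed.

Lemma subm_valP (u : subm) : W (val u). Proof. exact/asboolP/(valP u). Qed.

Lemma val_lin : linear (val : subm -> V). Proof. exact: linearP. Qed.
End Submodule.

Definition ker_sub (k : fieldType) (U V : lmodType k) (f : U -> V)
    (lf : linear f) : submod U.
Proof.
exists (fun u => f u = 0); first exact: lin0.
by move=> a u v fu fv; rewrite lf fu fv scaler0 addr0.
Defined.

(* Linear extension to the free module [{malg k[K]}] of a map on the basis. *)
Section FreeModule.
Variables (k : fieldType) (K : choiceType) (V : lmodType k) (h : K -> V).

Definition mlift (g : {malg k[K]}) : V := \sum_(x <- msupp g) g@_x *: h x.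

Lemma mliftw (g : {malg k[K]}) (d : {fset K}) : (msupp g `<=` d)%fset ->
  mlift g = \sum_(x <- d) g@_x *: h x.
Proof.
move=> sgd; apply: big_fset_incl => // x _ xg.
by rewrite mcoeff_outdom // scale0r.
Qed.

Lemma mlift_lin : linear mlift.
Proof.
move=> a u v; pose d := (msupp (a *: u + v) `|` (msupp u `|` msupp v))%fset.
have sw : (msupp (a *: u + v) `<=` d)%fset by apply: fsubsetUl.
have su : (msupp u `<=` d)%fset by rewrite /d fsetUCA fsubsetUl.
have sv : (msupp v `<=` d)%fset by rewrite /d fsetUA fsubsetUr.
rewrite (mliftw sw) (mliftw su) (mliftw sv).
rewrite scaler_sumr -big_split /=; apply: eq_bigr => x _.
by rewrite mcoeffD mcoeffZ scalerDl scalerA.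
Qed.

Lemma mliftU x : mlift << x >> = h x.
Proof.
by rewrite (mliftw (msuppU_le)) big_seq_fset1 mcoeffUU scale1r.
Qed.
End FreeModule.

Lemma malg_ext (k : fieldType) (K : choiceType) (V : lmodType k)
    (f g : {malg k[K]} -> V) : linear f -> linear g ->
  (forall x, f << x >> = g << x >>) -> f =1 g.
Proof.
move=> lf lg fg u; rewrite (monalgE u) (lin_sum lf) (lin_sum lg).
apply: eq_bigr => x _.
have -> : << u@_x *g x >> = u@_x *: << x >> :> {malg k[K]}.
  by apply/malgP => y; rewrite mcoeffZ !mcoeffU mulrnAr mulr1.
by rewrite (linZ lf) (linZ lg) fg.
Qed.

Record kcat (k : fieldType) := KCat {
  ob : choiceType;
  hom : ob -> ob -> lmodType k;
  idm : forall x, hom x x;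
  comp : forall x y z, hom y z -> hom x y -> hom x z;
  comp1m : forall x y (f : hom x y), comp (idm y) f = f;
  compm1 : forall x y (f : hom x y), comp f (idm x) = f;
  compA : forall x y z t (h : hom z t) (g : hom y z) (f : hom x y),
    comp h (comp g f) = comp (comp h g) f;
  comp_linl : forall x y z (f : hom x y), linear (fun g : hom y z => comp g f);
  comp_linr : forall x y z (g : hom y z), linear (fun f : hom x y => comp g f)
}.
Arguments hom {k} A _ _ : rename.
Arguments idm {k A} x : rename.
Arguments comp {k A x y z} g f : rename.

Notation "g \oc f" := (comp g f) (at level 40, left associativity).

Record kfunctor k (A B : kcat k) := KFunctor {
  fob :> ob A -> ob B;
  fmor : forall x y, hom A x y -> hom B (fob x) (fob y);
  fmor_lin : forall x y, linear (@fmor x y);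
  fmor1 : forall x, fmor (idm x) = idm (fob x);
  fmorM : forall x y z (g : hom A y z) (f : hom A x y),
    fmor (g \oc f) = fmor g \oc fmor f
}.
Arguments fmor {k A B} F {x y} f : rename.

Program Definition fidentity k (A : kcat k) : kfunctor A A :=
  @KFunctor k A A id (fun x y f => f) _ _ _.
Next Obligation. by []. Qed.
Next Obligation. by []. Qed.
Next Obligation. by []. Qed.

Program Definition fcompose k (A B C : kcat k)
    (G : kfunctor B C) (F : kfunctor A B) : kfunctor A C :=
  @KFunctor k A C (fun x => G (F x)) (fun x y f => fmor G (fmor F f)) _ _ _.
Next Obligation. by move=> k A B C G F x y a u v; rewrite !fmor_lin. Qed.
Next Obligation. by move=> k A B C G F x /=; rewrite !fmor1. Qed.
Next Obligation. by move=> k A B C G F x y z g f /=; rewrite !fmorM. Qed.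

Definition kcat_isomorphic k (A B : kcat k) : Prop :=
  exists (F : kfunctor A B) (G : kfunctor B A),
    fcompose G F = fidentity A /\ fcompose F G = fidentity B.

Section IsoCriterion.
Variable k : fieldType.

Definition hcast (A : kcat k) x x' y y' (ex : x = x') (ey : y = y')
    (f : hom A x y) : hom A x' y' :=
  ecast z (hom A z y') ex (ecast z (hom A x z) ey f).

Lemma kfunctor_ext (A B : kcat k) (F G : kfunctor A B)
    (e : forall x, F x = G x) :
  (forall x y (f : hom A x y), hcast (e x) (e y) (fmor F f) = fmor G f) -> F = G.
Proof.
case: F G e => [F0 F1 ? ? ?] [G0 G1 ? ? ?] /= e.
have e0 : F0 = G0 by apply/funext.
subst G0 => FG; have e1 : F1 = G1.
  apply: functional_extensionality_dep => x.
  apply: functional_extensionality_dep => y.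
  apply: functional_extensionality_dep => f.
  by rewrite -FG (Prop_irrelevance (e x) erefl) (Prop_irrelevance (e y) erefl).
by subst G1; congr KFunctor; apply: Prop_irrelevance.
Qed.

Lemma kcat_isomorphic_bij (A B : kcat k) (F : kfunctor A B) :
  bijective F -> (forall x y, bijective (@fmor _ _ _ F x y)) ->
  kcat_isomorphic A B.
Proof.
case=> g Fg gF Fbij.
have exH : forall p : ob A * ob A, exists h : hom B (F p.1) (F p.2) -> hom A p.1 p.2,
    cancel (@fmor _ _ _ F p.1 p.2) h /\ cancel h (@fmor _ _ _ F p.1 p.2).
  by move=> [x y]; case: (Fbij x y) => h; exists h.
pose H p := projT1 (cid (exH p)); have HP p := projT2 (cid (exH p)).
pose G1 x y (f : hom B x y) : hom A (g x) (g y) :=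
  H (g x, g y) (hcast (esym (gF x)) (esym (gF y)) f).
have G1K x y (f : hom B x y) : fmor F (G1 x y f) = hcast (esym (gF x)) (esym (gF y)) f.
  exact: (HP (g x, g y)).2.
have finj x y : injective (@fmor _ _ _ F x y).
  by case: (Fbij x y) => h + _; apply: can_inj.
have hcl (C : kcat k) x x' y y' (ex : x = x') (ey : y = y') : linear (@hcast C x x' y y' ex ey).
  by case: _ / ex; case: _ / ey.
have hc1 (C : kcat k) x x' (ex : x = x') : hcast ex ex (idm x) = idm x' :> hom C _ _.
  by case: _ / ex.
have hcM (C : kcat k) x x' y y' z z' (ex : x = x') (ey : y = y') (ez : z = z')
   (v : hom C y z) (u : hom C x y) : hcast ex ez (v \oc u) = hcast ey ez v \oc hcast ex ey u.
  by case: _ / ex; case: _ / ey; case: _ / ez.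
have hK (C : kcat k) x x' y y' (ex : x' = x) (ey : y' = y) (f : hom C x y) :
    hcast ex ey (hcast (esym ex) (esym ey) f) = f.
  by case: _ / ex f; case: _ / ey.
have GL x y : linear (G1 x y).
  by move=> a u v; apply: finj; rewrite fmor_lin !G1K hcl.
have G11 x : G1 x x (idm x) = idm (g x) by apply: finj; rewrite G1K hc1 fmor1.
have G1M x y z (v : hom B y z) (u : hom B x y) : G1 x z (v \oc u) = G1 y z v \oc G1 x y u.
  by apply: finj; rewrite fmorM !G1K -hcM.
pose G := KFunctor GL G11 G1M; exists F, G; split.
  apply: (@kfunctor_ext _ _ (fcompose G F) (fidentity A) Fg) => x y f /=; apply: finj.
  have cF x' y' (ex : g (F x) = x') (ey : g (F y) = y') (h : hom A (g (F x)) (g (F y))) :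
    fmor F (hcast ex ey h) = hcast (congr1 F ex) (congr1 F ey) (fmor F h).
    by case: _ / ex; case: _ / ey.
  rewrite cF G1K (Prop_irrelevance (congr1 F (Fg x)) (gF (F x))).
  rewrite (Prop_irrelevance (congr1 F (Fg y)) (gF (F y))).
  exact: hK.
apply: (@kfunctor_ext _ _ (fcompose F G) (fidentity B) gF) => x y f /=; rewrite G1K.
exact: hK.
Qed.
End IsoCriterion.

Section FullSubcategory.
Variables (k : fieldType) (A : kcat k) (P : pred (ob A)).

Definition full_subcat : kcat k := @KCat k {x | P x}
  (fun x y => hom A (val x) (val y)) (fun x => idm (val x))
  (fun x y z g f => g \oc f)
  (fun x y f => comp1m f) (fun x y f => compm1 f)
  (fun x y z t h g f => compA h g f)
  (fun x y z f => @comp_linl k A _ _ _ f)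
  (fun x y z g => @comp_linr k A _ _ _ g).
End FullSubcategory.

Section Ideal.
Variables (k : fieldType) (A : kcat k).

Record ideal := Ideal {
  imem :> forall x y, submod (hom A x y);
  imem_l : forall x y z (g : hom A y z) (f : hom A x y),
    imem x y f -> imem x z (g \oc f);
  imem_r : forall x y z (g : hom A y z) (f : hom A x y),
    imem y z g -> imem x z (g \oc f)
}.

Inductive gen_ideal_mem (G : forall x y, hom A x y -> Prop) :
    forall x y, hom A x y -> Prop :=
| Gi_gen x y (f : hom A x y) : G x y f -> gen_ideal_mem G f
| Gi_0 x y : gen_ideal_mem G (0 : hom A x y)
| Gi_lin x y a (f g : hom A x y) :
    gen_ideal_mem G f -> gen_ideal_mem G g -> gen_ideal_mem G (a *: f + g)
| Gi_l x y z (g : hom A y z) (f : hom A x y) :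
    gen_ideal_mem G f -> gen_ideal_mem G (g \oc f)
| Gi_r x y z (g : hom A y z) (f : hom A x y) :
    gen_ideal_mem G g -> gen_ideal_mem G (g \oc f).

Definition gen_ideal (G : forall x y, hom A x y -> Prop) : ideal :=
  @Ideal (fun x y => Submod (@Gi_0 G x y) (@Gi_lin G x y))
    (@Gi_l G) (@Gi_r G).

Variable I : ideal.

Definition qhom x y : lmodType k := lquot (I x y).

Definition qcomp x y z (g : qhom y z) (f : qhom x y) : qhom x z :=
  lpi (I x z) (repr g \oc repr f).

Lemma qcompE x y z (g : hom A y z) (f : hom A x y) :
  qcomp (lpi (I y z) g) (lpi (I x y) f) = lpi (I x z) (g \oc f).
Proof.
apply/lpiP; set g' := repr _; set f' := repr _.
have -> : g' \oc f' - g \oc f = 1 *: (g' \oc (f' - f)) + (g' - g) \oc f.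
  rewrite scale1r (linB (@comp_linr _ _ _ _ _ g')).
  by rewrite (linB (@comp_linl _ _ _ _ _ f)) addrA subrK.
by apply: smem_lin; [apply: imem_l | apply: imem_r]; apply: lpi_repr.
Qed.

Program Definition quot_cat : kcat k :=
  @KCat k (ob A) qhom (fun x => lpi (I x x) (idm x)) qcomp _ _ _ _ _.
Next Obligation.
by move=> x y q; have [f ->] := lpi_surj q; rewrite qcompE comp1m.
Qed.
Next Obligation.
by move=> x y q; have [f ->] := lpi_surj q; rewrite qcompE compm1.
Qed.
Next Obligation.
move=> x y z t q3 q2 q1; have [h ->] := lpi_surj q3.
by have [g ->] := lpi_surj q2; have [f ->] := lpi_surj q1; rewrite !qcompE compA.
Qed.
Next Obligation.
move=> x y z q1 a q2 q3; have [f ->] := lpi_surj q1.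
have [g ->] := lpi_surj q2; have [h ->] := lpi_surj q3.
by rewrite -lpi_lin !qcompE (@comp_linl _ _ _ _ _ f) lpi_lin.
Qed.
Next Obligation.
move=> x y z q1 a q2 q3; have [f ->] := lpi_surj q1.
have [g ->] := lpi_surj q2; have [h ->] := lpi_surj q3.
by rewrite -lpi_lin !qcompE (@comp_linr _ _ _ _ _ f) lpi_lin.
Qed.
End Ideal.

Record wide_subcat k (A : kcat k) := WideSubcat {
  wmem :> forall x y, submod (hom A x y);
  wmem1 : forall x, wmem x x (idm x);
  wmemM : forall x y z (g : hom A y z) (f : hom A x y),
    wmem y z g -> wmem x y f -> wmem x z (g \oc f)
}.

Inductive gen_subcat_mem k (A : kcat k) (G : forall x y, hom A x y -> Prop) :
    forall x y, hom A x y -> Prop :=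
| Gs_gen x y (f : hom A x y) : G x y f -> gen_subcat_mem G f
| Gs_1 x : gen_subcat_mem G (idm x)
| Gs_0 x y : gen_subcat_mem G (0 : hom A x y)
| Gs_lin x y a (f g : hom A x y) :
    gen_subcat_mem G f -> gen_subcat_mem G g -> gen_subcat_mem G (a *: f + g)
| Gs_comp x y z (g : hom A y z) (f : hom A x y) :
    gen_subcat_mem G g -> gen_subcat_mem G f -> gen_subcat_mem G (g \oc f).

Definition gen_subcat k (A : kcat k) (G : forall x y, hom A x y -> Prop) :
    wide_subcat A :=
  @WideSubcat k A (fun x y => Submod (@Gs_0 k A G x y) (@Gs_lin k A G x y))
    (@Gs_1 k A G) (@Gs_comp k A G).

Inductive is_idm k (A : kcat k) : forall x y, hom A x y -> Prop :=
| Is_idm x : is_idm (idm x).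

Definition discrete_subcat k (A : kcat k) : wide_subcat A :=
  gen_subcat (@is_idm k A).

(* [bhom c a] is contravariant in [c] and covariant in [a]. *)
Record bimod k (A : kcat k) := Bimod {
  bhom :> ob A -> ob A -> lmodType k;
  lact : forall c a a', hom A a a' -> bhom c a -> bhom c a';
  ract : forall c c' a, bhom c a -> hom A c' c -> bhom c' a;
  lact1 : forall c a (x : bhom c a), lact (idm a) x = x;
  lactM : forall c a a' a'' (g : hom A a' a'') (f : hom A a a') (x : bhom c a),
    lact g (lact f x) = lact (g \oc f) x;
  ract1 : forall c a (x : bhom c a), ract x (idm c) = x;
  ractM : forall c c' c'' a (x : bhom c a) (g : hom A c' c) (f : hom A c'' c'),
    ract (ract x g) f = ract x (g \oc f);
  lractA : forall c c' a a' (g : hom A a a') (x : bhom c a) (f : hom A c' c),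
    lact g (ract x f) = ract (lact g x) f;
  lact_linl : forall c a a' (x : bhom c a),
    linear (fun g : hom A a a' => lact g x);
  lact_linr : forall c a a' (g : hom A a a'),
    linear (fun x : bhom c a => lact g x);
  ract_linl : forall c c' a (f : hom A c' c),
    linear (fun x : bhom c a => ract x f);
  ract_linr : forall c c' a (x : bhom c a),
    linear (fun f : hom A c' c => ract x f)
}.
Arguments lact {k A} X {c a a'} g x : rename.
Arguments ract {k A} X {c c' a} x f : rename.

Record bimod_mor k (A : kcat k) (X Y : bimod A) := BimodMor {
  bmor :> forall c a, X c a -> Y c a;
  bmor_lin : forall c a, linear (@bmor c a);
  bmor_l : forall c a a' (g : hom A a a') (x : X c a),
    bmor (lact X g x) = lact Y g (bmor x);
  bmor_r : forall c c' a (x : X c a) (f : hom A c' c),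
    bmor (ract X x f) = ract Y (bmor x) f
}.
Arguments bmor {k A X Y} _ {c a} _.

Definition regular k (A : kcat k) : bimod A :=
  @Bimod k A (hom A) (fun c a a' g x => g \oc x) (fun c c' a x f => x \oc f)
    (fun c a x => comp1m x) (fun c a a' a'' g f x => compA g f x)
    (fun c a x => compm1 x) (fun c c' c'' a x g f => esym (compA x g f))
    (fun c c' a a' g x f => compA g x f)
    (fun c a a' x => @comp_linl _ _ _ _ _ x)
    (fun c a a' g => @comp_linr _ _ _ _ _ g)
    (fun c c' a f => @comp_linl _ _ _ _ _ f)
    (fun c c' a x => @comp_linr _ _ _ _ _ x).

Section Tensor.
Variables (k : fieldType) (A : kcat k) (B : wide_subcat A) (X Y : bimod A).

(* [(X (x)_B Y)(c,a)], presented by the generators [x (x) y], where [x] is in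
   [X(b,a)] and [y] in [Y(c,b)], [b] being any object, and the relations of
   bilinearity (which present the direct sum over [b] of the tensor products
   over [k]) together with [xf (x) y = x (x) fy] for [f] in [B(b1,b2)]. *)
Definition tgen (c a : ob A) := {b : ob A & (X b a * Y c b)%type}.

Definition tsym c a b (x : X b a) (y : Y c b) : {malg k[tgen c a]} :=
  << Tagged (fun b => (X b a * Y c b)%type) (x, y) >>.

Inductive trel c a : {malg k[tgen c a]} -> Prop :=
| Trel_linl b t (x x' : X b a) (y : Y c b) :
    trel (tsym (t *: x + x') y - (t *: tsym x y + tsym x' y))
| Trel_linr b t (x : X b a) (y y' : Y c b) :
    trel (tsym x (t *: y + y') - (t *: tsym x y + tsym x y'))
| Trel_bal b1 b2 (f : hom A b1 b2) (x : X b2 a) (y : Y c b1) :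
    B b1 b2 f -> trel (tsym (ract X x f) y - tsym x (lact Y f y)).

Definition thom c a : lmodType k := lquot (span (@trel c a)).

Definition tens c a b (x : X b a) (y : Y c b) : thom c a :=
  lpi (span (@trel c a)) (tsym x y).

Lemma tens_linl c a b (y : Y c b) : linear (fun x : X b a => tens x y).
Proof.
by move=> t x x'; rewrite -lpi_lin; apply/lpiP/Span_gen/Trel_linl.
Qed.

Lemma tens_linr c a b (x : X b a) : linear (fun y : Y c b => tens x y).
Proof.
by move=> t y y'; rewrite -lpi_lin; apply/lpiP/Span_gen/Trel_linr.
Qed.

Lemma tens_bal c a b1 b2 (f : hom A b1 b2) (x : X b2 a) (y : Y c b1) :
  B b1 b2 f -> tens (ract X x f) y = tens x (lact Y f y).
Proof. by move=> Bf; apply/lpiP/Span_gen/Trel_bal. Qed.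

Section Lift.
Variables (c a : ob A) (V : lmodType k) (h : forall b, X b a -> Y c b -> V).

(* The linear map with [x (x) y |-> h x y], for a balanced bilinear [h]. *)
Definition tlift : thom c a -> V :=
  qlift (mlift (fun s : tgen c a => h (tagged s).1 (tagged s).2)).

Definition balanced := [/\ forall b y, linear (fun x => @h b x y),
  forall b x, linear (@h b x) & forall b1 b2 (f : hom A b1 b2) x y,
    B b1 b2 f -> h (ract X x f) y = h x (lact Y f y)].

Hypothesis hP : balanced.

Lemma tlift_ker v : span (@trel c a) v ->
  mlift (fun s : tgen c a => h (tagged s).1 (tagged s).2) v = 0.
Proof.
have lm := mlift_lin (fun s : tgen c a => h (tagged s).1 (tagged s).2).
apply: span_ker => // {}v; case: hP => hl hr hb.
case=> [b t x x' y|b t x y y'|b1 b2 f x y Bf];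
  rewrite (linB lm) ?lm ?mliftU /=.
- by rewrite hl subrr.
- by rewrite hr subrr.
- by rewrite hb // subrr.
Qed.

Lemma tliftE b (x : X b a) (y : Y c b) : tlift (tens x y) = h x y.
Proof.
by rewrite /tlift qliftE ?mliftU //; [exact: mlift_lin | exact: tlift_ker].
Qed.

Lemma tlift_lin : linear tlift.
Proof. by apply: qlift_lin; [exact: mlift_lin | exact: tlift_ker]. Qed.
End Lift.

Lemma tens_ext c a (V : lmodType k) (f g : thom c a -> V) :
  linear f -> linear g ->
  (forall b (x : X b a) (y : Y c b), f (tens x y) = g (tens x y)) -> f =1 g.
Proof.
move=> lf lg fg q; have [v ->] := lpi_surj q; move: v.
apply: malg_ext => [t u v|t u v|[b [x y]]].
- by rewrite lpi_lin lf.
- by rewrite lpi_lin lg.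
- exact: fg.
Qed.

Lemma linear_id (V : lmodType k) : linear (fun x : V => x).
Proof. by []. Qed.

Lemma linear_comp (U V W : lmodType k) (f : V -> W) (g : U -> V) :
  linear f -> linear g -> linear (fun x => f (g x)).
Proof. by move=> lf lg a u v; rewrite lg lf. Qed.

Definition tlact c a a' (g : hom A a a') : thom c a -> thom c a' :=
  tlift (fun b x y => tens (lact X g x) y).
Definition tract c c' a (q : thom c a) (f : hom A c' c) : thom c' a :=
  tlift (fun b x y => tens x (ract Y y f)) q.

Fact tlact_bal c a a' (g : hom A a a') :
  @balanced c a _ (fun b x y => tens (lact X g x) y).
Proof.
split=> [b y|b x|b1 b2 f x y Bf].
- exact: linear_comp (@tens_linl _ _ _ _) (@lact_linr _ _ _ _ _ _ _).
- exact: tens_linr.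
- by rewrite lractA tens_bal.
Qed.

Fact tract_bal c c' a (f : hom A c' c) :
  @balanced c a _ (fun b x y => tens x (ract Y y f)).
Proof.
split=> [b y|b x|b1 b2 g x y Bf].
- exact: tens_linl.
- exact: linear_comp (@tens_linr _ _ _ _) (@ract_linl _ _ _ _ _ _ _).
- by rewrite tens_bal // lractA.
Qed.

Lemma tlactE c a a' (g : hom A a a') b (x : X b a) (y : Y c b) :
  tlact g (tens x y) = tens (lact X g x) y.
Proof. by rewrite /tlact (tliftE (tlact_bal _ g)). Qed.

Lemma tractE c c' a (f : hom A c' c) b (x : X b a) (y : Y c b) :
  tract (tens x y) f = tens x (ract Y y f).
Proof. by rewrite /tract (tliftE (tract_bal _ f)). Qed.

Lemma tlact_lin c a a' (g : hom A a a') : linear (@tlact c a a' g).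
Proof. exact: tlift_lin (tlact_bal _ g). Qed.

Lemma tract_lin c c' a (f : hom A c' c) : linear (fun q : thom c a => tract q f).
Proof. exact: tlift_lin (tract_bal _ f). Qed.

Lemma linear_pencil (U V : lmodType k) (t : k) (f g : U -> V) :
  linear f -> linear g -> linear (fun u => t *: f u + g u).
Proof.
move=> lf lg s u v; rewrite lf lg !scalerDr !scalerA mulrC.
by rewrite !addrA; congr (_ + _); rewrite -!addrA; congr (_ + _); rewrite addrC.
Qed.

Program Definition tensor : bimod A :=
  @Bimod k A thom tlact tract _ _ _ _ _ _ _ _ _.
Next Obligation.
move=> c a; apply: tens_ext => [||b x y]; [exact: tlact_lin|by []|].
by rewrite tlactE lact1.
Qed.
Next Obligation.
move=> c a a' a'' g f; apply: tens_ext => [||b x y].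
- exact: linear_comp (@tlact_lin _ _ _ _) (@tlact_lin _ _ _ _).
- exact: tlact_lin.
- by rewrite !tlactE lactM.
Qed.
Next Obligation.
move=> c a; apply: tens_ext => [||b x y]; [exact: tract_lin|by []|].
by rewrite tractE ract1.
Qed.
Next Obligation.
move=> c c' c'' a q g f; move: q; apply: tens_ext => [||b x y].
- exact: linear_comp (@tract_lin _ _ _ _) (@tract_lin _ _ _ _).
- exact: tract_lin.
- by rewrite !tractE ractM.
Qed.
Next Obligation.
move=> c c' a a' g q f; move: q; apply: tens_ext => [||b x y].
- exact: linear_comp (@tlact_lin _ _ _ _) (@tract_lin _ _ _ _).
- exact: linear_comp (@tract_lin _ _ _ _) (@tlact_lin _ _ _ _).
- by rewrite tractE !tlactE tractE.
Qed.
Next Obligation.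
move=> c a a' q t g g'; move: q; apply: tens_ext => [||b x y].
- exact: tlact_lin.
- by apply: linear_pencil; apply: tlact_lin.
- by rewrite !tlactE (@lact_linl _ _ X _ _ _ x) (@tens_linl _ _ _ y).
Qed.
Next Obligation. by move=> c a a' g; apply: tlact_lin. Qed.
Next Obligation. by move=> c c' a f; apply: tract_lin. Qed.
Next Obligation.
move=> c c' a q t g g'; move: q; apply: tens_ext => [||b x y].
- exact: tract_lin.
- by apply: linear_pencil; apply: tract_lin.
- by rewrite !tractE (@ract_linr _ _ Y _ _ _ y) (@tens_linr _ _ _ x).
Qed.
End Tensor.

Section TensorMap.
Variables (k : fieldType) (A : kcat k) (B : wide_subcat A) (X Y Y' : bimod A).
Variable phi : bimod_mor Y Y'.

Definition tmap_fun c a : tensor B X Y c a -> tensor B X Y' c a :=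
  @tlift k A B X Y c a _ (fun b x y => tens B x (phi c b y)).

Fact tmap_bal c a : @balanced k A B X Y c a (tensor B X Y' c a)
  (fun b x y => tens B x (phi c b y)).
Proof.
split=> [b y|b x|b1 b2 f x y Bf].
- exact: tens_linl.
- exact: linear_comp (@tens_linr _ _ _ _ _ _ _ _ _) (@bmor_lin _ _ _ _ _ _ _).
- by rewrite tens_bal // bmor_l.
Qed.

Lemma tmap_funE c a b (x : X b a) (y : Y c b) :
  tmap_fun (tens B x y) = tens B x (phi c b y).
Proof. by rewrite /tmap_fun (tliftE (@tmap_bal c a)). Qed.

Lemma tmap_fun_lin c a : linear (@tmap_fun c a).
Proof. exact: tlift_lin (@tmap_bal c a). Qed.

(* The map id (x) phi. *)
Program Definition tmap : bimod_mor (tensor B X Y) (tensor B X Y') :=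
  @BimodMor k A _ _ tmap_fun tmap_fun_lin _ _.
Next Obligation.
move=> c a a' g; apply: tens_ext => [||b x y].
- exact: linear_comp (@tmap_fun_lin _ _) (@tlact_lin _ _ _ _ _ _ _ _ _).
- exact: linear_comp (@tlact_lin _ _ _ _ _ _ _ _ _) (@tmap_fun_lin _ _).
- by rewrite /= tlactE !tmap_funE tlactE.
Qed.
Next Obligation.
move=> c c' a q f; move: q; apply: tens_ext => [||b x y].
- exact: linear_comp (@tmap_fun_lin _ _) (@tract_lin _ _ _ _ _ _ _ _ _).
- exact: linear_comp (@tract_lin _ _ _ _ _ _ _ _ _) (@tmap_fun_lin _ _).
- by rewrite /= tractE !tmap_funE tractE bmor_r.
Qed.
End TensorMap.

Section Multiplication.
Variables (k : fieldType) (A : kcat k) (B : wide_subcat A).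

Definition mu_fun c a : tensor B (regular A) (regular A) c a -> regular A c a :=
  @tlift k A B (regular A) (regular A) c a (regular A c a)
    (fun b (x : hom A b a) (y : hom A c b) => x \oc y).

Fact mu_bal c a : @balanced k A B (regular A) (regular A) c a (regular A c a)
  (fun b (x : hom A b a) (y : hom A c b) => x \oc y).
Proof.
split=> [b y|b x|b1 b2 f x y Bf]; [exact: comp_linl | exact: comp_linr |].
by rewrite /= compA.
Qed.

Lemma mu_funE c a b (x : hom A b a) (y : hom A c b) :
  mu_fun (@tens k A B (regular A) (regular A) c a b x y) = x \oc y.
Proof. by rewrite /mu_fun (tliftE (@mu_bal c a)). Qed.

Lemma mu_fun_lin c a : linear (@mu_fun c a).
Proof. exact: tlift_lin (@mu_bal c a). Qed.

Program Definition mu :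
    bimod_mor (tensor B (regular A) (regular A)) (regular A) :=
  @BimodMor k A _ _ mu_fun mu_fun_lin _ _.
Next Obligation.
move=> c a a' g; apply: tens_ext => [||b x y].
- exact: linear_comp (@mu_fun_lin _ _) (@tlact_lin _ _ _ _ _ _ _ _ _).
- exact: linear_comp (@comp_linr _ _ _ _ _ _) (@mu_fun_lin _ _).
- by rewrite /= tlactE !mu_funE compA.
Qed.
Next Obligation.
move=> c c' a q f; move: q; apply: tens_ext => [||b x y].
- exact: linear_comp (@mu_fun_lin _ _) (@tract_lin _ _ _ _ _ _ _ _ _).
- exact: linear_comp (@comp_linl _ _ _ _ _ _) (@mu_fun_lin _ _).
- by rewrite /= tractE !mu_funE compA.
Qed.
End Multiplication.

Section Kernel.
Variables (k : fieldType) (A : kcat k) (X Y : bimod A) (phi : bimod_mor X Y).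

Definition bker_hom c a : lmodType k := subm (ker_sub (@bmor_lin _ _ _ _ phi c a)).

Fact bker_lact_subproof c a a' (g : hom A a a') (x : bker_hom c a) :
  phi c a' (lact X g (val x)) = 0.
Proof. by rewrite bmor_l (subm_valP x) (lin0 (@lact_linr _ _ Y _ _ _ g)). Qed.

Fact bker_ract_subproof c c' a (x : bker_hom c a) (f : hom A c' c) :
  phi c' a (ract X (val x) f) = 0.
Proof. by rewrite bmor_r (subm_valP x) (lin0 (@ract_linl _ _ Y _ _ _ f)). Qed.

Definition bker_lact c a a' (g : hom A a a') (x : bker_hom c a) : bker_hom c a' :=
  @smk _ _ (ker_sub (@bmor_lin _ _ _ _ phi c a')) _ (bker_lact_subproof g x).

Definition bker_ract c c' a (x : bker_hom c a) (f : hom A c' c) : bker_hom c' a :=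
  @smk _ _ (ker_sub (@bmor_lin _ _ _ _ phi c' a)) _ (bker_ract_subproof x f).

Program Definition bker : bimod A :=
  @Bimod k A bker_hom bker_lact bker_ract _ _ _ _ _ _ _ _ _.
Next Obligation. by move=> *; apply: val_inj; rewrite /= lact1. Qed.
Next Obligation. by move=> *; apply: val_inj; rewrite /= lactM. Qed.
Next Obligation. by move=> *; apply: val_inj; rewrite /= ract1. Qed.
Next Obligation. by move=> *; apply: val_inj; rewrite /= ractM. Qed.
Next Obligation. by move=> *; apply: val_inj; rewrite /= lractA. Qed.
Next Obligation.
move=> c a a' x t g g'; apply: val_inj; rewrite [RHS]val_lin.
exact: (@lact_linl _ _ X _ _ _ (val x)).
Qed.
Next Obligation.
move=> c a a' g t x x'; apply: val_inj; rewrite [RHS]val_lin.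
exact: (@lact_linr _ _ X _ _ _ g).
Qed.
Next Obligation.
move=> c c' a f t x x'; apply: val_inj; rewrite [RHS]val_lin.
exact: (@ract_linl _ _ X _ _ _ f).
Qed.
Next Obligation.
move=> c c' a x t g g'; apply: val_inj; rewrite [RHS]val_lin.
exact: (@ract_linr _ _ X _ _ _ (val x)).
Qed.
End Kernel.

(* Transport between the members of a family of modules, extended by 0. *)
Section IndexCast.
Variables (k : fieldType) (F : nat -> lmodType k).

Definition icast m n (u : F m) : F n :=
  match m =P n with
  | ReflectT e => ecast i (F i) e u
  | ReflectF _ => 0
  end.

Lemma icast_id m (u : F m) : icast m u = u.
Proof. by rewrite /icast; case: eqP => // e; rewrite eq_axiomK. Qed.

Lemma icast_lin m n : linear (@icast m n).
Proof.
move=> a u v; rewrite /icast; case: eqP => [e|_]; last by rewrite scaler0 addr0.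
by case: _ / e.
Qed.

Lemma icast0 m n : icast n (0 : F m) = 0.
Proof. exact: lin0 (@icast_lin m n). Qed.

Lemma icast_trans m n p (u : F m) : m = n -> icast p (icast n u) = icast p u.
Proof. by move=> e; case: _ / e; rewrite icast_id. Qed.
End IndexCast.
Arguments icast {k} F {m} n u.

Lemma icast_nat (k : fieldType) (F G : nat -> lmodType k) (s : nat -> nat)
    (h : forall m, F m -> G (s m)) m n (u : F m) :
  m = n -> h n (icast F n u) = icast G (s n) (h m u).
Proof. by move=> e; case: _ / e; rewrite !icast_id. Qed.

Section Powers.
Variables (k : fieldType) (A : kcat k) (B : wide_subcat A).

(* Indices are shifted by one: [tpow m] is the tensor power of exponent [m+1]
   of the regular bimodule over [B], [mu_last m] the map id^m (x) mu from
   [tpow m.+1] to [tpow m], and [tker m] the bimodule X_{m+1}. *)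
Fixpoint tpow m : bimod A :=
  if m is m'.+1 then tensor B (regular A) (tpow m') else regular A.

Fixpoint mu_last m : bimod_mor (tpow m.+1) (tpow m) :=
  match m with
  | 0 => mu B
  | m'.+1 => tmap B (regular A) (mu_last m')
  end.

Definition tker m : bimod A :=
  if m is m'.+1 then bker (mu_last m') else regular A.

(* Concatenation of tensors, multiplying the last factor of the first one with
   the first factor of the second one:
   (f_0 (x) .. (x) f_m) . (g_0 (x) .. (x) g_m')
     = f_0 (x) .. (x) (f_m g_0) (x) .. (x) g_m'. *)
Fixpoint pmul m m' {a b c} : tpow m b a -> tpow m' c b -> tpow (m + m') c a :=
  match m return tpow m b a -> tpow m' c b -> tpow (m + m') c a with
  | 0 => fun f t => lact (tpow m') f t
  | n.+1 => fun s t =>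
      @tlift k A B (regular A) (tpow n) b a (tpow (n.+1 + m') c a)
        (fun d (f : hom A d a) (s' : tpow n b d) =>
           @tens k A B (regular A) (tpow (n + m')) c a d f (pmul s' t)) s
  end.

Local Notation tn m := (@tens k A B (regular A) (tpow m) _ _ _) (only parsing).

Lemma pmul_lact_lin m m' c b (t : tpow m' c b) :
  (forall a, linear (fun s : tpow m b a => pmul s t)) /\
  (forall a a' (g : hom A a a') (s : tpow m b a),
     pmul (lact _ g s) t = lact _ g (pmul s t)) /\
  (forall a, if m is n.+1 then
     @balanced k A B (regular A) (tpow n) b a (tpow (n.+1 + m') c a)
       (fun d (f : hom A d a) (s' : tpow n b d) =>
         @tens k A B (regular A) (tpow (n + m')) c a d f (pmul s' t))
     else True).
Proof.
elim: m => [|m [IHlin [IHact _]]].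
  by split=> [a|]; [exact: lact_linl | split=> // a a' g s; rewrite /= lactM].
have bal a : @balanced k A B (regular A) (tpow m) b a (tpow (m.+1 + m') c a)
    (fun d (f : hom A d a) (s' : tpow m b d) =>
      @tens k A B (regular A) (tpow (m + m')) c a d f (pmul s' t)).
  split=> [d y|d x|b1 b2 f x y Bf].
  - exact: tens_linl.
  - exact: linear_comp (@tens_linr _ _ _ _ _ _ _ _ _) (IHlin _).
  - by rewrite tens_bal // IHact.
split; [|split] => [a|a a' g|//]; first exact: tlift_lin (bal a).
apply: tens_ext => [||d x y].
- exact: linear_comp (tlift_lin (bal a')) (@tlact_lin _ _ _ _ _ _ _ _ _).
- exact: linear_comp (@tlact_lin _ _ _ _ _ _ _ _ _) (tlift_lin (bal a)).
- by rewrite /= tlactE (tliftE (bal _)) (tliftE (bal _)) tlactE.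
Qed.

Lemma pmul_linl m m' a b c (t : tpow m' c b) :
  linear (fun s : tpow m b a => pmul s t).
Proof. by case: (pmul_lact_lin m t). Qed.

Lemma pmul_lact m m' a a' b c (g : hom A a a') (s : tpow m b a)
  (t : tpow m' c b) : pmul (lact _ g s) t = lact _ g (pmul s t).
Proof. by case: (pmul_lact_lin m t) => _ []. Qed.

Lemma pmul_tens m m' a b c d (f : hom A d a) (s : tpow m b d)
    (t : tpow m' c b) :
  @pmul m.+1 m' a b c (tn m f s) t = tn (m + m') f (pmul s t).
Proof. by case: (pmul_lact_lin m.+1 t) => _ [_ bal]; rewrite /= (tliftE (bal a)). Qed.

Lemma pmul_linr m m' a b c (s : tpow m b a) :
  linear (fun t : tpow m' c b => pmul s t).
Proof.
elim: m a s => [|m IH] a s; first exact: lact_linr.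
move=> u t t'; move: s; apply: tens_ext => [||d x y].
- exact: (@pmul_linl m.+1).
- by apply: linear_pencil; apply: (@pmul_linl m.+1).
- by rewrite !pmul_tens IH (@tens_linr _ _ _ _ _ _ _ _ x).
Qed.

Lemma pmul_mid m m' a b b' c (s : tpow m b a) (g : hom A b' b)
    (t : tpow m' c b') : pmul (ract _ s g) t = pmul s (lact _ g t).
Proof.
elim: m a s => [|m IH] a s; first by rewrite /= lactM.
move: s; apply: tens_ext => [||d x y].
- exact: linear_comp (@pmul_linl _.+1 _ _ _ _ _) (@tract_lin _ _ _ _ _ _ _ _ _).
- exact: (@pmul_linl m.+1).
- by rewrite pmul_tens -IH -pmul_tens /= tractE.
Qed.

Lemma pmulA m m' m'' a b c d (s : tpow m b a) (t : tpow m' c b)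
    (u : tpow m'' d c) :
  pmul (pmul s t) u =
  icast (fun i => tpow i d a) (m + m' + m'') (pmul s (pmul t u)).
Proof.
elim: m a s => [|m IH] a s; first by rewrite icast_id pmul_lact.
move: s; apply: tens_ext => [||e x y].
- exact: linear_comp (@pmul_linl _.+1 _ _ _ _ _) (@pmul_linl _.+1 _ _ _ _ _).
- exact: linear_comp (@icast_lin _ _ _ _) (@pmul_linl _.+1 _ _ _ _ _).
- rewrite !pmul_tens IH.
  exact: (@icast_nat k (fun i => tpow i d e) (fun i => tpow i d a) S
    (fun i v => @tens k A B (regular A) (tpow i) d a e x v) _ _ _ (addnA _ _ _)).
Qed.

Lemma pmul1 m a c (s : tpow m c a) :
  @pmul m 0 a c c s (idm c) = icast (fun i => tpow i c a) (m + 0) s.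
Proof.
elim: m a s => [|m IH] a s; first by rewrite icast_id /= compm1.
move: s; apply: tens_ext => [||e x y].
- exact: (@pmul_linl m.+1).
- exact: icast_lin.
- rewrite pmul_tens IH.
  exact: (@icast_nat k (fun i => tpow i c e) (fun i => tpow i c a) S
    (fun i v => @tens k A B (regular A) (tpow i) c a e x v)
    _ _ _ (esym (addn0 _))).
Qed.

Definition in_tker m c a : tpow m c a -> Prop :=
  if m is m'.+1 then fun s => mu_last m' c a s = 0 else fun=> True.

Definition tker_val m c a : tker m c a -> tpow m c a :=
  match m with 0 => id | _.+1 => fun s => val s end.

Definition tker_mk m c a : forall s : tpow m c a, in_tker s -> tker m c a :=
  match m with
  | 0 => fun s _ => s
  | m'.+1 => fun s => @smk k _ (ker_sub (@bmor_lin _ _ _ _ (mu_last m') c a)) s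
  end.

Lemma tker_valP m c a (s : tker m c a) : in_tker (tker_val s).
Proof. by case: m s => [//|m] s; apply: (subm_valP s). Qed.

Lemma tker_mkK m c a (s : tpow m c a) (sP : in_tker s) :
  tker_val (tker_mk sP) = s.
Proof. by case: m s sP. Qed.

Lemma tker_val_inj m c a : injective (@tker_val m c a).
Proof. by case: m => [s t|m]; last exact: val_inj. Qed.

Lemma tker_val_lin m c a : linear (@tker_val m c a).
Proof. by case: m => [//|m]; apply: val_lin. Qed.

Lemma mu_last_pmul_lin m m' a b c (t : tpow m' c b) :
  linear (fun s : tpow m.+1 b a => mu_last (m + m') c a (pmul s t)).
Proof.
exact: (@linear_comp k (tpow m.+1 b a) (tpow (m + m').+1 c a)
  (tpow (m + m') c a) (fun q => mu_last (m + m') c a q)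
  (fun s => @pmul m.+1 m' a b c s t)
  (@bmor_lin k A _ _ (mu_last (m + m')) c a) (@pmul_linl m.+1 m' a b c t)).
Qed.

Lemma pmul_mu_last_lin m m' a b c (t : tpow m' c b) :
  linear (fun s : tpow m.+1 b a => pmul (mu_last m b a s) t).
Proof.
exact: (@linear_comp k (tpow m.+1 b a) (tpow m b a) (tpow (m + m') c a)
  (fun q => @pmul m m' a b c q t) (fun s => mu_last m b a s)
  (@pmul_linl m m' a b c t) (@bmor_lin k A _ _ (mu_last m) b a)).
Qed.

Lemma mu_last_pmulS m n a b c (s : tpow m.+1 b a) (t : tpow n.+1 c b) :
  mu_last n c b t = 0 -> mu_last (m + n.+1) c a (pmul s t) = 0.
Proof.
move=> t0; elim: m a s => [|m IH] a; apply: tens_ext.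
- exact: (@mu_last_pmul_lin 0).
- by move=> u x y; rewrite scaler0 addr0.
- move=> d x y; rewrite pmul_tens /= tmap_funE bmor_l t0.
  by rewrite (lin0 (@lact_linr _ _ _ _ _ _ y)) (lin0 (@tens_linr _ _ _ _ _ _ _ _ x)).
- exact: (@mu_last_pmul_lin m.+1).
- by move=> u x y; rewrite scaler0 addr0.
- move=> d x y; rewrite pmul_tens [mu_last _]/= /= tmap_funE.
  by rewrite IH (lin0 (@tens_linr _ _ _ _ _ _ _ _ x)).
Qed.

Lemma mu_last_pmul0 m a b c (s : tpow m.+1 b a) (t : tpow 0 c b) :
  mu_last (m + 0) c a (pmul s t) = pmul (mu_last m b a s) t.
Proof.
elim: m a s => [|m IH] a; apply: tens_ext.
- exact: (@mu_last_pmul_lin 0).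
- exact: (@pmul_mu_last_lin 0 0 a b c t).
- by move=> d x y; rewrite pmul_tens /= !mu_funE compA.
- exact: (@mu_last_pmul_lin m.+1).
- exact: (@pmul_mu_last_lin m.+1 0 a b c t).
- move=> d x y; rewrite pmul_tens [mu_last (m.+1 + 0)]/= [mu_last m.+1]/=.
  by rewrite [LHS]tmap_funE IH -pmul_tens /= tmap_funE.
Qed.

Lemma in_tker_pmul m m' a b c (s : tpow m b a) (t : tpow m' c b) :
  in_tker s -> in_tker t -> in_tker (pmul s t).
Proof.
case: m s => [|m] s; case: m' t => [|m'] t s0 t0; first by [].
- have t1 : mu_last m' c b t = 0 := t0.
  change (mu_last m' c a (lact (tpow m'.+1) s t) = 0).
  by rewrite bmor_l t1 (lin0 (@lact_linr _ _ (tpow m') _ _ _ s)).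
- have s1 : mu_last m b a s = 0 := s0.
  change (mu_last (m + 0) c a (@pmul m.+1 0 a b c s t) = 0).
  by rewrite mu_last_pmul0 s1 (lin0 (@pmul_linl m 0 a b c t)).
- exact: (mu_last_pmulS s t0).
Qed.

(* The map mu_{m+1,m'+1}, as a bilinear map; by [xmul_mid], it factors through
   the tensor product over [A]. *)
Definition xmul m m' a b c (s : tker m b a) (t : tker m' c b) :
    tker (m + m') c a :=
  tker_mk (in_tker_pmul (tker_valP s) (tker_valP t)).

Lemma xmulE m m' a b c (s : tker m b a) (t : tker m' c b) :
  tker_val (xmul s t) = pmul (tker_val s) (tker_val t).
Proof. exact: tker_mkK. Qed.

Lemma xmul_linl m m' a b c (t : tker m' c b) :
  linear (fun s : tker m b a => xmul s t).
Proof.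
move=> u s s'; apply: tker_val_inj.
by rewrite tker_val_lin !xmulE tker_val_lin pmul_linl.
Qed.

Lemma xmul_linr m m' a b c (s : tker m b a) :
  linear (fun t : tker m' c b => xmul s t).
Proof.
move=> u t t'; apply: tker_val_inj.
by rewrite tker_val_lin !xmulE tker_val_lin pmul_linr.
Qed.

Lemma xmul_mid m m' a b b' c (s : tker m b a) (g : hom A b' b)
    (t : tker m' c b') : xmul (ract _ s g) t = xmul s (lact _ g t).
Proof.
apply: tker_val_inj; rewrite !xmulE.
have -> : tker_val (ract _ s g) = ract _ (tker_val s) g by case: m s.
have -> : tker_val (lact _ g t) = lact _ g (tker_val t) by case: m' t.
exact: pmul_mid.
Qed.

Lemma xmul0r m m' a b c (t : tker m' c b) : xmul (0 : tker m b a) t = 0.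
Proof. exact: (lin0 (@xmul_linl m m' a b c t)). Qed.

Lemma xmulr0 m m' a b c (s : tker m b a) : xmul s (0 : tker m' c b) = 0.
Proof. exact: (lin0 (@xmul_linr m m' a b c s)). Qed.

Lemma tker_val_icast m n c a (s : tker m c a) :
  tker_val (icast (fun i => tker i c a) n s) =
  icast (fun i => tpow i c a) n (tker_val s).
Proof.
rewrite /icast; case: eqP => [e|_]; first by case: _ / e.
exact: lin0 (@tker_val_lin _ _ _).
Qed.

Lemma xmulA m m' m'' a b c d (s : tker m b a) (t : tker m' c b)
    (u : tker m'' d c) :
  xmul (xmul s t) u =
  icast (fun i => tker i d a) (m + m' + m'') (xmul s (xmul t u)).
Proof. by apply: tker_val_inj; rewrite tker_val_icast !xmulE pmulA. Qed.

Lemma xmul1x m a c (t : tker m c a) : @xmul 0 m a a c (idm a) t = t.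
Proof. by apply: tker_val_inj; rewrite xmulE /= lact1. Qed.

Lemma xmulx1 m a c (s : tker m c a) :
  @xmul m 0 a c c s (idm c) = icast (fun i => tker i c a) (m + 0) s.
Proof. by apply: tker_val_inj; rewrite tker_val_icast xmulE /= pmul1. Qed.

Lemma xmul_icast m n m' n' a b c (s : tker m b a) (t : tker m' c b) :
  m = n -> m' = n' ->
  xmul (icast (fun i => tker i b a) n s) (icast (fun i => tker i c b) n' t) =
  icast (fun i => tker i c a) (n + n') (xmul s t).
Proof. by move=> e e'; case: _ / e; case: _ / e'; rewrite !icast_id. Qed.
End Powers.

Section Conditional.
Variables (k : fieldType) (b : bool) (V : lmodType k).

Definition cond_mod : lmodType k := if b then V else 'rV[k]_0.

Definition cond_out : cond_mod -> V :=
  match b return (if b then V else 'rV[k]_0 : lmodType k) -> V with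
  | true => id
  | false => fun=> 0
  end.

Definition cond_in : V -> cond_mod :=
  match b return V -> (if b then V else 'rV[k]_0 : lmodType k) with
  | true => id
  | false => fun=> 0
  end.

Lemma cond_out_lin : linear cond_out.
Proof.
by rewrite /cond_out /cond_mod; case: b => // t u v; rewrite scaler0 addr0.
Qed.

Lemma cond_in_lin : linear cond_in.
Proof.
by rewrite /cond_in /cond_mod; case: b => // t u v; rewrite scaler0 addr0.
Qed.

Lemma cond_out0 : cond_out 0 = 0. Proof. exact: lin0 cond_out_lin. Qed.
Lemma cond_in0 : cond_in 0 = 0. Proof. exact: lin0 cond_in_lin. Qed.

Lemma cond_outK : cancel cond_out cond_in.
Proof.
by rewrite /cond_out /cond_in /cond_mod; case: b => [//|u]; rewrite [RHS]thinmx0.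
Qed.

Lemma cond_inK v : b -> cond_out (cond_in v) = v.
Proof. by rewrite /cond_out /cond_in /cond_mod; case: b. Qed.

Lemma cond_outN u : ~~ b -> cond_out u = 0.
Proof. by rewrite /cond_out /cond_mod in u *; case: b u. Qed.
End Conditional.
Arguments cond_in {k} b {V} _.
Arguments cond_out {k b V} _.

Section TriangularCategory.
Variables (k : fieldType) (A : kcat k) (B : wide_subcat A) (n : nat).

(* [(x, i)] is the object x^{i+1}, the index [i] ranging over [0 .. n-1]. *)
Definition tri_ob : choiceType := (ob A * 'I_n)%type.

Definition tri_hom (x y : tri_ob) : lmodType k :=
  cond_mod (x.2 <= y.2)%N (tker B (y.2 - x.2) x.1 y.1).

(* When [x.2 <= y.2 <= z.2], [icast] is the transport along the equality
   [z.2 - y.2 + (y.2 - x.2) = z.2 - x.2]. *)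
Definition tri_comp (x y z : tri_ob) (g : tri_hom y z) (f : tri_hom x y) :
    tri_hom x z :=
  cond_in _ (icast (fun i => tker B i x.1 z.1) (z.2 - x.2)
    (xmul (cond_out g) (cond_out f))).

Definition tri_id (x : tri_ob) : tri_hom x x :=
  cond_in _ (icast (fun i => tker B i x.1 x.1) (x.2 - x.2)
    (idm x.1 : tker B 0 x.1 x.1)).

Lemma tri_out_inj (x y : tri_ob) (f g : tri_hom x y) :
  ((x.2 <= y.2)%N -> cond_out f = cond_out g) -> f = g.
Proof.
move=> fg; rewrite -[f]cond_outK -[g]cond_outK; congr cond_in.
have [le_xy|nxy] : (x.2 <= y.2)%N \/ ~~ (x.2 <= y.2)%N by apply/orP/orbN.
  exact: fg.
by rewrite !cond_outN.
Qed.

Program Definition tri_cat : kcat k :=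
  @KCat k tri_ob tri_hom tri_id tri_comp _ _ _ _ _.
Next Obligation.
move=> x y f; apply: tri_out_inj => le_xy.
rewrite /tri_comp /tri_id !cond_inK //.
have e0 : 0%N = (y.2 - y.2)%N by rewrite subnn.
rewrite -[cond_out f](icast_id (F := fun i => tker B i x.1 y.1)).
rewrite xmul_icast // xmul1x icast_trans ?icast_id // -e0 //.
Qed.
Next Obligation.
move=> x y f; apply: tri_out_inj => le_xy.
rewrite /tri_comp /tri_id !cond_inK //.
have e0 : 0%N = (x.2 - x.2)%N by rewrite subnn.
rewrite -[cond_out f](icast_id (F := fun i => tker B i x.1 y.1)).
rewrite xmul_icast // xmulx1 !icast_trans ?icast_id // -?e0 ?addn0 //.
Qed.
Next Obligation.
move=> x y z t h g f; apply: tri_out_inj => le_xt.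
rewrite /tri_comp !(cond_inK _ le_xt).
have [nxy|le_xy] : ~~ (x.2 <= y.2)%N \/ (x.2 <= y.2)%N
  by apply/orP; rewrite orNb.
  by rewrite [cond_out f]cond_outN // !(xmulr0, icast0, cond_in0, cond_out0).
have [nzt|le_zt] : ~~ (z.2 <= t.2)%N \/ (z.2 <= t.2)%N
  by apply/orP; rewrite orNb.
  by rewrite [cond_out h]cond_outN // !(xmul0r, icast0, cond_in0, cond_out0).
have [nyz|le_yz] : ~~ (y.2 <= z.2)%N \/ (y.2 <= z.2)%N
  by apply/orP; rewrite orNb.
  rewrite [cond_out g]cond_outN //.
  by rewrite !(xmul0r, xmulr0, icast0, cond_in0, cond_out0).
have add_sub (i j l : nat) : (i <= j -> j <= l -> l - j + (j - i) = l - i)%N.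
  by move=> ij jl; rewrite addnBA // subnK.
have le_xz := leq_trans le_xy le_yz; have le_yt := leq_trans le_yz le_zt.
rewrite (cond_inK _ le_xz) (cond_inK _ le_yt).
rewrite -{1}[cond_out h](icast_id (F := fun i => tker B i z.1 t.1)).
rewrite -{2}[cond_out f](icast_id (F := fun i => tker B i x.1 y.1)).
rewrite !xmul_icast ?add_sub // xmulA !icast_trans ?add_sub //.
Qed.
Next Obligation.
move=> x y z f t g g'; rewrite /tri_comp cond_out_lin xmul_linl icast_lin.
by rewrite cond_in_lin.
Qed.
Next Obligation.
move=> x y z g t f f'; rewrite /tri_comp cond_out_lin xmul_linr icast_lin.
by rewrite cond_in_lin.
Qed.
End TriangularCategory.

Record quiver := Quiver {
  vtx : choiceType; arr : choiceType; src : arr -> vtx; tgt : arr -> vtx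
}.

Section Paths.
Variable Q : quiver.

(* A path is the list of its arrows, in the order in which they are followed. *)
Fixpoint is_path (x y : vtx Q) (p : seq (arr Q)) : bool :=
  if p is a :: p' then (src a == x) && is_path (tgt a) y p' else x == y.

Definition path_of x y := {p : seq (arr Q) | is_path x y p}.

Lemma is_path_cat x y z p q :
  is_path x y p -> is_path y z q -> is_path x z (p ++ q).
Proof.
by elim: p x => [|a p IH] x /= => [/eqP -> //|/andP[-> /IH pq] /pq].
Qed.

Definition path_id x : path_of x x := exist _ [::] (eqxx x).

Definition path_comp x y z (q : path_of y z) (p : path_of x y) : path_of x z :=
  exist _ (val p ++ val q) (is_path_cat (valP p) (valP q)).
End Paths.

Section PathCategory.
Variables (k : fieldType) (Q : quiver).

Definition path_hom (x y : vtx Q) : lmodType k := {malg k[path_of x y]}.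

Definition path_hom_comp x y z (g : path_hom y z) (f : path_hom x y) :
    path_hom x z :=
  mlift (fun q => mlift (fun p => << path_comp q p >> : path_hom x z) f) g.

Lemma path_hom_compUl x y z (q : path_of y z) (f : path_hom x y) :
  path_hom_comp << q >> f =
  mlift (fun p => << path_comp q p >> : path_hom x z) f.
Proof. exact: mliftU. Qed.

Lemma path_hom_compU x y z (q : path_of y z) (p : path_of x y) :
  path_hom_comp << q >> << p >> = << path_comp q p >>.
Proof. by rewrite path_hom_compUl; apply: mliftU. Qed.

Lemma path_hom_comp_linl x y z (f : path_hom x y) :
  linear (fun g : path_hom y z => path_hom_comp g f).
Proof. exact: mlift_lin. Qed.

Lemma path_hom_comp_linr x y z (g : path_hom y z) :
  linear (fun f : path_hom x y => path_hom_comp g f).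
Proof.
move=> t f f'; move: g; apply: malg_ext => [||q].
- exact: path_hom_comp_linl.
- exact: (linear_pencil t (@path_hom_comp_linl x y z f)
    (@path_hom_comp_linl x y z f')).
- by rewrite !path_hom_compUl; apply: mlift_lin.
Qed.

Program Definition path_cat : kcat k :=
  @KCat k (vtx Q) path_hom (fun x => << path_id x >>) path_hom_comp
    _ _ _ (@path_hom_comp_linl) (@path_hom_comp_linr).
Next Obligation.
move=> x y; apply: malg_ext => [||p] //; first exact: path_hom_comp_linr.
by rewrite path_hom_compU; congr << _ >>; apply: val_inj; rewrite /= cats0.
Qed.
Next Obligation.
move=> x y; apply: malg_ext => [||p] //; first exact: path_hom_comp_linl.
by rewrite path_hom_compU; congr << _ >>; apply: val_inj.
Qed.
Next Obligation.
move=> x y z t h g f; move: h; apply: malg_ext => [||r].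
- exact: path_hom_comp_linl.
- exact: linear_comp (@path_hom_comp_linl _ _ _ _) (@path_hom_comp_linl _ _ _ _).
move: g; apply: malg_ext => [||q].
- exact: linear_comp (@path_hom_comp_linr _ _ _ _) (@path_hom_comp_linl _ _ _ _).
- exact: linear_comp (@path_hom_comp_linl _ _ _ _) (@path_hom_comp_linr _ _ _ _).
move: f; apply: malg_ext => [||p].
- exact: linear_comp (@path_hom_comp_linr _ _ _ _) (@path_hom_comp_linr _ _ _ _).
- exact: path_hom_comp_linr.
rewrite !path_hom_compU; congr << _ >>; apply: val_inj; exact: esym (catA _ _ _).
Qed.
End PathCategory.

Record fin_quiver := FinQuiver {
  fvtx : finType; farr : finType; fsrc : farr -> fvtx; ftgt : farr -> fvtx
}.

Definition quiver_of_fin (Q : fin_quiver) : quiver :=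
  @Quiver (fvtx Q) (farr Q) (@fsrc Q) (@ftgt Q).

Definition acyclic (Q : fin_quiver) : Prop :=
  forall x (p : path_of (Q := quiver_of_fin Q) x x), val p = [::].

Record ice_quiver := IceQuiver {
  ice_quiver_val :> fin_quiver;
  frozen : pred (fvtx ice_quiver_val)
}.

(* [inr (i, r)] is the frozen vertex i_{r+1} on the side of vertices, and the
   arrow from i to i_{r+1} on the side of arrows. *)
Definition framed (Q : fin_quiver) (n : nat) : ice_quiver :=
  @IceQuiver
    (@FinQuiver (fvtx Q + fvtx Q * 'I_n)%type (farr Q + fvtx Q * 'I_n)%type
      (fun a => match a with inl a => inl (fsrc a) | inr (i, _) => inl i end)
      (fun a => match a with inl a => inl (ftgt a) | inr ir => inr ir end))
    (fun v => if v is inr _ then true else false).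

Section Repetition.
Variable R : ice_quiver.

(* [inl (a, p)] is the arrow (a, p), and [inr (a, p)] is sigma(a, p). *)
Definition rep_quiver : quiver :=
  @Quiver (fvtx R * int)%type (farr R * int + farr R * int)%type
    (fun b => match b with
      | inl (a, p) => (fsrc a, p)
      | inr (a, p) => (ftgt a, p - 1)
      end)
    (fun b => match b with
      | inl (a, p) => (ftgt a, p)
      | inr (a, p) => (fsrc a, p)
      end).

Definition rep_frozen (x : vtx rep_quiver) : bool := frozen x.1.

Definition rep_sigma (b : arr rep_quiver) : arr rep_quiver :=
  match b with
  | inl (a, p) => inr (a, p)
  | inr (a, p) => inl (a, p - 1)
  end.

Definition rep_tau (x : vtx rep_quiver) : vtx rep_quiver := (x.1, x.2 - 1).

(* Every arrow of the repetition quiver with target (i, p) is of the form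
   (a, p) or sigma(a, p), with the same p: this makes the set of arrows with
   a given target a finite type. *)
Definition arr_at (p : int) (b : farr R + farr R) : arr rep_quiver :=
  match b with inl a => inl (a, p) | inr a => inr (a, p) end.

Definition arr_to (x : vtx rep_quiver) :=
  {b : farr R + farr R | tgt (arr_at x.2 b) == x}.

Lemma arr_to_surj x (b : arr rep_quiver) :
  tgt b = x -> exists c : arr_to x, arr_at x.2 (val c) = b.
Proof.
move=> <-; case: b => [[a p]|[a p]] /=.
- by exists (exist _ (inl a) (eqxx _)).
- by exists (exist _ (inr a) (eqxx _)).
Qed.

Lemma mesh_path_subproof x (b : arr_to x) :
  is_path (rep_tau x) x [:: rep_sigma (arr_at x.2 (val b)); arr_at x.2 (val b)].
Proof.
case: x b => i p [[a|a] /= ab].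
- by move: (ab); rewrite !xpair_eqE !eqxx !andbT => /eqP ->; rewrite !eqxx.
- by move: (ab); rewrite !xpair_eqE !eqxx !andbT => /eqP ->; rewrite !eqxx.
Qed.

Definition mesh_path x (b : arr_to x) : path_of (rep_tau x) x :=
  exist _ [:: rep_sigma (arr_at x.2 (val b)); arr_at x.2 (val b)]
    (mesh_path_subproof b).

Variable k : fieldType.

Definition mesh_sum x : hom (path_cat k rep_quiver) (rep_tau x) x :=
  \sum_(b : arr_to x) (<< mesh_path b >> : path_hom k (rep_tau x) x).

Inductive mesh_rel :
    forall x y, hom (path_cat k rep_quiver) x y -> Prop :=
| Mesh_rel x : ~~ rep_frozen x -> mesh_rel (mesh_sum x).

Definition mesh_cat : kcat k := quot_cat (gen_ideal mesh_rel).
End Repetition.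

Section NakajimaFiltered.
Variables (k : fieldType) (Q : fin_quiver) (n : nat).

Definition filt_rel (x y : ob (mesh_cat (framed Q n) k))
    (f : hom (mesh_cat (framed Q n) k) x y) : Prop :=
  match x.1, y.1 with
  | inr (_, r), inr (_, s) => (s < r)%N
  | _, _ => False
  end.

Definition Rfilt : kcat k := quot_cat (gen_ideal filt_rel).

Definition Sfilt : kcat k :=
  full_subcat (A := Rfilt) (@rep_frozen (framed Q n)).
End NakajimaFiltered.

(* Main.v *)
(** Write a_r : w -> w_r and b_r : w_r -> tau^-1 w for the arrows at the frozen
    vertices over w. Sending a non-frozen vertex to itself, x to the sum of the
    x_r, a to the column (a_s) and b to the row (b_r) turns the mesh relations
    of level 1 into those of level n; this gives components
    D_{r,s} : S(x, y) -> S^n-filt(x_r, y_s) with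
    D_{r,s}(g f) = sum_t D_{t,s}(g) D_{r,t}(f), and these generate S^n-filt.

    Conversely, in the category of words f_0 (x) .. (x) f_m with letters in
    R^1-filt graded by levels, let E = 1 (x) 1 be the shift by one level. Sending
    w to the sum of its copies at all levels, a_s to the entries of
    (1 - E)^-1 a and b_r to those of b (1 - E) respects the mesh relations,
    because the two matrices in E are inverse to each other. On S^n-filt this is
    a functor Psi to words with letters in S, and
    Psi(D_{r,s} f) = 1 (x) .. (x) 1 (x) f - 1 (x) .. (x) f (x) 1, which is killed
    by the multiplication of the last two letters. The words of this shape
    generate the kernels X_l, whence surjectivity; a left inverse Gamma of Psi
    is defined by recursion on words through
    Gamma(1^i (x) f (x) t) = Gamma(1^(i+1) (x) f t) - D(f) Gamma(t). *)
From HB Require Import structures.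
From mathcomp Require Import all_boot all_order all_algebra.
From mathcomp Require Import zify.
From mathcomp.multinomials Require Import monalg.
From mathcomp.classical Require Import boolp.
Require Import Defs.

Set Implicit Arguments.
Unset Strict Implicit.
Unset Printing Implicit Defensive.

Import GRing.Theory.
Local Open Scope ring_scope.

#[local] Obligation Tactic := idtac.

(** * Linear maps and bilinearity of composition *)

Lemma lin_sub (k : fieldType) (U V : lmodType k) (f g : U -> V) :
  linear f -> linear g -> linear (fun u => f u - g u).
Proof.
move=> lf lg a u v.
by rewrite lf lg scalerBr opprD !addrA; congr (_ + _); rewrite addrAC.
Qed.

Lemma lin_bigsum (k : fieldType) (U V : lmodType k) I (r : seq I) (P : pred I)
    (f : I -> U -> V) :
  (forall i, linear (f i)) -> linear (fun u => \sum_(i <- r | P i) f i u).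
Proof.
move=> lf a u v; rewrite scaler_sumr -big_split /=.
by apply: eq_bigr => i _; apply: lf.
Qed.

Lemma lin_sump (k : fieldType) (U V : lmodType k) (f : U -> V) I (r : seq I)
    (P : pred I) (E : I -> U) : linear f ->
  f (\sum_(i <- r | P i) E i) = \sum_(i <- r | P i) f (E i).
Proof. by move=> lf; rewrite -!(big_filter r) (lin_sum lf). Qed.

Section CategoryFacts.
Variables (k : fieldType) (A : kcat k).

Lemma comp0m x y z (f : hom A x y) : (0 : hom A y z) \oc f = 0.
Proof. exact: (lin0 (@comp_linl _ _ _ _ _ f)). Qed.
Lemma compm0 x y z (g : hom A y z) : g \oc (0 : hom A x y) = 0.
Proof. exact: (lin0 (@comp_linr _ _ _ _ _ g)). Qed.
Lemma compZl x y z a (g : hom A y z) (f : hom A x y) :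
  (a *: g) \oc f = a *: (g \oc f).
Proof. exact: (linZ (@comp_linl _ _ _ _ _ f)). Qed.
Lemma compZr x y z a (g : hom A y z) (f : hom A x y) :
  g \oc (a *: f) = a *: (g \oc f).
Proof. exact: (linZ (@comp_linr _ _ _ _ _ g)). Qed.
Lemma compDl x y z (g g' : hom A y z) (f : hom A x y) :
  (g + g') \oc f = g \oc f + g' \oc f.
Proof. exact: (linD (@comp_linl _ _ _ _ _ f)). Qed.
Lemma compDr x y z (g : hom A y z) (f f' : hom A x y) :
  g \oc (f + f') = g \oc f + g \oc f'.
Proof. exact: (linD (@comp_linr _ _ _ _ _ g)). Qed.
Lemma compBl x y z (g g' : hom A y z) (f : hom A x y) :
  (g - g') \oc f = g \oc f - g' \oc f.
Proof. exact: (linB (@comp_linl _ _ _ _ _ f)). Qed.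
Lemma compBr x y z (g : hom A y z) (f f' : hom A x y) :
  g \oc (f - f') = g \oc f - g \oc f'.
Proof. exact: (linB (@comp_linr _ _ _ _ _ g)). Qed.
Lemma comp_suml x y z I (r : seq I) (P : pred I) (g : I -> hom A y z)
    (f : hom A x y) :
  (\sum_(i <- r | P i) g i) \oc f = \sum_(i <- r | P i) g i \oc f.
Proof. exact: (lin_sump _ _ _ (@comp_linl _ _ _ _ _ f)). Qed.
Lemma comp_sumr x y z I (r : seq I) (P : pred I) (g : hom A y z)
    (f : I -> hom A x y) :
  g \oc (\sum_(i <- r | P i) f i) = \sum_(i <- r | P i) g \oc f i.
Proof. exact: (lin_sump _ _ _ (@comp_linr _ _ _ _ _ g)). Qed.
End CategoryFacts.

(** * Isomorphisms of categories and functors out of quotient categories *)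

Section Functors.
Variable k : fieldType.

Lemma kcat_isomorphic_sym (A B : kcat k) :
  kcat_isomorphic A B -> kcat_isomorphic B A.
Proof. by case=> F [G [GF FG]]; exists G, F. Qed.

Lemma kcat_isomorphic_trans (A B C : kcat k) :
  kcat_isomorphic A B -> kcat_isomorphic B C -> kcat_isomorphic A C.
Proof.
have fcA (X Y Z T : kcat k) (H : kfunctor Z T) (G : kfunctor Y Z)
    (F : kfunctor X Y) : fcompose H (fcompose G F) = fcompose (fcompose H G) F.
  by apply: (@kfunctor_ext k X T (fcompose H (fcompose G F))
    (fcompose (fcompose H G) F) (fun=> erefl)).
have fc1 (X Y : kcat k) (F : kfunctor X Y) : fcompose (fidentity Y) F = F.
  by apply: (@kfunctor_ext k X Y (fcompose (fidentity Y) F) F (fun=> erefl)).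
case=> F [G [GF FG]] [F' [G' [GF' FG']]].
exists (fcompose F' F), (fcompose G G'); split.
  by rewrite -fcA (fcA _ _ _ _ G') GF' fc1.
by rewrite -fcA (fcA _ _ _ _ F) FG fc1.
Qed.

(** Relabels the objects of [C] along [q], so that the isomorphism with the triangular category can
    be built as the identity on objects. *)
Definition pull_cat (C : kcat k) (O : choiceType) (q : O -> ob C) : kcat k :=
  @KCat k O (fun x y => hom C (q x) (q y)) (fun x => idm (q x))
  (fun x y z g f => g \oc f)
  (fun x y f => comp1m f) (fun x y f => compm1 f)
  (fun x y z t h g f => compA h g f)
  (fun x y z f => @comp_linl k C _ _ _ f)
  (fun x y z g => @comp_linr k C _ _ _ g).

Lemma pull_cat_iso (C : kcat k) (O : choiceType) (q : O -> ob C) :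
  bijective q -> kcat_isomorphic (pull_cat q) C.
Proof.
move=> bq; pose F := @KFunctor k (pull_cat q) C q (fun x y f => f)
  (fun x y a f g => erefl) (fun=> erefl) (fun x y z g f => erefl).
by apply: (@kcat_isomorphic_bij k _ _ F) => // x y; exists id.
Qed.

Section QuotientLift.
Variables (A C : kcat k) (G : forall x y, hom A x y -> Prop) (F : kfunctor A C).
Hypothesis FG0 : forall x y (f : hom A x y), G f -> fmor F f = 0.

Lemma gen_ideal_ker x y (f : hom A x y) : gen_ideal (@G) x y f -> fmor F f = 0.
Proof.
elim=> {x y f} [x y f /FG0 //|x y|x y a f g _ f0 _ g0|x y z g f _ f0|
  x y z g f _ g0].
- exact: lin0 (@fmor_lin _ _ _ F x y).
- by rewrite fmor_lin f0 g0 scaler0 addr0.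
- by rewrite fmorM f0 compm0.
- by rewrite fmorM g0 comp0m.
Qed.

Definition quot_fmor x y : qhom (gen_ideal (@G)) x y -> hom C (F x) (F y) :=
  qlift (fun f : hom A x y => fmor F f).

Lemma quot_fmorE x y f : @quot_fmor x y (lpi (gen_ideal (@G) x y) f) = fmor F f.
Proof.
by apply: qliftE; [exact: fmor_lin | exact: gen_ideal_ker].
Qed.

Program Definition quot_functor : kfunctor (quot_cat (gen_ideal (@G))) C :=
  @KFunctor k (quot_cat (gen_ideal (@G))) C F quot_fmor _ _ _.
Next Obligation.
by move=> x y; apply: qlift_lin; [exact: fmor_lin | exact: gen_ideal_ker].
Qed.
Next Obligation. by move=> x; rewrite /= quot_fmorE fmor1. Qed.
Next Obligation.
move=> x y z q2 q1; have [g ->] := lpi_surj q2; have [f ->] := lpi_surj q1.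
by rewrite /= qcompE !quot_fmorE fmorM.
Qed.
End QuotientLift.

Definition pi_functor (A : kcat k) (I : ideal A) : kfunctor A (quot_cat I) :=
  @KFunctor k A (quot_cat I) id (fun x y f => lpi (I x y) f)
    (fun x y => @lpi_lin _ _ (I x y)) (fun=> erefl)
    (fun x y z g f => esym (qcompE _ g f)).
End Functors.

(** * Path categories: functors out of them and induction on paths *)

Section PathFunctor.
Variables (k : fieldType) (Q : quiver) (C : kcat k) (o : vtx Q -> ob C).
Variable F : forall a : arr Q, hom C (o (src a)) (o (tgt a)).

(** The value is 0 when [a] does not start at [x]. Together with [id_cast], this lets [pmor] recurse
    on bare lists of arrows, without a proof that they form a path. *)
Definition src_cast x (a : arr Q) : hom C (o x) (o (tgt a)) :=
  match src a =P x with
  | ReflectT e => ecast z (hom C (o z) (o (tgt a))) e (F a)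
  | ReflectF _ => 0
  end.

Definition id_cast x y : hom C (o x) (o y) :=
  match x =P y with
  | ReflectT e => ecast z (hom C (o x) (o z)) e (idm (o x))
  | ReflectF _ => 0
  end.

Fixpoint pmor x y (p : seq (arr Q)) : hom C (o x) (o y) :=
  if p is a :: p' then pmor (tgt a) y p' \oc src_cast x a else id_cast x y.

Lemma src_castE a : src_cast (src a) a = F a.
Proof. by rewrite /src_cast; case: eqP => // e; rewrite eq_axiomK. Qed.

Lemma id_castE x : id_cast x x = idm (o x).
Proof. by rewrite /id_cast; case: eqP => // e; rewrite eq_axiomK. Qed.

Lemma pmor_cons a y p : pmor (src a) y (a :: p) = pmor (tgt a) y p \oc F a.
Proof. by rewrite /= src_castE. Qed.

Lemma pmor1 a : pmor (src a) (tgt a) [:: a] = F a.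
Proof. by rewrite pmor_cons /= id_castE comp1m. Qed.

Lemma pmor_cat x y z p q : is_path x y p -> is_path y z q ->
  pmor x z (p ++ q) = pmor y z q \oc pmor x y p.
Proof.
elim: p x => [|a p IH] x; first by move=> /eqP <- _; rewrite /= id_castE compm1.
by move=> /andP[_ /IH pq] /pq /= ->; rewrite compA.
Qed.

Definition path_fmor x y : path_hom k x y -> hom C (o x) (o y) :=
  mlift (fun p : path_of x y => pmor x y (val p)).

Lemma path_fmorU x y (p : path_of x y) : path_fmor << p >> = pmor x y (val p).
Proof. exact: mliftU. Qed.

Program Definition path_functor : kfunctor (path_cat k Q) C :=
  @KFunctor k (path_cat k Q) C o path_fmor _ _ _.
Next Obligation. by move=> x y; apply: mlift_lin. Qed.
Next Obligation. by move=> x; rewrite /= path_fmorU /= id_castE. Qed.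
Next Obligation.
move=> x y z g f; move: g; apply: malg_ext => [||q].
- exact: linear_comp (mlift_lin _) (@path_hom_comp_linl _ _ _ _ _ f).
- exact: linear_comp (@comp_linl _ _ _ _ _ _) (mlift_lin _).
move: f; apply: malg_ext => [||p].
- exact: linear_comp (mlift_lin _) (@path_hom_comp_linr _ _ _ _ _ _).
- exact: linear_comp (@comp_linr _ _ _ _ _ _) (mlift_lin _).
rewrite /= path_hom_compU !path_fmorU /=.
exact: pmor_cat (valP p) (valP q).
Qed.
End PathFunctor.

Lemma malg_ind (k : fieldType) (K : choiceType) (P : {malg k[K]} -> Prop) :
  P 0 -> (forall a u v, P u -> P v -> P (a *: u + v)) ->
  (forall x, P << x >>) -> forall u, P u.
Proof.
move=> P0 PL PU u; rewrite (monalgE u); elim/big_rec: _ => [//|x v _ Pv].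
have -> : << u@_x *g x >> = u@_x *: << x >> :> {malg k[K]}.
  by apply/malgP => y; rewrite mcoeffZ !mcoeffU mulrnAr mulr1.
exact: PL.
Qed.

Definition arrow_path (Q : quiver) (a : arr Q) : path_of (src a) (tgt a) :=
  exist _ [:: a] (introT andP (conj (eqxx (src a)) (eqxx (tgt a)))).

Definition arrow_mor (k : fieldType) (Q : quiver) (a : arr Q) :
    hom (path_cat k Q) (src a) (tgt a) :=
  (<< arrow_path a >> : path_hom k (src a) (tgt a)).

(** Arrows are added at the target end, so the source stays fixed and the predicate only varies with
    the target. *)
Lemma path_cat_ind (k : fieldType) (Q : quiver) (x : vtx Q)
    (P : forall y, hom (path_cat k Q) x y -> Prop) :
  (forall y, P y 0) ->
  (forall y a u v, P y u -> P y v -> P y (a *: u + v)) ->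
  P x (idm (x : ob (path_cat k Q))) ->
  (forall (a : arr Q) u, P (src a) u ->
     P (tgt a) (arrow_mor k a \oc u)) ->
  forall y u, P y u.
Proof.
move=> P0 PL P1 PS y; apply: malg_ind => [||[p pP]]; [exact: P0|exact: PL|].
(* A path lists its arrows in the order of travel, so composing with an arrow on the left appends it
   to the list. *)
elim/last_ind: p y pP => [|p a IH] y pP.
  have e : x = y by apply/eqP.
  subst y; suff <- : path_id x = exist _ [::] pP by [].
  exact: val_inj.
have [pa ya] : is_path x (src a) p /\ tgt a = y.
  elim: p x pP {IH P P0 PL P1 PS} => [|b p IH] x /=.
    by case/andP=> /eqP -> /eqP.
  by case/andP=> -> /IH.
subst y; have := PS a _ (IH _ pa); rewrite /= path_hom_compU.
suff -> : path_comp (arrow_path a) (exist _ p pa) = exist _ (rcons p a) pP by [].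
by apply: val_inj; rewrite /= cats1.
Qed.

#[local] Arguments hom {k} A _ _ : simpl never.
#[local] Arguments idm {k A} x : simpl never.
#[local] Arguments comp {k A x y z} g f : simpl never.
#[local] Arguments fmor {k A B} F {x y} f : simpl never.

(** * Matrix categories *)

Section ProductModule.
Variables (k : fieldType) (I : Type) (V : I -> lmodType k).

Definition prod_mod : Type := forall i, V i.
HB.instance Definition _ := Choice.copy prod_mod (forall i, V i).

Implicit Types f g : prod_mod.

Fact prod_addA : associative (fun f g => (fun i => f i + g i) : prod_mod).
Proof. by move=> f g h; apply: functional_extensionality_dep => i; rewrite addrA. Qed.
Fact prod_addC : commutative (fun f g => (fun i => f i + g i) : prod_mod).
Proof. by move=> f g; apply: functional_extensionality_dep => i; rewrite addrC. Qed.
Fact prod_add0 : left_id ((fun i => 0) : prod_mod)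
  (fun f g => (fun i => f i + g i) : prod_mod).
Proof. by move=> f; apply: functional_extensionality_dep => i; rewrite add0r. Qed.
Fact prod_addN : left_inverse ((fun i => 0) : prod_mod)
  (fun f => (fun i => - f i) : prod_mod)
  (fun f g => (fun i => f i + g i) : prod_mod).
Proof. by move=> f; apply: functional_extensionality_dep => i; rewrite addNr. Qed.
HB.instance Definition _ := GRing.isZmodule.Build prod_mod
  prod_addA prod_addC prod_add0 prod_addN.

Definition prod_scale (a : k) f : prod_mod := fun i => a *: f i.
Fact prod_scaleA a b f : prod_scale a (prod_scale b f) = prod_scale (a * b) f.
Proof. by apply: functional_extensionality_dep => i; apply: scalerA. Qed.
Fact prod_scale1 : left_id 1 prod_scale.
Proof. by move=> f; apply: functional_extensionality_dep => i; apply: scale1r. Qed.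
Fact prod_scaleDr : right_distributive prod_scale +%R.
Proof. by move=> a f g; apply: functional_extensionality_dep => i; apply: scalerDr. Qed.
Fact prod_scaleDl f : {morph prod_scale^~ f : a b / a + b}.
Proof. by move=> a b; apply: functional_extensionality_dep => i; apply: scalerDl. Qed.
HB.instance Definition _ := GRing.Zmodule_isLmodule.Build k prod_mod
  prod_scaleA prod_scale1 prod_scaleDr prod_scaleDl.

Lemma prod_lin i : linear (fun f : prod_mod => f i).
Proof. by []. Qed.

Lemma prod_sumE (J : Type) (r : seq J) (P : pred J) (F : J -> prod_mod) i :
  (\sum_(j <- r | P j) F j) i = \sum_(j <- r | P j) F j i.
Proof. exact: (lin_sump _ _ _ (prod_lin i)). Qed.
End ProductModule.

Section MatrixCategory.
Variables (k : fieldType) (A : kcat k) (V : choiceType) (J : V -> finType).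
Variable o : forall v, J v -> ob A.

(** An object [v] stands for the formal direct sum of the [o j] with [j] in [J v]. Entries are
    indexed by the source summand first, the transpose of the usual convention. *)
Definition mat_hom (u v : V) : lmodType k :=
  prod_mod (fun i : J u => prod_mod (fun j : J v => hom A (o i) (o j))).

Lemma mat_hom_ext u v (f g : mat_hom u v) : (forall i j, f i j = g i j) -> f = g.
Proof.
move=> fg; apply: functional_extensionality_dep => i.
exact: functional_extensionality_dep.
Qed.

Definition mat_id_entry v (i j : J v) : hom A (o i) (o j) :=
  match i =P j with
  | ReflectT e => ecast z (hom A (o i) (o z)) e (idm (o i))
  | ReflectF _ => 0
  end.

Lemma mat_id_diag v (i : J v) : mat_id_entry i i = idm (o i).
Proof. by rewrite /mat_id_entry; case: eqP => // e; rewrite eq_axiomK. Qed.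

Lemma mat_id_off v (i j : J v) : i != j -> mat_id_entry i j = 0.
Proof. by rewrite /mat_id_entry; case: eqP. Qed.

Definition mat_comp u v w (g : mat_hom v w) (f : mat_hom u v) : mat_hom u w :=
  fun i j => \sum_(m : J v) g m j \oc f i m.

Program Definition mat_cat : kcat k :=
  @KCat k V mat_hom (fun v (i j : J v) => mat_id_entry i j) mat_comp _ _ _ _ _.
Next Obligation.
move=> u v f; apply: mat_hom_ext => i j; rewrite /mat_comp.
rewrite (bigD1 j) //= mat_id_diag comp1m big1 ?addr0 // => m mj.
by rewrite mat_id_off ?comp0m.
Qed.
Next Obligation.
move=> u v f; apply: mat_hom_ext => i j; rewrite /mat_comp.
rewrite (bigD1 i) //= mat_id_diag compm1 big1 ?addr0 // => m mi.
by rewrite mat_id_off ?compm0 // eq_sym.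
Qed.
Next Obligation.
move=> u v w x h g f; apply: mat_hom_ext => i j; rewrite /mat_comp.
transitivity (\sum_m \sum_l h m j \oc (g l m \oc f i l)).
  by apply: eq_bigr => m _; rewrite comp_sumr.
rewrite exchange_big; apply: eq_bigr => l _; rewrite comp_suml.
by apply: eq_bigr => m _; rewrite compA.
Qed.
Next Obligation.
move=> u v w f a g g'; apply: mat_hom_ext => i j; rewrite /mat_comp.
transitivity (\sum_m (a *: (g m j \oc f i m) + g' m j \oc f i m)).
  by apply: eq_bigr => m _; rewrite -compZl -compDl.
by rewrite big_split -scaler_sumr.
Qed.
Next Obligation.
move=> u v w g a f f'; apply: mat_hom_ext => i j; rewrite /mat_comp.
transitivity (\sum_m (a *: (g m j \oc f i m) + g m j \oc f' i m)).
  by apply: eq_bigr => m _; rewrite -compZr -compDr.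
by rewrite big_split -scaler_sumr.
Qed.
End MatrixCategory.

(** * Tensor products over the discrete subcategory *)

Section TensorFacts.
Variables (k : fieldType) (A : kcat k).

Lemma tens_ind (B : wide_subcat A) (X Y : bimod A) c a
    (P : thom B X Y c a -> Prop) :
  P 0 -> (forall t u v, P u -> P v -> P (t *: u + v)) ->
  (forall b (x : X b a) (y : Y c b), P (tens B x y)) -> forall q, P q.
Proof.
move=> P0 PL PT q; have [u ->] := lpi_surj q; move: u.
apply: malg_ind => [|t u v Pu Pv|[b [x y]]]; last exact: PT.
- by rewrite (lin0 (@lpi_lin _ _ _)).
- by rewrite lpi_lin; apply: PL.
Qed.

(* The morphisms of the discrete subcategory are multiples of identities. *)
Lemma balanced_discrete (X Y : bimod A) c a (V : lmodType k)
    (h : forall b, X b a -> Y c b -> V) :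
  (forall b y, linear (fun x => h b x y)) -> (forall b x, linear (h b x)) ->
  balanced (discrete_subcat A) h.
Proof.
move=> hl hr; split=> // b1 b2 f x y Bf; elim: Bf x y => {b1 b2 f}.
- by move=> b1 b2 f [b] x y; rewrite ract1 lact1.
- by move=> b x y; rewrite ract1 lact1.
- move=> b1 b2 x y; rewrite (lin0 (@ract_linr _ _ X _ _ _ x)).
  by rewrite (lin0 (@lact_linl _ _ Y _ _ _ y)) (lin0 (hl _ y)) (lin0 (hr _ x)).
- move=> b1 b2 t f g _ IHf _ IHg x y.
  rewrite (@ract_linr _ _ X _ _ _ x) (@lact_linl _ _ Y _ _ _ y).
  by rewrite (hl b1 y) (hr b2 x) IHf IHg.
- move=> b1 b2 b3 g f _ IHg _ IHf x y.
  by rewrite -ractM IHf IHg lactM.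
Qed.
End TensorFacts.

(** * Words, levels and the shift [E] *)

(* The analogue of [tri_cat] with the whole tensor powers, instead of the kernels
   X_l, as morphism spaces. *)
Section WordCategory.
Variables (k : fieldType) (A : kcat k) (B : wide_subcat A) (n : nat).
Local Notation tpow := (tpow B).
Local Notation T c a := (fun m => tpow m c a).

Definition word_hom (x y : tri_ob A n) : lmodType k :=
  cond_mod (x.2 <= y.2)%N (tpow (y.2 - x.2) x.1 y.1).

Definition word_comp (x y z : tri_ob A n) (g : word_hom y z)
    (f : word_hom x y) : word_hom x z :=
  cond_in _ (icast (T x.1 z.1) (z.2 - x.2) (pmul (cond_out g) (cond_out f))).

Definition word_id (x : tri_ob A n) : word_hom x x :=
  cond_in _ (icast (T x.1 x.1) (x.2 - x.2) (idm x.1 : tpow 0 x.1 x.1)).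

Lemma word_out_inj (x y : tri_ob A n) (f g : word_hom x y) :
  ((x.2 <= y.2)%N -> cond_out f = cond_out g) -> f = g.
Proof.
move=> fg; rewrite -[f]cond_outK -[g]cond_outK; congr cond_in.
have [/fg //|nxy] : (x.2 <= y.2)%N \/ ~~ (x.2 <= y.2)%N by apply/orP/orbN.
by rewrite !cond_outN.
Qed.

Lemma pmul0r m m' a b c (t : tpow m' c b) : pmul (0 : tpow m b a) t = 0.
Proof. exact: (lin0 (@pmul_linl _ _ _ m m' a b c t)). Qed.

Lemma pmulr0 m m' a b c (s : tpow m b a) : pmul s (0 : tpow m' c b) = 0.
Proof. exact: (lin0 (@pmul_linr _ _ _ m m' a b c s)). Qed.

Lemma pmul_icast m m1 m' m1' a b c (s : tpow m b a) (t : tpow m' c b) :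
  m = m1 -> m' = m1' ->
  pmul (icast (T b a) m1 s) (icast (T c b) m1' t) =
  icast (T c a) (m1 + m1') (pmul s t).
Proof. by move=> e e'; case: _ / e; case: _ / e'; rewrite !icast_id. Qed.

Lemma sub_split (i j l : nat) : (i <= j -> j <= l -> l - j + (j - i) = l - i)%N.
Proof. by move=> ij jl; rewrite addnBA // subnK. Qed.

Program Definition word_cat : kcat k :=
  @KCat k (tri_ob A n) word_hom word_id word_comp _ _ _ _ _.
Next Obligation.
move=> x y f; apply: word_out_inj => le_xy.
rewrite /word_comp /word_id !cond_inK //.
have e0 : 0%N = (y.2 - y.2)%N by rewrite subnn.
rewrite -[cond_out f](icast_id (F := T x.1 y.1)) pmul_icast //.
by rewrite [pmul _ _]lact1 icast_trans ?icast_id // -e0.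
Qed.
Next Obligation.
move=> x y f; apply: word_out_inj => le_xy.
rewrite /word_comp /word_id !cond_inK //.
have e0 : 0%N = (x.2 - x.2)%N by rewrite subnn.
rewrite -[cond_out f](icast_id (F := T x.1 y.1)).
rewrite pmul_icast // pmul1 !icast_trans ?icast_id // -?e0 ?addn0 //.
Qed.
Next Obligation.
move=> x y z t h g f; apply: word_out_inj => le_xt.
rewrite /word_comp !(cond_inK _ le_xt).
have [nxy|le_xy] : ~~ (x.2 <= y.2)%N \/ (x.2 <= y.2)%N
  by apply/orP; rewrite orNb.
  by rewrite [cond_out f]cond_outN // !(pmulr0, icast0, cond_in0, cond_out0).
have [nzt|le_zt] : ~~ (z.2 <= t.2)%N \/ (z.2 <= t.2)%N
  by apply/orP; rewrite orNb.
  by rewrite [cond_out h]cond_outN // !(pmul0r, icast0, cond_in0, cond_out0).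
have [nyz|le_yz] : ~~ (y.2 <= z.2)%N \/ (y.2 <= z.2)%N
  by apply/orP; rewrite orNb.
  rewrite [cond_out g]cond_outN //.
  by rewrite !(pmul0r, pmulr0, icast0, cond_in0, cond_out0).
have le_xz := leq_trans le_xy le_yz; have le_yt := leq_trans le_yz le_zt.
rewrite (cond_inK _ le_xz) (cond_inK _ le_yt).
rewrite -{1}[cond_out h](icast_id (F := T z.1 t.1)).
rewrite -{2}[cond_out f](icast_id (F := T x.1 y.1)).
rewrite !pmul_icast ?sub_split // pmulA !icast_trans ?sub_split //.
Qed.
Next Obligation.
move=> x y z f t g g'; rewrite /word_comp cond_out_lin pmul_linl icast_lin.
by rewrite cond_in_lin.
Qed.
Next Obligation.
move=> x y z g t f f'; rewrite /word_comp cond_out_lin pmul_linr icast_lin.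
by rewrite cond_in_lin.
Qed.

(** Because [icast] extends by 0, this is 0 unless [s = r + m]; sums over all levels then need no
    side conditions. *)
Definition emb m c a (t : tpow m c a) (r s : 'I_n) :
    hom word_cat (c, r) (a, s) :=
  cond_in _ (icast (T c a) (s - r) t).

Lemma emb_lin m c a (r s : 'I_n) :
  linear (fun t : tpow m c a => emb t r s).
Proof. by move=> u t t'; rewrite /emb icast_lin cond_in_lin. Qed.

Lemma emb_eq0 m c a (t : tpow m c a) (r s : 'I_n) :
  s != (r + m)%N :> nat -> emb t r s = 0.
Proof.
move=> srm; apply: word_out_inj => /= le_rs; rewrite cond_inK // cond_out0.
rewrite /icast; case: eqP => // e.
by case/eqP: srm; rewrite e subnKC.
Qed.

Lemma emb_out c a (r s : 'I_n) (h : hom word_cat (c, r) (a, s)) :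
  h = emb (cond_out h) r s.
Proof. by rewrite /emb icast_id cond_outK. Qed.

Lemma out_emb m c a (t : tpow m c a) (r s : 'I_n) : (r <= s)%N ->
  cond_out (emb t r s) = icast (T c a) (s - r) t.
Proof. by move=> le_rs; rewrite cond_inK. Qed.

(** One of the two equalities is enough: if the other one fails, a factor on the left vanishes, and
    the total length no longer matches the levels on the right. *)
Lemma comp_emb m m' c b a (r u s : 'I_n) (t : tpow m b a) (t' : tpow m' c b) :
  u = (r + m')%N :> nat \/ s = (u + m)%N :> nat ->
  emb t u s \oc emb t' r u = emb (pmul t t') r s.
Proof.
move=> us; have [urm|urm] := eqVneq (u : nat) (r + m')%N; last first.
  case: us => [/eqP|sum]; first by rewrite (negPf urm).
  rewrite [emb t' _ _]emb_eq0 // compm0 emb_eq0 //; apply: contra urm => /eqP.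
  lia.
have [sum|sum] := eqVneq (s : nat) (u + m)%N; last first.
  rewrite [emb t _ _]emb_eq0 // comp0m emb_eq0 //; apply: contra sum => /eqP.
  lia.
have le_ru : (r <= u)%N by rewrite urm leq_addr.
have le_us : (u <= s)%N by rewrite sum leq_addr.
have le_rs := leq_trans le_ru le_us.
apply: word_out_inj => /= _; rewrite /word_comp /= !cond_inK //=.
rewrite pmul_icast; first last.
- by rewrite urm addKn.
- by rewrite sum addKn.
rewrite icast_trans //; congr addn; first by rewrite sum addKn.
by rewrite urm addKn.
Qed.

Lemma emb_id x r : emb (idm x : tpow 0 x x) r r = idm ((x, r) : ob word_cat).
Proof. by []. Qed.

(** Over all levels, these are the entries of the diagonal matrix with [f] on the diagonal. *)
Definition lev c a (f : hom A c a) r s := @emb 0 c a f r s.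

Lemma lev_lin c a r s : linear (fun f : hom A c a => lev f r s).
Proof. exact: (@emb_lin 0). Qed.

Lemma lev_off c a (f : hom A c a) (r s : 'I_n) : r != s -> lev f r s = 0.
Proof. by move=> rs; rewrite /lev emb_eq0 // addn0 eq_sym. Qed.

Lemma lev_emb m c b a (f : hom A b a) (t : tpow m c b) (r s : 'I_n) :
  lev f s s \oc emb t r s = emb (lact (tpow m) f t) r s.
Proof. by rewrite /lev comp_emb // addn0; right. Qed.

Lemma levM c b a (g : hom A b a) (f : hom A c b) (r s : 'I_n) :
  lev g s s \oc lev f r s = lev (g \oc f) r s.
Proof. exact: lev_emb. Qed.

Fixpoint ones m x : tpow m x x :=
  if m is m'.+1 then @tens k A B (regular A) (tpow m') x x x (idm x) (ones m' x)
  else idm x.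

(** The entry of [1 + E + E^2 + ..], that is [E^(s - r)]. For [s < r] the truncated difference is
    harmless, as the morphism space is then 0. *)
Definition eps x (r s : 'I_n) : hom word_cat (x, r) (x, s) :=
  emb (ones (s - r) x) r s.

Lemma eps_id x r : eps x r r = idm _.
Proof. by rewrite /eps subnn emb_id. Qed.

Lemma eps_eq0 x (r s : 'I_n) : (s < r)%N -> eps x r s = 0.
Proof.
move=> sr; apply: word_out_inj => /= rs.
by rewrite leqNgt sr in rs.
Qed.

Lemma ones_pmul i m x : pmul (ones i x) (ones m x) = ones (i + m) x.
Proof.
elim: i => [|i IH]; first exact: (@lact1 _ _ (tpow m)).
by rewrite [ones i.+1 x]/= pmul_tens IH.
Qed.

Lemma eps_emb m c a (t : tpow m c a) (r u s : 'I_n) :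
  u = (r + m)%N :> nat ->
  eps a u s \oc emb t r u = emb (pmul (ones (s - u) a) t) r s.
Proof. by move=> urm; rewrite /eps comp_emb //; left. Qed.

Lemma eps_comp x (r u s : 'I_n) : (r <= u <= s)%N ->
  eps x u s \oc eps x r u = eps x r s.
Proof.
case/andP=> ru us; rewrite /eps comp_emb ?ones_pmul ?sub_split //.
by left; rewrite subnKC.
Qed.

Lemma eps_comp_if x (r u s : 'I_n) :
  eps x u s \oc eps x r u = if (r <= u <= s)%N then eps x r s else 0.
Proof.
case: ifP => [/eps_comp //|/negbT]; rewrite negb_and -!ltnNge.
by case/orP=> /eps_eq0 ->; rewrite ?comp0m ?compm0.
Qed.

(* The coefficients of the inverse 1 - E of the geometric series
   1 + E + E^2 + .. in the shift E. *)
Definition icoef (r s : 'I_n) : k :=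
  if s == r then 1 else if s == r.+1 :> nat then -1 else 0.

Definition ieps x (r s : 'I_n) : hom word_cat (x, r) (x, s) :=
  icoef r s *: eps x r s.

Lemma icoef_diag r : icoef r r = 1.
Proof. by rewrite /icoef eqxx. Qed.

Lemma icoef_succ (r s : 'I_n) : s = r.+1 :> nat -> icoef r s = -1.
Proof.
move=> e; rewrite /icoef e eqxx ifN //; apply/eqP => /(congr1 val) /=; lia.
Qed.

Lemma icoef_off (r s : 'I_n) : s != r -> s != r.+1 :> nat -> icoef r s = 0.
Proof. by rewrite /icoef => /negPf -> /negPf ->. Qed.

(** Besides the diagonal, row [r] of [1 - E] has at most one nonzero entry, at the next level. It is
    absent at the top level and meets a vanishing [F] elsewhere. *)
Lemma sum_icoef1 (W : lmodType k) (r : 'I_n) (F : 'I_n -> W) :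
  (forall s : 'I_n, (r < s)%N -> F s = 0) ->
  \sum_s icoef r s *: F s = F r.
Proof.
move=> F0; rewrite (bigD1 r) //= icoef_diag scale1r big1 ?addr0 // => s sr.
have [e|e] := eqVneq (s : nat) r.+1; first by rewrite F0 ?scaler0 // e.
by rewrite icoef_off ?scale0r.
Qed.

Lemma sum_icoef2 (W : lmodType k) (r r' : 'I_n) (F : 'I_n -> W) :
  r' = r.+1 :> nat -> \sum_s icoef r s *: F s = F r - F r'.
Proof.
move=> e; have r'r : r' != r by apply/eqP => /(congr1 val) /=; lia.
rewrite (bigD1 r) //= icoef_diag scale1r (bigD1 r') //= icoef_succ // scaleN1r.
rewrite big1 ?addr0 // => s /andP[sr sr']; rewrite icoef_off ?scale0r //.
by apply: contra sr' => /eqP es; apply/eqP/val_inj; rewrite /= es e.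
Qed.

(** The geometric series telescopes: for [r < t], only [s = t] and [s = t - 1] contribute, with
    [eps r t] and its opposite. *)
Lemma ieps_eps x (r t : 'I_n) :
  \sum_s ieps x s t \oc eps x r s = lev (idm x) r t.
Proof.
transitivity (\sum_s icoef s t *: (eps x s t \oc eps x r s)).
  by apply: eq_bigr => s _; rewrite compZl.
rewrite (bigD1 t) //= icoef_diag scale1r eps_id comp1m.
have [<-|rt] := eqVneq r t; last rewrite lev_off //.
  rewrite eps_id [RHS]emb_id big1 ?addr0 // => s sr; rewrite eps_comp_if.
  case: ifP => [srs|]; last by rewrite scaler0.
  by case/eqP: sr; apply/val_inj => /=; lia.
have [tr|tr|/val_inj e] := ltngtP (t : nat) r; last by rewrite e eqxx in rt.
  rewrite eps_eq0 // add0r big1 // => s st; rewrite eps_comp_if.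
  by case: ifP => [|_]; [lia|rewrite scaler0].
have t1 : (t.-1 < n)%N by have := ltn_ord t; lia.
have et : t = (Ordinal t1).+1 :> nat by rewrite /=; lia.
rewrite (bigD1 (Ordinal t1)) /=; last by apply/eqP => /(congr1 val) /=; lia.
rewrite (icoef_succ et) scaleN1r eps_comp /=; last lia.
rewrite big1 ?addr0 ?subrr // => s /andP[st st']; rewrite icoef_off ?scale0r //.
  by rewrite eq_sym.
by apply: contra st' => /eqP e; apply/eqP/val_inj => /=; lia.
Qed.

(** The same cancellation along rows: for [r < s], the two contributions come from [t = r] and
    [t = r + 1]. *)
Lemma eps_ieps x (r s : 'I_n) :
  \sum_t eps x t s \oc ieps x r t = lev (idm x) r s.
Proof.
transitivity (\sum_t icoef r t *: (eps x t s \oc eps x r t)).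
  by apply: eq_bigr => t _; rewrite compZr.
have [sr|rs|/val_inj e] := ltngtP (s : nat) r.
- rewrite lev_off; last by apply/eqP => /(congr1 val) /=; lia.
  rewrite big1 // => t _; rewrite eps_comp_if; case: ifP; rewrite ?scaler0 //; lia.
- have lt_n : (r.+1 < n)%N by have := ltn_ord s; lia.
  rewrite (@sum_icoef2 _ r (Ordinal lt_n)) // !eps_comp /= ?leqnn; try lia.
  by rewrite subrr lev_off //; apply/eqP => /(congr1 val) /=; lia.
- rewrite e sum_icoef1 => [|t rt]; first by rewrite eps_id comp1m.
  by rewrite eps_comp_if; case: ifP => //; lia.
Qed.
End WordCategory.

(** * A projection onto the kernels X_l *)

Section Discrete.
Variables (k : fieldType) (S : kcat k).
Local Notation B := (discrete_subcat S).
Local Notation tpow := (tpow B).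
Local Notation tn m x t := (@tens k S B (regular S) (tpow m) _ _ _ x t).

(** Appends an identity as a new last letter: a linear section of [mu_last]. *)
Fixpoint add_id m c a : tpow m c a -> tpow m.+1 c a :=
  match m with
  | 0 => fun f => @tens k S B (regular S) (regular S) c a c f (idm c)
  | m'.+1 => @tlift k S B (regular S) (tpow m') c a (tpow m'.+2 c a)
      (fun b f t => @tens k S B (regular S) (tpow m'.+1) c a b f (add_id t))
  end.

(** The lift at [m + 1] is balanced because of linearity at [m], so both properties go through one
    induction. *)
Lemma add_id_lin_bal m c a : linear (@add_id m c a) /\
  (if m is m'.+1 then @balanced k S B (regular S) (tpow m') c a (tpow m'.+2 c a)
      (fun b f t => @tens k S B (regular S) (tpow m'.+1) c a b f (add_id t))
   else True).
Proof.
elim: m a => [|m IH] a; first by split=> //; exact: tens_linl.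
have bal : @balanced k S B (regular S) (tpow m) c a (tpow m.+2 c a)
      (fun b f t => @tens k S B (regular S) (tpow m.+1) c a b f (add_id t)).
  apply: balanced_discrete => b f; first exact: tens_linl.
  exact: linear_comp (@tens_linr _ _ _ _ _ _ _ _ _) (IH b).1.
by split=> //; exact: tlift_lin bal.
Qed.

Lemma add_id_lin m c a : linear (@add_id m c a).
Proof. by case: (add_id_lin_bal m c a). Qed.

Lemma add_id_tens m c a b (f : hom S b a) (t : tpow m c b) :
  add_id (tn m f t : tpow m.+1 c a) = tn m.+1 f (add_id t).
Proof. by case: (add_id_lin_bal m.+1 c a) => _ bal; rewrite /= (tliftE bal). Qed.

Lemma lact_tens m c b a a' (g : hom S a a') (f : hom S b a) (t : tpow m c b) :
  lact (tpow m.+1) g (tn m f t) = tn m (g \oc f) t.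
Proof. exact: tlactE. Qed.

Lemma add_id_lact m c a a' (g : hom S a a') (t : tpow m c a) :
  add_id (lact (tpow m) g t) = lact (tpow m.+1) g (add_id t).
Proof.
case: m t => [|m] t; first by rewrite /= tlactE.
move: t; apply: tens_ext => [||b f t].
- exact: linear_comp (@add_id_lin _ _ _) (@lact_linr _ _ (tpow m.+1) _ _ _ g).
- exact: linear_comp (@lact_linr _ _ (tpow m.+2) _ _ _ g) (@add_id_lin _ _ _).
- by rewrite add_id_tens /= !tlactE -add_id_tens.
Qed.

(** The projection onto the kernel of [mu_last] along the words ending in an identity. It fixes the
    kernel, which is therefore spanned by the images of pure tensors. *)
Definition kproj m c a (t : tpow m.+1 c a) : tpow m.+1 c a :=
  t - add_id (mu_last B m c a t).

Lemma kproj_lin m c a : linear (@kproj m c a).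
Proof.
apply: lin_sub => //.
exact: linear_comp (@add_id_lin _ _ _) (@bmor_lin _ _ _ _ (mu_last B m) c a).
Qed.

Lemma kproj_tens m c b a (f : hom S b a) (t : tpow m.+1 c b) :
  kproj (tn m.+1 f t : tpow m.+2 c a) = tn m.+1 f (kproj t).
Proof.
have e : mu_last B m.+1 c a (tn m.+1 f t) = tn m f (mu_last B m c b t).
  exact: tmap_funE.
rewrite /kproj e add_id_tens.
by rewrite -(linB (@tens_linr k S B (regular S) (tpow m.+1) c a b f)).
Qed.

Lemma kproj_lact m c a a' (g : hom S a a') (t : tpow m.+1 c a) :
  lact (tpow m.+1) g (kproj t) = kproj (lact (tpow m.+1) g t).
Proof.
rewrite /kproj (linB (@lact_linr _ _ (tpow m.+1) _ _ _ g)) -add_id_lact.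
by rewrite bmor_l.
Qed.

Lemma kproj_id m c a (t : tpow m.+1 c a) : mu_last B m c a t = 0 -> kproj t = t.
Proof. by move=> t0; rewrite /kproj t0 (lin0 (@add_id_lin _ _ _)) subr0. Qed.
End Discrete.

(** * The triangular category as a subcategory of the words *)

Section TriangularInWord.
Variables (k : fieldType) (S : kcat k) (B : wide_subcat S) (n : nat).
Local Notation W := (word_cat B n).

Definition tri_val (x y : tri_ob S n) (w : hom (tri_cat B n) x y) : hom W x y :=
  cond_in _ (tker_val (cond_out w)).

Lemma tri_val_lin x y : linear (@tri_val x y).
Proof.
apply: (linear_comp (f := cond_in (x.2 <= y.2)%N) (@cond_in_lin _ _ _)).
apply: (linear_comp (f := @tker_val _ _ B (y.2 - x.2) x.1 y.1)).
  exact: tker_val_lin.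
exact: cond_out_lin.
Qed.

Lemma tri_val_id x : tri_val (idm (x : ob (tri_cat B n))) = idm (x : ob W).
Proof.
apply: word_out_inj => /= le_xx.
change (cond_out (tri_val (tri_id B x)) = cond_out (word_id B x)).
by rewrite /tri_val /tri_id /word_id !cond_inK // tker_val_icast.
Qed.

Lemma tri_val_comp x y z (g : hom (tri_cat B n) y z) (f : hom (tri_cat B n) x y) :
  tri_val (g \oc f) = tri_val g \oc tri_val f.
Proof.
apply: word_out_inj => /= le_xz.
change (cond_out (tri_val (tri_comp g f)) =
  cond_out (word_comp (tri_val g) (tri_val f))).
rewrite /tri_val /tri_comp /word_comp !(cond_inK _ le_xz).
rewrite tker_val_icast xmulE; congr icast.
have [le_xy|nxy] : (x.2 <= y.2)%N \/ ~~ (x.2 <= y.2)%N by apply/orP/orbN.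
  have [le_yz|nyz] : (y.2 <= z.2)%N \/ ~~ (y.2 <= z.2)%N by apply/orP/orbN.
    by rewrite !cond_inK.
  rewrite [cond_out g]cond_outN // !(lin0 (@tker_val_lin _ _ _ _ _ _)).
  by rewrite cond_in0 cond_out0 !pmul0r.
rewrite [cond_out f]cond_outN // !(lin0 (@tker_val_lin _ _ _ _ _ _)).
by rewrite cond_in0 cond_out0 !pmulr0.
Qed.

Lemma tri_val_inj x y : injective (@tri_val x y).
Proof.
move=> f g /(congr1 cond_out) fg; apply: tri_out_inj => le_xy.
by apply: tker_val_inj; move: fg; rewrite !cond_inK.
Qed.

Lemma tri_val_emb m c a (t : tpow B m c a) (r s : 'I_n) : in_tker t ->
  exists w, tri_val (w : hom (tri_cat B n) (c, r) (a, s)) = emb t r s.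
Proof.
move=> t0; exists (cond_in _ (icast (fun i => tker B i c a) (s - r) (tker_mk t0))).
apply: word_out_inj => /= le_rs; rewrite !cond_inK //.
by rewrite tker_val_icast tker_mkK.
Qed.
End TriangularInWord.

(** * A criterion for a category to be triangular *)

(* [C] stands for a filtered category, [D r s f] for the component from the
   copy of level [r] to the copy of level [s] of a morphism [f] of [S]. *)
Section FilteredCriterion.
Variables (k : fieldType) (S : kcat k) (n : nat) (C : kcat k).
Variable q : tri_ob S n -> ob C.
Local Notation B := (discrete_subcat S).
Local Notation tpow := (tpow B).
Local Notation tn m x t := (@tens k S B (regular S) (tpow m) _ _ _ x t).
Local Notation W := (word_cat B n).

Variable D : forall c a (r s : 'I_n), hom S c a -> hom C (q (c, r)) (q (a, s)).
Hypothesis D_lin : forall c a r s, linear (@D c a r s).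
Hypothesis D_id : forall c r, D r r (idm c) = idm _.
Hypothesis D_id0 : forall c (r s : 'I_n), r != s -> D r s (idm c) = 0.
Hypothesis D_lt : forall c a (r s : 'I_n) (f : hom S c a),
  (s < r)%N -> D r s f = 0.
Hypothesis D_comp : forall c b a r s (g : hom S b a) (f : hom S c b),
  D r s (g \oc f) = \sum_t D t s g \oc D r t f.
(** Generation of [C] by the components, phrased as an induction principle with fixed source in
    which generators are composed on the left. *)
Hypothesis D_gen : forall c (r : 'I_n)
  (P : forall a (s : 'I_n), hom C (q (c, r)) (q (a, s)) -> Prop),
  P c r (idm _) -> (forall a (s : 'I_n), P a s 0) ->
  (forall a (s : 'I_n) t f g, P a s f -> P a s g -> P a s (t *: f + g)) ->
  (forall b a (t s : 'I_n) (f : hom S b a) g, P b t g -> P a s (D t s f \oc g)) ->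
  forall a s h, P a s h.

Variable Psi : forall x y, hom C (q x) (q y) -> hom W x y.
Hypothesis Psi_lin : forall x y, linear (@Psi x y).
Hypothesis Psi_id : forall x, Psi (idm (q x)) = idm (x : ob W).
Hypothesis Psi_comp : forall x y z (g : hom C (q y) (q z)) (f : hom C (q x) (q y)),
  Psi (g \oc f) = Psi g \oc Psi f.
(** The right-hand side is an entry of the conjugate [(1 - E)^-1 f (1 - E)]. *)
Hypothesis Psi_D : forall c a r s (f : hom S c a),
  Psi (D r s f) = \sum_t eps B a t s \oc lev B f t t \oc ieps B c r t.

Lemma Psi_D_diag c a r (f : hom S c a) : Psi (D r r f) = lev B f r r.
Proof.
rewrite Psi_D; under eq_bigr => t _ do rewrite compZr.
rewrite sum_icoef1 => [|t rt]; last by rewrite eps_eq0 // !comp0m.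
by rewrite !eps_id comp1m compm1.
Qed.

Lemma Psi_D_succ c a (r r' s : 'I_n) (f : hom S c a) : r' = r.+1 :> nat ->
  Psi (D r s f) = eps B a r s \oc lev B f r r -
                  eps B a r' s \oc lev B f r' r' \oc eps B c r r'.
Proof.
move=> er; rewrite Psi_D; under eq_bigr => t _ do rewrite compZr.
by rewrite (sum_icoef2 _ er) eps_id compm1.
Qed.

(** The shift puts an identity in front of [t], and [f] is then multiplied into that letter. This
    factors a pure tensor into letters and shifts. *)
Lemma eps_succ_emb m c b a (f : hom S b a) (t : tpow m c b) (r u u' : 'I_n) :
  u = (r + m)%N :> nat -> u' = u.+1 :> nat ->
  lev B f u' u' \oc eps B b u u' \oc emb t r u =
  emb (tn m f t : tpow m.+1 c a) r u'.
Proof.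
move=> eu eu'; rewrite -compA eps_emb // eu' subSnn.
rewrite [pmul _ _](_ : _ = tn m (idm b) t); last first.
  by rewrite [ones _ _ _]/= pmul_tens /= lact1.
by rewrite lev_emb lact_tens compm1.
Qed.

(* The inverse of [Psi], extended to all the words by killing those whose last
   letter is an identity. *)
Fixpoint Gam m c a (r s : 'I_n) : tpow m c a -> hom C (q (c, r)) (q (a, s)) :=
  match m with
  | 0 => fun f => D r s f
  | m'.+1 => @tlift k S B (regular S) (tpow m') c a (hom C (q (c, r)) (q (a, s)))
      (fun b f t => Gam r s (lact (tpow m') f t) -
         D (insubd s (r + m')%N) s f \oc Gam r (insubd s (r + m')%N) t)
  end.

Lemma Gam_lin_bal m c a r s : linear (@Gam m c a r s) /\
  (if m is m'.+1 then
    @balanced k S B (regular S) (tpow m') c a (hom C (q (c, r)) (q (a, s)))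
      (fun b f t => Gam r s (lact (tpow m') f t) -
         D (insubd s (r + m')%N) s f \oc Gam r (insubd s (r + m')%N) t)
   else True).
Proof.
elim: m a s => [|m IH] a s; first by split=> //; exact: D_lin.
have bal : @balanced k S B (regular S) (tpow m) c a (hom C (q (c, r)) (q (a, s)))
      (fun b f t => Gam r s (lact (tpow m) f t) -
         D (insubd s (r + m)%N) s f \oc Gam r (insubd s (r + m)%N) t).
  apply: balanced_discrete => b f; apply: lin_sub.
  - exact: linear_comp (IH _ _).1 (@lact_linl _ _ (tpow m) _ _ _ f).
  - exact: linear_comp (@comp_linl _ _ _ _ _ _) (@D_lin _ _ _ _).
  - exact: linear_comp (IH _ _).1 (@lact_linr _ _ (tpow m) _ _ _ f).
  - exact: linear_comp (@comp_linr _ _ _ _ _ _) (IH _ _).1.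
by split=> //; exact: tlift_lin bal.
Qed.

#[local] Arguments Gam : simpl never.

Lemma Gam_lin m c a r s : linear (@Gam m c a r s).
Proof. by case: (Gam_lin_bal m c a r s). Qed.

(** [u] is the level at which the tail [t] ends; since it is a genuine level, [insubd] does not fall
    back on its default [s]. *)
Lemma Gam_tens m c b a (r u s : 'I_n) (f : hom S b a) (t : tpow m c b) :
  u = (r + m)%N :> nat ->
  Gam r s (tn m f t : tpow m.+1 c a) =
  Gam r s (lact (tpow m) f t) - D u s f \oc Gam r u t.
Proof.
case: (Gam_lin_bal m.+1 c a r s) => _ bal eu.
rewrite [LHS](tliftE bal).
suff -> : insubd s (r + m)%N = u by [].
by apply/val_inj; rewrite val_insubd -eu ltn_ord.
Qed.

(** For one letter this is [D_comp], the terms below [r] being 0. For [g (x) t], the induction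
    hypothesis expands the action of [f] on [g t], and [D_comp] expands the component of [f g]. *)
Lemma Gam_lact m c b a (r s : 'I_n) (f : hom S b a) (t : tpow m c b) :
  (r + m <= s)%N ->
  Gam r s (lact (tpow m) f t) =
  \sum_(u : 'I_n | (r + m <= u)%N) D u s f \oc Gam r u t.
Proof.
elim: m b a s f t => [|m IH] b a s f t le_s.
  rewrite [LHS]D_comp (bigID (fun u : 'I_n => (r + 0 <= u)%N)) /= addrC.
  rewrite big1 ?add0r //.
  by move=> u; rewrite addn0 -ltnNge => ur; rewrite (D_lt _ ur) compm0.
have lt_n : (r + m < n)%N by have := ltn_ord s; lia.
pose u0 := Ordinal lt_n; have eu0 : u0 = (r + m)%N :> nat by [].
move: t; apply: tens_ext => [||b' g t].
- exact: linear_comp (@Gam_lin _ _ _ _ _) (@lact_linr _ _ (tpow m.+1) _ _ _ f).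
- apply: lin_bigsum => u.
  exact: (linear_comp (@comp_linr k C _ _ _ (D u s f)) (@Gam_lin m.+1 c b r u)).
rewrite lact_tens (Gam_tens _ _ _ eu0) -lactM IH; last by lia.
have pu0 : (r + m <= u0)%N by [].
(* At the lowest level [u0] only the diagonal component of [g] survives: the others would go
   down. *)
have du0 : Gam r u0 (lact (tpow m) g t) = D u0 u0 g \oc Gam r u0 t.
  rewrite IH // (bigD1 u0) //= big1 ?addr0 // => u /andP[le_u ne_u].
  by rewrite D_lt ?comp0m //= ltn_neqAle le_u andbT eq_sym; apply: contra ne_u.
have -> : D u0 s (f \oc g) =
    \sum_(u : 'I_n | (r + m <= u)%N) D u s f \oc D u0 u g.
  rewrite D_comp (bigID (fun u : 'I_n => (r + m <= u)%N)) /= addrC big1 ?add0r //.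
  by move=> u; rewrite -ltnNge => ur; rewrite (@D_lt _ _ u0) ?compm0.
(* The terms at [u0] cancel by [du0], which raises the lower bound to [r + m + 1]; the others
   regroup into [Gam] of [g (x) t]. *)
rewrite comp_suml -sumrB (bigD1 u0) //= du0 compA subrr add0r.
apply: eq_big => [u|u].
  by rewrite addnS ltn_neqAle andbC eq_sym; congr (~~ _ && _).
move=> _; rewrite (Gam_tens _ _ _ eu0) compBr compA //.
Qed.

(** Thus [Gam r s t] with [s] beyond [r + m] is the value on [t] padded with leading identities up
    to level [s]. Each of them contributes nothing, since [D] of an identity vanishes between
    distinct levels. *)
Lemma Gam_ones i m c a (r s : 'I_n) (t : tpow m c a) : (r + (i + m) <= s)%N ->
  Gam r s (pmul (ones B i a) t) = Gam r s t.
Proof.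
elim: i => [|i IH] le_s; first by congr Gam; exact: (@lact1 _ _ (tpow m)).
have lt_n : (r + (i + m) < n)%N by have := ltn_ord s; lia.
rewrite [ones _ _ _]/= pmul_tens (@Gam_tens _ _ _ _ _ (Ordinal lt_n)) //.
rewrite D_id0 ?comp0m ?subr0 /=; last by apply/eqP => /(congr1 val) /=; lia.
by rewrite (@lact1 _ _ (tpow (i + m))) IH //; lia.
Qed.

Definition Gamma x y (h : hom W x y) : hom C (q (x.1, x.2)) (q (y.1, y.2)) :=
  Gam x.2 y.2 (cond_out h).

Lemma Gamma_emb m c a (t : tpow m c a) (r s : 'I_n) : s = (r + m)%N :> nat ->
  Gamma (emb t r s) = Gam r s t.
Proof.
move=> es; have rs : (r <= s)%N by lia.
rewrite /Gamma out_emb //=.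
have e : m = (s - r)%N by lia.
by case: _ / e; rewrite icast_id.
Qed.

Lemma Gamma_lin x y : linear (@Gamma x y).
Proof. exact: linear_comp (@Gam_lin _ _ _ _ _) (@cond_out_lin _ _ _). Qed.

(** For [u < s], the composite with a word [t] is, up to leading identities, [f t - f (x) t], and
    the recursion defining [Gam] returns [D f] composed with the value on [t]. For [u = s] only the
    diagonal term of [Gam_lact] remains. *)
Lemma Gamma_Psi_D c b a (r u s : 'I_n) (f : hom S b a)
    (h : hom W (c, r) (b, u)) :
  Gamma (Psi (D u s f) \oc h) = D u s f \oc Gamma h.
Proof.
have [su|us|/val_inj e] := ltngtP (s : nat) u.
- by rewrite D_lt // (lin0 (@Psi_lin _ _)) !comp0m (lin0 (@Gamma_lin _ _)).
- have [ur|ru] := ltnP u r.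
    suff -> : h = 0 by rewrite compm0 !(lin0 (@Gamma_lin _ _)) compm0.
    by apply: word_out_inj => /= ru; rewrite leqNgt ur in ru.
  have lt_n : (u.+1 < n)%N by have := ltn_ord s; lia.
  pose u' := Ordinal lt_n; have eu' : u' = u.+1 :> nat by [].
  rewrite [h]emb_out; move: (cond_out h) => t.
  have eu : u = (r + (u - r))%N :> nat by lia.
  rewrite (Psi_D_succ _ _ eu') compBl (linB (@Gamma_lin _ _)) -!compA lev_emb.
  rewrite [lev _ _ _ _ \oc _]compA eps_succ_emb // !eps_emb ?eu' //=; try lia.
  rewrite !Gamma_emb ?Gam_ones ?eu' //=; try lia.
  by rewrite (Gam_tens _ _ _ eu) opprB addrC subrK.
- rewrite {s}e Psi_D_diag; have [ur|ru] := ltnP u r.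
    suff -> : h = 0 by rewrite compm0 !(lin0 (@Gamma_lin _ _)) compm0.
    by apply: word_out_inj => /= ru; rewrite leqNgt ur in ru.
  rewrite [h]emb_out; move: (cond_out h) => t.
  have eu : u = (r + (u - r))%N :> nat by lia.
  rewrite lev_emb !Gamma_emb // Gam_lact -?eu // (bigD1 u) //= big1 ?addr0 //.
  move=> v /andP[uv vu]; rewrite D_lt ?comp0m //.
  by rewrite ltn_neqAle uv andbT eq_sym; apply: contra vu.
Qed.

(** [Gamma] preserves identities and turns composition with [Psi (D f)] into composition with [D f],
    so the generators settle the claim. *)
Lemma GammaK c a r s (h : hom C (q (c, r)) (q (a, s))) : Gamma (Psi h) = h.
Proof.
move: a s h; apply: D_gen => [|a s|a s t f g IHf IHg|b a t s f g IH].
- by rewrite Psi_id -emb_id Gamma_emb ?addn0 //= D_id.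
- by rewrite (lin0 (@Psi_lin _ _)) (lin0 (@Gamma_lin _ _)).
- by rewrite Psi_lin Gamma_lin IHf IHg.
- by rewrite Psi_comp Gamma_Psi_D IH.
Qed.

(** With at least two letters in [u], multiplying its last two letters commutes with left
    concatenation by [t]. This allows padding by identities, which are not themselves in a
    kernel. *)
Lemma in_tker_pmulS i m c b a (t : tpow i b a) (u : tpow m.+1 c b) :
  in_tker u -> in_tker (pmul t u).
Proof.
case: i t => [|i] t u0; last exact: mu_last_pmulS u0.
have u1 : mu_last B m c b u = 0 := u0.
change (mu_last B m c a (lact (tpow m.+1) t u) = 0).
by rewrite bmor_l u1 (lin0 (@lact_linr _ _ (tpow m) _ _ _ t)).
Qed.

Lemma Psi_D_tri c a r s (f : hom S c a) :
  exists w, tri_val (w : hom (tri_cat B n) (c, r) (a, s)) = Psi (D r s f).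
Proof.
have [sr|rs|/val_inj e] := ltngtP (s : nat) r.
- exists 0; rewrite D_lt // (lin0 (@Psi_lin _ _)).
  exact: (lin0 (@tri_val_lin _ _ _ _ _ _)).
- have lt_n : (r.+1 < n)%N by have := ltn_ord s; lia.
  pose r' := Ordinal lt_n; have er' : r' = r.+1 :> nat by [].
  (* Factoring [E^(s - r - 1)] out of the two terms of [Psi_D_succ] leaves this commutator of [f]
     with [E]. *)
  pose t : tpow 1 c a := tn 0 (idm a) f - tn 0 f (idm c).
  have t0 : mu_last B 0 c a t = 0.
    rewrite (linB (@bmor_lin _ _ _ _ (mu B) c a)) /= !mu_funE comp1m compm1.
    exact: subrr.
  have e : Psi (D r s f) = eps B a r' s \oc emb t r r'.
    rewrite (Psi_D_succ _ _ er') /t (linB (@emb_lin _ _ _ _ _ _ _ _ _)).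
    have er : r = (r + 0)%N :> nat by rewrite addn0.
    rewrite -!(eps_succ_emb _ _ er er') emb_id compm1 compBr.
    have -> : lev B (idm a) r' r' = idm ((a, r') : ob W) by [].
    rewrite comp1m compA.
    rewrite -[eps B a r s](@eps_comp _ _ _ _ _ _ r'); last by rewrite er' leqnSn; lia.
    by rewrite -!compA.
  rewrite e eps_emb //; last by rewrite addn1.
  exact: tri_val_emb (in_tker_pmulS _ t0).
- by rewrite e Psi_D_diag; apply: (@tri_val_emb _ _ _ _ 0).
Qed.

Lemma Psi_tri c a r s (h : hom C (q (c, r)) (q (a, s))) :
  exists w, tri_val (w : hom (tri_cat B n) (c, r) (a, s)) = Psi h.
Proof.
move: a s h; apply: D_gen => [|a s|a s t f g [u eu] [v ev]|b a t s f g [v ev]].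
- by exists (idm _); rewrite tri_val_id Psi_id.
- exists 0; rewrite (lin0 (@Psi_lin _ _)).
  exact: (lin0 (@tri_val_lin _ _ _ _ _ _)).
- by exists (t *: u + v); rewrite tri_val_lin Psi_lin eu ev.
- have [u eu] := Psi_D_tri t s f.
  by exists (u \oc v); rewrite tri_val_comp Psi_comp eu ev.
Qed.

Definition Psi_im x y (w : hom W x y) := exists h, Psi (h : hom C (q x) (q y)) = w.

Lemma Psi_im0 x y : @Psi_im x y 0.
Proof. by exists 0; apply: (lin0 (@Psi_lin _ _)). Qed.

Lemma Psi_im_lin x y a (f g : hom W x y) :
  Psi_im f -> Psi_im g -> Psi_im (a *: f + g).
Proof. by move=> [f' <-] [g' <-]; exists (a *: f' + g'); apply: Psi_lin. Qed.

Lemma Psi_imB x y (f g : hom W x y) : Psi_im f -> Psi_im g -> Psi_im (f - g).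
Proof. by move=> [f' <-] [g' <-]; exists (f' - g'); apply: (linB (@Psi_lin _ _)). Qed.

Lemma Psi_im_comp x y z (g : hom W y z) (f : hom W x y) :
  Psi_im g -> Psi_im f -> Psi_im (g \oc f).
Proof. by move=> [g' <-] [f' <-]; exists (g' \oc f'); apply: Psi_comp. Qed.

Lemma Psi_im_D c a r s (f : hom S c a) : Psi_im (Psi (D r s f)).
Proof. by exists (D r s f). Qed.

(** The padding up to [s] is part of the claim because the induction trades the first letter of a
    tensor for one more leading identity. *)
Lemma Psi_im_kproj m c a (r u s : 'I_n) (t : tpow m.+1 c a) :
  u = (r + m.+1)%N :> nat -> (u <= s)%N ->
  Psi_im (eps B a u s \oc emb (kproj t) r u).
Proof.
elim: m a u s t => [|m IH] a u s t eu us; move: t; apply: tens_ind.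
- rewrite (lin0 (@kproj_lin _ _ _ _ _)) (lin0 (@emb_lin _ _ _ _ _ _ _ _ _)).
  by rewrite compm0; apply: Psi_im0.
- move=> v t t' IHt IHt'; rewrite kproj_lin emb_lin compDr compZr.
  exact: Psi_im_lin.
- move=> b f g; have er : r = (r + 0)%N :> nat by rewrite addn0.
  have eu' : u = r.+1 :> nat by rewrite eu addn1.
  (* Both terms contain [E^(s - r) f g], which cancels; what is left is [E^(s - u)] applied to
     [f E g - f g E]. *)
  suff -> : eps B a u s \oc emb (kproj (tn 0 f g : tpow 1 c a)) r u =
      Psi (D r s (f \oc g)) - Psi (D r s f) \oc Psi (D r r g).
    by apply: Psi_imB; [|apply: Psi_im_comp]; apply: Psi_im_D.
  rewrite Psi_D_diag !(Psi_D_succ _ _ eu') compBl -[_ \oc lev B g r r]compA levM.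
  rewrite opprB addrC addrA subrK.
  have -> : kproj (tn 0 f g : tpow 1 c a) = tn 0 f g - tn 0 (f \oc g) (idm c).
    by rewrite /kproj [add_id _]/= mu_funE.
  rewrite (linB (@emb_lin _ _ _ _ _ _ _ _ _)) -!(eps_succ_emb _ _ er eu').
  by rewrite emb_id compm1 compBr !compA.
- rewrite (lin0 (@kproj_lin _ _ _ _ _)) (lin0 (@emb_lin _ _ _ _ _ _ _ _ _)).
  by rewrite compm0; apply: Psi_im0.
- move=> v t t' IHt IHt'; rewrite kproj_lin emb_lin compDr compZr.
  exact: Psi_im_lin.
- move=> b f t; have lt_n : (r + m.+1 < n)%N by have := ltn_ord u; lia.
  pose u' := Ordinal lt_n; have eu' : u' = (r + m.+1)%N :> nat by [].
  have euu : u = u'.+1 :> nat by rewrite eu /= addnS.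
  rewrite kproj_tens -(eps_succ_emb _ _ eu' euu) compA.
  (* [E^(s - u) f E] is the subtracted part of [Psi (D u' s f)]. The complementary part
     [E^(s - u') f] acts inside the projection by [kproj_lact], where the induction hypothesis
     applies. *)
  suff -> : eps B a u s \oc (lev B f u u \oc eps B b u' u) \oc emb (kproj t) r u' =
      eps B a u' s \oc emb (kproj (lact (tpow m.+1) f t)) r u' -
      Psi (D u' s f) \oc emb (kproj t) r u'.
    apply: Psi_imB; first by apply: IH => //; lia.
    apply: Psi_im_comp; first exact: Psi_im_D.
    by rewrite -[emb _ _ _]comp1m -(eps_id B); apply: IH.
  rewrite (Psi_D_succ _ _ euu) compBl -kproj_lact -lev_emb !compA.
  by rewrite opprB addrC addrNK.
Qed.

(** A single letter is a diagonal component; a longer word of the kernel is fixed by [kproj]. *)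
Lemma tri_Psi_im c a r s (w : hom (tri_cat B n) (c, r) (a, s)) :
  Psi_im (tri_val w).
Proof.
have [nrs|rs] : ~~ (r <= s)%N \/ (r <= s)%N by apply/orP; rewrite orNb.
  suff -> : tri_val w = 0 by apply: Psi_im0.
  by apply: word_out_inj => /= rs; rewrite rs in nrs.
have -> : tri_val w = emb (tker_val (cond_out w)) r s by rewrite /emb icast_id.
move: (tker_valP (cond_out w)); move: (tker_val _) => /=.
have : s = (r + (s - r))%N :> nat by lia.
move: (s - r)%N => [|m] es t t0.
  have e : r = s by apply: val_inj => /=; lia.
  by subst s; exists (D r r t); rewrite Psi_D_diag.
rewrite -[t]kproj_id // -[emb _ _ _]comp1m -(eps_id B).
exact: Psi_im_kproj.
Qed.

(** [Psi] lifts through the injective maps [tri_val], which makes the lift functorial. It is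
    injective since [Gamma] is a left inverse of [Psi], and surjective by [tri_Psi_im]. *)
Lemma filtered_criterion : kcat_isomorphic (pull_cat q) (tri_cat B n).
Proof.
pose F1 x y (h : hom (pull_cat q) x y) : hom (tri_cat B n) x y :=
  match x, y return hom (pull_cat q) x y -> hom (tri_cat B n) x y with
  | (c, r), (a, s) => fun h => sval (cid (Psi_tri h))
  end h.
have F1P x y (h : hom (pull_cat q) x y) : tri_val (F1 x y h) = Psi h.
  by case: x y h => [c r] [a s] h; apply: (svalP (cid (Psi_tri h))).
have F1_lin x y : linear (F1 x y).
  by move=> a f g; apply: tri_val_inj; rewrite tri_val_lin !F1P Psi_lin.
have F1_id x : F1 x x (idm x) = idm (x : ob (tri_cat B n)).
  by apply: tri_val_inj; rewrite tri_val_id F1P Psi_id.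
have F1_comp x y z g f : F1 x z (g \oc f) = F1 y z g \oc F1 x y f.
  by apply: tri_val_inj; rewrite tri_val_comp !F1P Psi_comp.
pose F := @KFunctor k (pull_cat q) (tri_cat B n) id F1 F1_lin F1_id F1_comp.
apply: (@kcat_isomorphic_bij k _ _ F); first by exists id.
move=> [c r] [a s].
have F_inj : injective (F1 (c, r) (a, s)).
  move=> f g /(congr1 (@tri_val _ _ _ _ _ _)); rewrite !F1P.
  by move=> /(congr1 (@Gamma _ _)); rewrite !GammaK.
have F_surj w : exists h, F1 (c, r) (a, s) h = w.
  by have [h eh] := tri_Psi_im w; exists h; apply: tri_val_inj; rewrite F1P.
exists (fun w => sval (cid (F_surj w))) => [h|w].
  by apply: F_inj; apply: (svalP (cid (F_surj _))).
exact: (svalP (cid (F_surj w))).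
Qed.
End FilteredCriterion.

(** * Mesh relations of framed repetition quivers *)

Lemma big_sig_val (R : Type) (idx : R) (op : Monoid.com_law idx) (I : finType)
    (P : pred I) (E : I -> R) :
  \big[op/idx]_(i : {i | P i}) E (val i) = \big[op/idx]_(i | P i) E i.
Proof.
rewrite [RHS](reindex_omap (val : {i | P i} -> I) insub) /=; last first.
  by move=> i Pi; rewrite insubT.
by apply: eq_bigl => -[i Pi] /=; rewrite insubT Pi /= eqxx.
Qed.

Section MeshSplit.
Variables (k : fieldType) (Q : fin_quiver) (n : nat) (C : kcat k).
Local Notation ZQ := (rep_quiver (framed Q n)).
Variable o : vtx ZQ -> ob C.
Variable F : forall a : arr ZQ, hom C (o (src a)) (o (tgt a)).

(** The terms of the mesh relation that avoid frozen vertices. They come from [Q] alone and have the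
    same shape for every number of levels. *)
Definition old_mesh i p : hom C (o (inl i, p - 1)) (o (inl i, p)) :=
  \sum_(a : farr Q | ftgt a == i)
     pmor F (inl i, p - 1) (inl i, p) [:: inr (inl a, p); inl (inl a, p)] +
  \sum_(a : farr Q | fsrc a == i)
     pmor F (inl i, p - 1) (inl i, p) [:: inl (inl a, p - 1); inr (inl a, p)].

Lemma mesh_split i p :
  fmor (path_functor F) (mesh_sum k ((inl i, p) : vtx ZQ)) =
  old_mesh i p + \sum_(r < n)
    (F (inr (inr (i, r), p)) : hom C (o (inr (i, r), p - 1)) (o (inl i, p)))
    \oc (F (inl (inr (i, r), p - 1))
      : hom C (o (inl i, p - 1)) (o (inr (i, r), p - 1))).
Proof.
set x : vtx ZQ := (inl i, p).
pose E (b : farr (framed Q n) + farr (framed Q n)) :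
    hom C (o (rep_tau x)) (o x) :=
  pmor F (rep_tau x) x [:: rep_sigma (arr_at p b); arr_at p b].
transitivity (\sum_(b : arr_to x) E (val b)).
  rewrite (lin_sum (@fmor_lin _ _ _ (path_functor F) _ _)).
  by apply: eq_bigr => b _; apply: path_fmorU.
rewrite (big_sig_val _ (fun b => tgt (arr_at x.2 b) == x) E) big_sumType /=.
rewrite !big_sumType /=.
(* The arrows [i -> i_r] end at frozen vertices, so none of them ends at [x]. *)
rewrite [X in _ + X + _]big1 ?addr0; last by move=> [j r] /andP[].
rewrite addrA; congr (_ + _ + _).
- by apply: eq_bigl => a; rewrite xpair_eqE eqxx andbT.
- by apply: eq_bigl => a; rewrite xpair_eqE eqxx andbT.
transitivity (\sum_(jr : fvtx Q * 'I_n | (jr.1 == i) && true) E (inr (inr jr))).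
  by apply: eq_bigl => -[j r]; rewrite xpair_eqE eqxx !andbT.
transitivity (\sum_(j | j == i) \sum_(r < n) E (inr (inr (j, r)))).
  by rewrite pair_big; apply: eq_bigr => -[].
rewrite big_pred1_eq; apply: eq_bigr => r _.
rewrite /E [LHS](pmor_cons F (inl (inr (i, r), p - 1))).
by congr (_ \oc _); apply: (pmor1 F (inr (inr (i, r), p))).
Qed.
End MeshSplit.

(** * Generators and relations of R^n-filt *)

Section RfiltFunctor.
Variables (k : fieldType) (Q : fin_quiver) (n : nat).
Local Notation ZQ := (rep_quiver (framed Q n)).
Local Notation R := (Rfilt k Q n).

Definition Rpi : kfunctor (path_cat k ZQ) R :=
  fcompose (pi_functor (gen_ideal (@filt_rel k Q n)))
    (pi_functor (gen_ideal (@mesh_rel (framed Q n) k))).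

Definition garr (a : arr ZQ) : hom R (src a) (tgt a) :=
  fmor Rpi (arrow_mor k a).

Lemma Rpi_surj (x y : vtx ZQ) (f : hom R x y) : exists u, f = fmor Rpi u.
Proof.
have [g ->] := lpi_surj f; have [u ->] := lpi_surj g.
by exists u.
Qed.

Lemma Rfilt_ind (x : vtx ZQ) (P : forall y : vtx ZQ, hom R x y -> Prop) :
  (forall y, P y 0) ->
  (forall y a u v, P y u -> P y v -> P y (a *: u + v)) ->
  P x (idm (x : ob R)) ->
  (forall a u, P (src a) u -> P (tgt a) (garr a \oc u)) ->
  forall y u, P y u.
Proof.
move=> P0 PL P1 PS y f; have [u ->] := Rpi_surj f.
move: y u {f}; apply: path_cat_ind => [y|y a u v Pu Pv||a u Pu].
- by rewrite (lin0 (@fmor_lin _ _ _ Rpi _ _)).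
- by rewrite fmor_lin; apply: PL.
- by rewrite fmor1.
- by rewrite fmorM; apply: PS.
Qed.

Lemma pmor_garr (x y : vtx ZQ) (p : path_of x y) :
  pmor (o := id : vtx ZQ -> ob R) garr x y (val p) =
  fmor Rpi (<< p >> : path_hom k x y).
Proof.
case: p => p /=; elim: p x => [|a p IH] x pP /=.
  have e : x = y by apply/eqP.
  subst y; have -> : exist _ [::] pP = path_id x :> path_of x x by apply: val_inj.
  by rewrite id_castE -[LHS](fmor1 Rpi).
case/andP: (pP) => /eqP e pa; subst x.
rewrite src_castE (IH _ pa) -[LHS](fmorM Rpi).
have -> : exist _ (a :: p) pP = path_comp (exist _ p pa : path_of _ _) (arrow_path a)
  by apply: val_inj.
by congr (fmor Rpi _); apply: path_hom_compU.
Qed.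

Definition Rold := old_mesh (o := id : vtx ZQ -> ob R) garr.

Lemma Rmesh i p : Rold i p + \sum_(r < n)
    (garr (inr (inr (i, r), p)) : hom R (inr (i, r), p - 1) (inl i, p))
    \oc (garr (inl (inr (i, r), p - 1)) : hom R (inl i, p - 1) (inr (i, r), p - 1)) = 0.
Proof.
rewrite -[LHS](@mesh_split k Q n R (id : vtx ZQ -> ob R) garr).
transitivity (fmor Rpi (mesh_sum k ((inl i, p) : vtx ZQ))).
  move: (mesh_sum _ _); apply: malg_ext => [||q].
  - exact: (@fmor_lin _ _ _ (path_functor (o := id : vtx ZQ -> ob R) garr)).
  - exact: (@fmor_lin _ _ _ Rpi).
  - by rewrite [LHS]path_fmorU pmor_garr.
pose x : vtx ZQ := (inl i, p).
have e : fmor (pi_functor (gen_ideal (@mesh_rel (framed Q n) k))) (mesh_sum k x) = 0.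
  by apply: lpi0; apply: Gi_gen; apply: Mesh_rel.
apply: etrans (congr1 (fmor (pi_functor (gen_ideal (@filt_rel k Q n)))) e) _.
exact: (lin0 (@fmor_lin _ _ _ (pi_functor (gen_ideal (@filt_rel k Q n))) _ _)).
Qed.

Variables (C : kcat k) (o : vtx ZQ -> ob C).
Variable F : forall a : arr ZQ, hom C (o (src a)) (o (tgt a)).
Hypothesis F_mesh : forall i p, old_mesh F i p + \sum_(r < n)
    (F (inr (inr (i, r), p)) : hom C (o (inr (i, r), p - 1)) (o (inl i, p)))
    \oc (F (inl (inr (i, r), p - 1))
      : hom C (o (inl i, p - 1)) (o (inr (i, r), p - 1))) = 0.
(** Asked of all morphisms of [C] between these objects: in the targets used below, nothing goes
    down in level. *)
Hypothesis F_filt : forall i r p j s q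
  (h : hom C (o (inr (i, r), p)) (o (inr (j, s), q))), (s < r)%N -> h = 0.

Lemma mesh_rel_ker x y (f : hom (path_cat k ZQ) x y) :
  mesh_rel f -> fmor (path_functor F) f = 0.
Proof.
by case=> -[[i|[i r]] p] // _; rewrite mesh_split; apply: F_mesh.
Qed.

Definition mesh_functor : kfunctor (mesh_cat (framed Q n) k) C :=
  quot_functor mesh_rel_ker.

Lemma filt_rel_ker x y (f : hom (mesh_cat (framed Q n) k) x y) :
  filt_rel f -> fmor mesh_functor f = 0.
Proof.
case: x y f => [[i|[i r]] p] [[j|[j s]] q] f //= sr.
exact: F_filt sr.
Qed.

Definition Rfilt_functor : kfunctor R C := quot_functor filt_rel_ker.

Lemma Rfilt_functor_garr a : fmor Rfilt_functor (garr a) = F a.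
Proof.
rewrite /garr [LHS](quot_fmorE filt_rel_ker) [LHS](quot_fmorE mesh_rel_ker).
by rewrite [LHS]path_fmorU; apply: pmor1.
Qed.
End RfiltFunctor.

(** * Restriction of words to a full subcategory *)

Section Restriction.
Variables (k : fieldType) (A : kcat k) (P : pred (ob A)) (n : nat).
Local Notation S := (full_subcat P).
Local Notation BA := (discrete_subcat A).
Local Notation BS := (discrete_subcat S).
Local Notation tA m x t := (@tens k A BA (regular A) (tpow BA m) _ _ _ x t).
Local Notation tS m x t := (@tens k S BS (regular S) (tpow BS m) _ _ _ x t).

(* Kills the tensors with an intermediate object outside of [P]. *)
Fixpoint restr m (c a : ob S) : tpow BA m (val c) (val a) -> tpow BS m c a :=
  match m return tpow BA m (val c) (val a) -> tpow BS m c a with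
  | 0 => fun f => f
  | m'.+1 => @tlift k A BA (regular A) (tpow BA m') (val c) (val a)
      (tpow BS m'.+1 c a)
      (fun b f t => match P b =P true with
        | ReflectT e => @tens k S BS (regular S) (tpow BS m') c a (exist _ b e)
            f (@restr m' c (exist _ b e) t)
        | ReflectF _ => 0
        end)
  end.

Lemma restr_lin_bal m c a : linear (@restr m c a) /\
  (if m is m'.+1 then
    @balanced k A BA (regular A) (tpow BA m') (val c) (val a) (tpow BS m'.+1 c a)
      (fun b f t => match P b =P true with
        | ReflectT e => @tens k S BS (regular S) (tpow BS m') c a (exist _ b e)
            f (@restr m' c (exist _ b e) t)
        | ReflectF _ => 0
        end)
   else True).
Proof.
elim: m a => [|m IH] a; first by [].
have bal : @balanced k A BA (regular A) (tpow BA m) (val c) (val a)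
    (tpow BS m.+1 c a)
      (fun b f t => match P b =P true with
        | ReflectT e => @tens k S BS (regular S) (tpow BS m) c a (exist _ b e)
            f (@restr m c (exist _ b e) t)
        | ReflectF _ => 0
        end).
  apply: balanced_discrete => b f; case: eqP => [e|_] u v w;
    rewrite ?scaler0 ?addr0 //.
    exact: (@tens_linl k S BS (regular S) (tpow BS m) c a (exist _ b e)).
  by rewrite (IH _).1 (@tens_linr k S BS (regular S) (tpow BS m) c a (exist _ b e)).
by split=> //; exact: tlift_lin bal.
Qed.

#[local] Arguments restr : simpl never.

Lemma restr_lin m c a : linear (@restr m c a).
Proof. by case: (restr_lin_bal m c a). Qed.

Lemma restr_tens m (c b a : ob S) (f : hom S b a) (t : tpow BA m (val c) (val b)) :
  @restr m.+1 c a (tA m (f : hom A (val b) (val a)) t) = tS m f (@restr m c b t).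
Proof.
case: b f t => b Pb f t; case: (restr_lin_bal m.+1 c a) => _ bal.
rewrite [LHS](tliftE bal); case: eqP => [e|nPb]; last by case: nPb.
by rewrite (bool_irrelevance e Pb).
Qed.

Lemma restr_tens0 m (c a : ob S) b (f : hom A b (val a)) (t : tpow BA m (val c) b) :
  ~~ P b -> @restr m.+1 c a (tA m f t) = 0.
Proof.
move=> Pb; case: (restr_lin_bal m.+1 c a) => _ bal; rewrite [LHS](tliftE bal).
by case: eqP => // Pb'; rewrite Pb' in Pb.
Qed.

Lemma restr_lact m (c b a : ob S) (g : hom S b a) (t : tpow BA m (val c) (val b)) :
  @restr m c a (lact (tpow BA m) (g : hom A (val b) (val a)) t) =
  lact (tpow BS m) g (@restr m c b t).
Proof.
case: m t => [//|m]; apply: tens_ext => [||d f t].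
- apply: (linear_comp (@restr_lin m.+1 c a)).
  exact: (@lact_linr _ _ (tpow BA m.+1) _ _ _ (g : hom A (val b) (val a))).
- apply: (linear_comp _ (@restr_lin m.+1 c b)).
  exact: (@lact_linr _ _ (tpow BS m.+1) _ _ _ g).
have [Pd|Pd] := boolP (P d).
  pose d' : ob S := exist _ d Pd; pose f' : hom S d' b := f.
  rewrite lact_tens (@restr_tens m c d' b f' t).
  by rewrite (@restr_tens m c d' a (g \oc f') t) lact_tens.
rewrite lact_tens !restr_tens0 //.
by rewrite (lin0 (@lact_linr _ _ (tpow BS m.+1) _ _ _ g)).
Qed.

(** The object [b] at which the words meet is composed away, and the remaining intermediate objects
    are those of [s] and of [t]. *)
Lemma restr_pmul m m' (c b a : ob S) (s : tpow BA m (val b) (val a))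
    (t : tpow BA m' (val c) (val b)) :
  @restr (m + m') c a (pmul s t) = pmul (@restr m b a s) (@restr m' c b t).
Proof.
elim: m a s => [|m IH] a s; first exact: restr_lact.
move: s; apply: tens_ext => [||d f s].
- exact: (linear_comp (@restr_lin (m.+1 + m') c a) (@pmul_linl _ _ _ m.+1 _ _ _ _ t)).
- exact: (linear_comp (@pmul_linl _ _ _ m.+1 _ _ _ _ (@restr m' c b t))
    (@restr_lin m.+1 b a)).
rewrite pmul_tens; have [Pd|Pd] := boolP (P d).
  pose d' : ob S := exist _ d Pd; pose f' : hom S d' a := f.
  rewrite (@restr_tens (m + m') c d' a f' (pmul s t)).
  by rewrite (@restr_tens m b d' a f' s) pmul_tens (IH d').
by rewrite (@restr_tens0 (m + m')) // (@restr_tens0 m) // pmul0r.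
Qed.

Lemma restr_ones m (x : ob S) : @restr m x x (ones BA m (val x)) = ones BS m x.
Proof. by elim: m => [//|m IH]; rewrite [LHS](@restr_tens m x x x (idm x)) IH. Qed.

Lemma restr_icast m m' (c a : ob S) (t : tpow BA m (val c) (val a)) :
  @restr m' c a (icast (fun i => tpow BA i (val c) (val a)) m' t) =
  icast (fun i => tpow BS i c a) m' (@restr m c a t).
Proof.
rewrite /icast; case: eqP => [e|_]; first by case: _ / e.
exact: (lin0 (@restr_lin m' c a)).
Qed.

Definition word_ob_val (x : tri_ob S n) : tri_ob A n := (val x.1, x.2).

Definition word_restr (x y : tri_ob S n)
    (h : hom (word_cat BA n) (word_ob_val x) (word_ob_val y)) :
    hom (word_cat BS n) x y :=
  cond_in _ (@restr _ x.1 y.1 (cond_out h)).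

Lemma word_restr_lin x y : linear (@word_restr x y).
Proof.
apply: (linear_comp (f := cond_in (x.2 <= y.2)%N) (@cond_in_lin _ _ _)).
exact: (linear_comp (@restr_lin (y.2 - x.2) x.1 y.1) (@cond_out_lin _ _ _)).
Qed.

Lemma word_restr_emb m (c a : ob S) (r s : 'I_n) (t : tpow BA m (val c) (val a)) :
  @word_restr (c, r) (a, s) (emb t r s) =
  emb (@restr m c a t) r s.
Proof.
apply: word_out_inj => /= le_rs; rewrite /word_restr /emb !cond_inK //=.
exact: restr_icast.
Qed.

Lemma word_restr_id x :
  @word_restr x x (idm (word_ob_val x : ob (word_cat BA n))) =
  idm (x : ob (word_cat BS n)).
Proof. by case: x => x r; rewrite -emb_id [LHS]word_restr_emb. Qed.

Lemma word_restr_comp x y z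
    (g : hom (word_cat BA n) (word_ob_val y) (word_ob_val z))
    (f : hom (word_cat BA n) (word_ob_val x) (word_ob_val y)) :
  word_restr (g \oc f) = word_restr g \oc word_restr f.
Proof.
apply: word_out_inj => /= le_xz.
change (cond_out (word_restr (word_comp g f)) =
  cond_out (word_comp (word_restr g) (word_restr f))).
rewrite /word_restr /word_comp !(cond_inK _ le_xz) restr_icast restr_pmul.
congr icast.
have [le_xy|nxy] : (x.2 <= y.2)%N \/ ~~ (x.2 <= y.2)%N by apply/orP/orbN.
  have [le_yz|nyz] : (y.2 <= z.2)%N \/ ~~ (y.2 <= z.2)%N by apply/orP/orbN.
    by rewrite !cond_inK.
  rewrite [cond_out g]cond_outN // !(lin0 (@restr_lin _ _ _)).
  by rewrite cond_in0 cond_out0 !pmul0r.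
rewrite [cond_out f]cond_outN // !(lin0 (@restr_lin _ _ _)).
by rewrite cond_in0 cond_out0 !pmulr0.
Qed.
End Restriction.

(** * Spreading level 1 over [n] levels *)

Lemma big_unit (R : Type) (idx : R) (op : Monoid.law idx) (E : unit -> R) :
  \big[op/idx]_m E m = E tt.
Proof. by rewrite (big_pred1 tt) // => -[]. Qed.

Lemma mat_compE (k : fieldType) (A : kcat k) (V : choiceType) (J : V -> finType)
    (o : forall v, J v -> ob A) (u v w : V) (g : hom (mat_cat o) v w)
    (f : hom (mat_cat o) u v) i j :
  (g \oc f) i j = \sum_m g m j \oc f i m.
Proof. by []. Qed.

Lemma Rfilt_lt (k : fieldType) (Q : fin_quiver) (n : nat) i (r : 'I_n) p j
    (s : 'I_n) q (h : hom (Rfilt k Q n) (inr (i, r), p) (inr (j, s), q)) :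
  (s < r)%N -> h = 0.
Proof.
by move=> sr; have [f ->] := lpi_surj h; apply: lpi0; apply: Gi_gen.
Qed.
Section Spread.
Variables (k : fieldType) (Q : fin_quiver) (n : nat).
Local Notation R1 := (Rfilt k Q 1).
Local Notation Rn := (Rfilt k Q n).
Local Notation Z1 := (rep_quiver (framed Q 1)).
Local Notation Zn := (rep_quiver (framed Q n)).

(* Non-frozen vertices are sent to themselves, and a frozen vertex x of level 1
   to the family (x_s)_s. *)
Definition spread_index (v : vtx Z1) : finType :=
  match v.1 with inl _ => unit | inr _ => 'I_n end.

Definition spread_ob (v : vtx Z1) : spread_index v -> ob Rn :=
  match v return spread_index v -> ob Rn with
  | (inl i, p) => fun=> (inl i, p)
  | (inr (i, _), p) => fun s => (inr (i, s), p)
  end.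

Local Notation M := (mat_cat spread_ob).

(** An arrow into a frozen vertex becomes a column over the levels, an arrow out of one becomes a
    row. *)
Definition spread_arr (a : arr Z1) : hom M (src a) (tgt a) :=
  match a return hom M (@src Z1 a) (@tgt Z1 a) with
  | inl (inl a, p) => fun _ _ => garr k (inl (inl a, p) : arr Zn)
  | inr (inl a, p) => fun _ _ => garr k (inr (inl a, p) : arr Zn)
  | inl (inr (i, _), p) => fun _ s => garr k (inl (inr (i, s), p) : arr Zn)
  | inr (inr (i, _), p) => fun s _ => garr k (inr (inr (i, s), p) : arr Zn)
  end.

Arguments spread_arr a : clear implicits.

Local Notation mpmor_cons :=
  (@pmor_cons k Z1 M (id : vtx Z1 -> ob M) spread_arr) (only parsing).
Local Notation mpmor1 :=
  (@pmor1 k Z1 M (id : vtx Z1 -> ob M) spread_arr) (only parsing).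
Local Notation gpmor_cons :=
  (@pmor_cons k Zn Rn (id : vtx Zn -> ob Rn) (@garr k Q n)) (only parsing).
Local Notation gpmor1 :=
  (@pmor1 k Zn Rn (id : vtx Zn -> ob Rn) (@garr k Q n)) (only parsing).

(** Row times column is the sum over all [n] framings, so the single framing term of level 1 becomes
    the framing part of [Rmesh] for [n]. *)
Lemma spread_mesh i p :
  @old_mesh k Q 1 M (id : vtx Z1 -> ob M) spread_arr i p + \sum_(r < 1)
    (spread_arr (inr (inr (i, r), p)) : hom M (inr (i, r), p - 1) (inl i, p))
    \oc (spread_arr (inl (inr (i, r), p - 1))
      : hom M (inl i, p - 1) (inr (i, r), p - 1)) = 0.
Proof.
apply: mat_hom_ext => -[] []; rewrite big_ord1.
rewrite -[RHS](Rmesh k n i p); congr (_ + _).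
rewrite /old_mesh; congr (_ + _); rewrite !prod_sumE;
  apply: eq_bigr => a /eqP <-.
  rewrite (mpmor_cons (inr (inl a, p))) (mpmor1 (inl (inl a, p))).
  rewrite mat_compE big_unit.
  rewrite (gpmor_cons (inr (inl a, p))).
  by rewrite (gpmor1 (inl (inl a, p))).
rewrite (mpmor_cons (inl (inl a, p - 1))) (mpmor1 (inr (inl a, p))).
rewrite mat_compE big_unit.
rewrite (gpmor_cons (inl (inl a, p - 1))).
by rewrite (gpmor1 (inr (inl a, p))).
Qed.

Lemma spread_filt i (r : 'I_1) p j (s : 'I_1) q
  (h : hom M (inr (i, r), p) (inr (j, s), q)) : (s < r)%N -> h = 0.
Proof. by rewrite (ord1 r). Qed.

Definition spread : kfunctor R1 M :=
  @Rfilt_functor k Q 1 M id spread_arr spread_mesh spread_filt.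

Lemma spread_garr a : fmor spread (garr k a) = spread_arr a.
Proof. exact: Rfilt_functor_garr. Qed.

Lemma spread_garrM (x : vtx Z1) (a : arr Z1) (f : hom R1 x (src a)) i j :
  fmor spread (garr k a \oc f) i j =
  \sum_m spread_arr a m j \oc (fmor spread f : hom M x (src a)) i m.
Proof. by rewrite fmorM spread_garr. Qed.
End Spread.

(** * Unfolding R^n-filt into matrices of words *)

Section Unfold.
Variables (k : fieldType) (Q : fin_quiver) (n : nat).
Local Notation R1 := (Rfilt k Q 1).
Local Notation Rn := (Rfilt k Q n).
Local Notation Z1 := (rep_quiver (framed Q 1)).
Local Notation Zn := (rep_quiver (framed Q n)).
Local Notation B := (discrete_subcat R1).
Local Notation W := (word_cat B n).

(* A non-frozen vertex w is sent to the family of its copies (w, t) at all the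
   levels t, and x_r to its copy (x, r). *)
Definition unfold_index (v : vtx Zn) : finType :=
  match v.1 with inl _ => 'I_n | inr _ => unit end.

Definition unfold_ob (v : vtx Zn) : unfold_index v -> ob W :=
  match v return unfold_index v -> ob W with
  | (inl i, p) => fun t => ((inl i, p), t)
  | (inr (i, r), p) => fun=> ((inr (i, ord0), p), r)
  end.

Local Notation M := (mat_cat unfold_ob).

(** The arrows of [Q] act diagonally on the levels. The source of sigma of an arrow at [p] lies at
    [p - 1], which is where its factor [ieps] sits. *)
Definition unfold_arr (a : arr Zn) : hom M (src a) (tgt a) :=
  match a return hom M (@src Zn a) (@tgt Zn a) with
  | inl (inl a, p) => fun t t' => lev B (garr k (inl (inl a, p) : arr Z1)) t t'
  | inr (inl a, p) => fun t t' => lev B (garr k (inr (inl a, p) : arr Z1)) t t'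
  | inl (inr (i, r), p) => fun t _ =>
      eps B ((inr (i, ord0), p) : ob R1) t r \oc
      lev B (garr k (inl (inr (i, ord0), p) : arr Z1)) t t
  | inr (inr (i, r), p) => fun _ t =>
      lev B (garr k (inr (inr (i, ord0), p) : arr Z1)) t t \oc
      ieps B ((inr (i, ord0), p - 1) : ob R1) r t
  end.

Arguments unfold_arr a : clear implicits.

Local Notation mpmor_cons :=
  (@pmor_cons k Zn M (id : vtx Zn -> ob M) unfold_arr) (only parsing).
Local Notation mpmor1 :=
  (@pmor1 k Zn M (id : vtx Zn -> ob M) unfold_arr) (only parsing).
Local Notation gpmor_cons :=
  (@pmor_cons k Z1 R1 (id : vtx Z1 -> ob R1) (@garr k Q 1)) (only parsing).
Local Notation gpmor1 :=
  (@pmor1 k Z1 R1 (id : vtx Z1 -> ob R1) (@garr k Q 1)) (only parsing).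

Lemma lev_sum c b a (g : hom R1 b a) (f : hom R1 c b) (r s : 'I_n) :
  \sum_m lev B g m s \oc lev B f r m = lev B (g \oc f) r s.
Proof.
rewrite (bigD1 s) //= levM big1 ?addr0 // => m ms.
by rewrite lev_off ?comp0m.
Qed.

(* The product of the column [ieps] and of the row [eps] is the identity matrix,
   by [ieps_eps]. *)
Lemma unfold_mesh i p :
  @old_mesh k Q n M (id : vtx Zn -> ob M) unfold_arr i p + \sum_(r < n)
    (unfold_arr (inr (inr (i, r), p)) : hom M (inr (i, r), p - 1) (inl i, p))
    \oc (unfold_arr (inl (inr (i, r), p - 1))
      : hom M (inl i, p - 1) (inr (i, r), p - 1)) = 0.
Proof.
apply: mat_hom_ext => t t'.
transitivity (lev B (0 : hom R1 (inl i, p - 1) (inl i, p)) t t'); last first.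
  exact: (lin0 (@lev_lin _ _ _ _ _ _ _ _)).
rewrite -(Rmesh k 1 i p) big_ord1 (linD (@lev_lin _ _ _ _ _ _ _ _)).
congr (_ + _).
  rewrite /Rold /old_mesh (linD (@lev_lin _ _ _ _ _ _ _ _)).
  congr (_ + _); rewrite !prod_sumE (lin_sump _ _ _ (@lev_lin _ _ _ _ _ _ _ _));
    apply: eq_bigr => a /eqP <-.
    rewrite (mpmor_cons (inr (inl a, p))) (mpmor1 (inl (inl a, p))).
    rewrite mat_compE lev_sum.
    rewrite (gpmor_cons (inr (inl a, p))).
    by rewrite (gpmor1 (inl (inl a, p))).
  rewrite (mpmor_cons (inl (inl a, p - 1))) (mpmor1 (inr (inl a, p))).
  rewrite mat_compE lev_sum.
  rewrite (gpmor_cons (inl (inl a, p - 1))).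
  by rewrite (gpmor1 (inr (inl a, p))).
rewrite !prod_sumE.
set a := garr k (inl (inr (i, ord0), p - 1)).
set b := garr k (inr (inr (i, ord0), p)).
pose x : ob R1 := (inr (i, ord0), p - 1).
transitivity (lev B b t' t' \oc (\sum_r ieps B x r t' \oc eps B x t r) \oc lev B a t t).
  rewrite comp_sumr comp_suml; apply: eq_bigr => r _.
  by rewrite mat_compE big_unit !compA.
rewrite ieps_eps levM compm1.
by rewrite [LHS]comp_emb //; left; rewrite addn0.
Qed.

(** Words never go down in level. *)
Lemma unfold_filt i (r : 'I_n) p j (s : 'I_n) q
  (h : hom M (inr (i, r), p) (inr (j, s), q)) : (s < r)%N -> h = 0.
Proof.
move=> sr; apply: mat_hom_ext => -[] []; apply: word_out_inj => /= rs.
by rewrite leqNgt sr in rs.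
Qed.

Definition unfold_words : kfunctor Rn M :=
  @Rfilt_functor k Q n M id unfold_arr unfold_mesh unfold_filt.

Lemma unfold_garr a : fmor unfold_words (garr k a) = unfold_arr a.
Proof. exact: Rfilt_functor_garr. Qed.
End Unfold.

(** * Transport of morphisms along equalities of objects *)

Section HomCast.
Variables (k : fieldType) (A : kcat k).

Lemma hcast_lin x x' y y' (ex : x = x') (ey : y = y') :
  linear (@hcast k A x x' y y' ex ey).
Proof. by case: _ / ex; case: _ / ey. Qed.

Lemma hcast_idm x x' (ex : x = x') : hcast ex ex (idm (x : ob A)) = idm x'.
Proof. by case: _ / ex. Qed.

Lemma hcast_comp x x' y y' z z' (ex : x = x') (ey : y = y') (ez : z = z')
    (g : hom A y z) (f : hom A x y) :
  hcast ex ez (g \oc f) = hcast ey ez g \oc hcast ex ey f.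
Proof. by case: _ / ex; case: _ / ey; case: _ / ez. Qed.

Lemma hcast_id x y (ex : x = x) (ey : y = y) (f : hom A x y) : hcast ex ey f = f.
Proof. by rewrite (eq_axiomK ex) (eq_axiomK ey). Qed.
End HomCast.

Lemma ord1_eq (o : 'I_1) : o = ord0.
Proof. exact: ord1. Qed.

Section Main.
Variables (k : fieldType) (Q : fin_quiver) (n : nat).
Local Notation R1 := (Rfilt k Q 1).
Local Notation Rn := (Rfilt k Q n).
Local Notation Z1 := (rep_quiver (framed Q 1)).
Local Notation Zn := (rep_quiver (framed Q n)).
Local Notation S1 := (Sfilt k Q 1).
Local Notation Sn := (Sfilt k Q n).
Local Notation B := (discrete_subcat R1).
Local Notation W := (word_cat B n).
Local Notation BS := (discrete_subcat S1).
Local Notation spread := (spread k Q n).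
Local Notation unfold_words := (unfold_words k Q n).

Definition frozen1 i p : vtx Z1 := (inr (i, ord0), p).

(** * Unfolding after spreading is conjugation by [1 - E] *)

Section UnfoldSpread.
Variables (i : fvtx Q) (p : int) (r : 'I_n).
Local Notation x := (frozen1 i p : ob R1).

(** At a non-frozen target the value is [f (1 - E)]; the factor [(1 - E)^-1] appears at frozen
    targets. The transport along [e] identifies [o] with [ord0], the only element of ['I_1]. *)
Definition unfold_spread_at (v : vtx Z1) : hom R1 x v -> Prop :=
  match v return hom R1 x v -> Prop with
  | (inl j, q) => fun f => forall t,
      (fmor unfold_words (fmor spread f r tt : hom Rn (inr (i, r), p) (inl j, q)))
        tt t = lev B f t t \oc ieps B x r t
  | (inr (j, o), q) => fun f => forall (e : (inr (j, o), q) = frozen1 j q) s,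
      (fmor unfold_words (fmor spread f r s
         : hom Rn (inr (i, r), p) (inr (j, s), q))) tt tt =
      \sum_t eps B (frozen1 j q : ob R1) t s \oc
        lev B (ecast z (hom R1 x z) e f) t t \oc ieps B x r t
  end.


Lemma unfold_spread_lin (v : vtx Z1) s l : 
  linear (fun f : hom R1 x v => fmor unfold_words (fmor spread f r s) tt l).
Proof.
move=> a f g.
have -> : fmor spread (a *: f + g) r s = a *: fmor spread f r s + fmor spread g r s.
  by rewrite fmor_lin.
by rewrite fmor_lin.
Qed.

Lemma unfold_garrM (y : vtx Zn) (a : arr Zn) (f : hom Rn y (src a)) l l' :
  fmor unfold_words (garr k a \oc f) l l' =
  \sum_m @unfold_arr k Q n a m l' \oc
    (fmor unfold_words f : hom (mat_cat (@unfold_ob k Q n)) y (src a)) l m.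
Proof. by rewrite fmorM unfold_garr. Qed.

Lemma eps_lev_ieps_lin (v : ob R1) t s :
  linear (fun f : hom R1 x v => eps B v t s \oc lev B f t t \oc ieps B x r t).
Proof.
exact: (linear_comp (@comp_linl k W _ _ _ (ieps B x r t))
  (linear_comp (@comp_linr k W _ _ _ (eps B v t s)) (@lev_lin k R1 B n x v t t))).
Qed.

Lemma unfold_spreadP (v : vtx Z1) (f : hom R1 x v) : unfold_spread_at f.
Proof.
move: v f; apply: Rfilt_ind => [v|v a f g|| a f].
- case: v => [[j|[j o]] q] /=.
    move=> t; rewrite (lin0 (@unfold_spread_lin (inl j, q) tt t)).
    by rewrite (lin0 (@lev_lin _ _ _ _ _ _ _ _)) comp0m.
  have eo := ord1_eq o; subst o => e s; rewrite (eq_axiomK e).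
  rewrite (lin0 (@unfold_spread_lin (inr (j, ord0), q) s tt)).
  rewrite big1 // => t _.
  by rewrite (lin0 (@lev_lin _ _ _ _ _ _ _ _)) compm0 comp0m.
- case: v f g => [[j|[j o]] q] f g /=.
    move=> IHf IHg t.
    apply: etrans (@unfold_spread_lin (inl j, q) tt t a f g) _.
    apply: etrans (congr2 (fun u v => a *: u + v) (IHf t) (IHg t)) _.
    by rewrite lev_lin compDl compZl.
  have eo := ord1_eq o; subst o => IHf IHg e s; rewrite (eq_axiomK e).
  apply: etrans (@unfold_spread_lin (inr (j, ord0), q) s tt a f g) _.
  apply: etrans (congr2 (fun u v => a *: u + v) (IHf erefl s) (IHg erefl s)) _.
  rewrite scaler_sumr -big_split.
  apply: eq_bigr => t _.
  exact: esym (@eps_lev_ieps_lin (frozen1 j q) t s a f g).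
(* For the identity, the claim is that [eps] times [ieps] is the identity matrix. *)
- move=> e s; rewrite (eq_axiomK e).
  transitivity (lev B (idm x) r s); last first.
    rewrite -eps_ieps; apply: eq_bigr => t _.
    by rewrite [lev _ _ _ _](_ : _ = idm _) // compm1.
  have e1 : fmor spread (idm x) r s =
      @mat_id_entry k Rn _ _ (@spread_ob k Q n) (frozen1 i p) r s by rewrite fmor1.
  pose U s' (h : hom Rn (inr (i, r), p) (inr (i, s'), p)) := fmor unfold_words h tt tt.
  apply: etrans (congr1 (U s) e1) _.
  have [<-|rs] := eqVneq r s.
    apply: etrans (congr1 (U r)
      (@mat_id_diag k Rn _ _ (@spread_ob k Q n) (frozen1 i p) r)) _.
    apply: etrans (congr1 (fun h => h tt tt)
      (fmor1 unfold_words ((inr (i, r), p) : ob Rn))) _.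
    apply: etrans
      (@mat_id_diag k W _ _ (@unfold_ob k Q n) ((inr (i, r), p) : vtx Zn) tt) _.
    exact: esym (emb_id _ _ _).
  apply: etrans (congr1 (U s)
    (@mat_id_off k Rn _ _ (@spread_ob k Q n) (frozen1 i p) r s rs)) _.
  rewrite lev_off //; apply: etrans (congr1 (fun h => h tt tt)
    (lin0 (@fmor_lin _ _ _ unfold_words (inr (i, r), p) (inr (i, s), p)))) _.
  by [].
case: a f => [[[a|[j o]] q]|[[a|[j o]] q]] f IH.
- move=> t; set g := garr k _.
  have e1 : fmor spread (g \oc f) r tt =
      garr k (inl (inl a, q) : arr Zn) \oc fmor spread f r tt.
    by rewrite spread_garrM big_unit.
  apply: etrans (congr1 (fun h : hom Rn (inr (i, r), p) (inl (ftgt a), q) =>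
    fmor unfold_words h tt t) e1) _.
  apply: etrans (unfold_garrM (a := (inl (inl a, q) : arr Zn))
    (fmor spread f r tt) tt t) _.
  transitivity (\sum_m lev B g m t \oc (lev B f m m \oc ieps B x r m)).
    by apply: eq_bigr => m _; apply: (congr1 (fun h => lev B g m t \oc h) (IH m)).
  rewrite (bigD1 t) //= compA levM big1 ?addr0 // => m mt.
  by rewrite lev_off ?comp0m.
(* An arrow into a frozen vertex brings in the left factor [eps]. *)
- have eo := ord1_eq o; subst o => e s; rewrite (eq_axiomK e); set g := garr k _.
  have e1 : fmor spread (g \oc f) r s =
      garr k (inl (inr (j, s), q) : arr Zn) \oc fmor spread f r tt.
    by rewrite spread_garrM big_unit.
  apply: etrans (congr1 (fun h : hom Rn (inr (i, r), p) (inr (j, s), q) =>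
    fmor unfold_words h tt tt) e1) _.
  pose y : ob R1 := frozen1 j q.
  apply: etrans (unfold_garrM (a := (inl (inr (j, s), q) : arr Zn))
    (fmor spread f r tt) tt tt) _.
  apply: eq_bigr => m _.
  apply: etrans (congr1 (fun h => (eps B y m s \oc lev B g m m) \oc h) (IH m)) _.
  by rewrite compA -[_ \oc lev B f m m]compA levM.
- move=> t; set g := garr k _.
  have e1 : fmor spread (g \oc f) r tt =
      garr k (inr (inl a, q) : arr Zn) \oc fmor spread f r tt.
    by rewrite spread_garrM big_unit.
  apply: etrans (congr1 (fun h : hom Rn (inr (i, r), p) (inl (fsrc a), q) =>
    fmor unfold_words h tt t) e1) _.
  apply: etrans (unfold_garrM (a := (inr (inl a, q) : arr Zn))
    (fmor spread f r tt) tt t) _.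
  transitivity (\sum_m lev B g m t \oc (lev B f m m \oc ieps B x r m)).
    by apply: eq_bigr => m _; apply: (congr1 (fun h => lev B g m t \oc h) (IH m)).
  rewrite (bigD1 t) //= compA levM big1 ?addr0 // => m mt.
  by rewrite lev_off ?comp0m.
(* An arrow out of a frozen vertex brings in [ieps], which cancels the factor [eps] of the previous
   value by [ieps_eps]. *)
- have eo := ord1_eq o; subst o => t; set g := garr k _.
  have e1 : fmor spread (g \oc f) r tt =
      \sum_s ((garr k (inr (inr (j, s), q) : arr Zn) \oc fmor spread f r s)
        : hom Rn (inr (i, r), p) (inl j, q)).
    by rewrite spread_garrM.
  apply: etrans (congr1 (fun h : hom Rn (inr (i, r), p) (inl j, q) =>
    fmor unfold_words h tt t) e1) _.
  rewrite (lin_sum (@fmor_lin _ _ _ unfold_words _ _)) !prod_sumE.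
  pose y : ob R1 := frozen1 j (q - 1).
  transitivity (\sum_s (lev B g t t \oc ieps B y s t) \oc
      \sum_t' eps B y t' s \oc lev B f t' t' \oc ieps B x r t').
    apply: eq_bigr => s _.
    apply: etrans (unfold_garrM (a := (inr (inr (j, s), q) : arr Zn))
    (fmor spread f r s) tt t) _.
    rewrite big_unit.
    exact: (congr1 (fun h => (lev B g t t \oc ieps B y s t) \oc h) (IH erefl s)).
  transitivity (lev B g t t \oc \sum_t' lev B (idm y) t' t \oc
      (lev B f t' t' \oc ieps B x r t')).
    rewrite comp_sumr; under eq_bigr => s _ do rewrite comp_sumr.
    rewrite exchange_big; apply: eq_bigr => t' _.
    rewrite -ieps_eps comp_suml comp_sumr; apply: eq_bigr => s _.
    by rewrite !compA.
  rewrite (bigD1 t) //= big1 ?addr0 => [|m mt]; last by rewrite lev_off ?comp0m.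
  rewrite [lev B (idm y) t t](_ : _ = idm _) // comp1m compA levM //.
Qed.
End UnfoldSpread.

(** * Components of the morphisms of S, and generation of S^n-filt by them *)

Definition frozenS i p : ob S1 := exist _ (frozen1 i p) isT.

Lemma frozenS_surj (a : ob S1) : exists i p, a = frozenS i p.
Proof.
case: a => -[[i|[i o]] p] // pa; exists i, p; apply: val_inj.
by rewrite /= (ord1_eq o).
Qed.

Definition base_vtx (a : ob S1) : fvtx Q :=
  match (val a).1 with inl i => i | inr (i, _) => i end.

Definition level_ob (x : tri_ob S1 n) : ob Sn :=
  exist _ ((inr (base_vtx x.1, x.2), (val x.1).2) : vtx Zn) isT.

Lemma level_ob_bij : bijective level_ob.
Proof.
pose g (v : ob Sn) : tri_ob S1 n :=
  match v with
  | exist (inr (i, r), p) _ => (frozenS i p, r)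
  | exist (inl _, _) e => match Bool.diff_false_true e with end
  end.
exists g => [[a r]|[[[i|[i r]] p] // pa]].
  by have [i [p ->]] := frozenS_surj a.
exact: val_inj.
Qed.

(** Objects of S are frozen, so the non-frozen cases do not occur; 0 fills them. *)
Definition level_comp (c a : ob S1) (r s : 'I_n) :
  hom S1 c a -> hom Sn (level_ob (c, r)) (level_ob (a, s)).
Proof.
case: c => [[[i|[i o]] p] pc]; first exact: (fun=> 0).
case: a => [[[j|[j o']] q] qa] f; first exact: 0.
exact: (fmor spread f r s).
Defined.

Lemma level_compE i p j q r s (f : hom S1 (frozenS i p) (frozenS j q)) :
  level_comp r s f = fmor spread f r s.
Proof. by []. Qed.

Lemma level_comp_lin c a r s : linear (@level_comp c a r s).
Proof.
have [i [p ->]] := frozenS_surj c; have [j [q ->]] := frozenS_surj a.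
move=> t f g; rewrite !level_compE.
have -> : fmor spread (t *: f + g) = t *: fmor spread f + fmor spread g.
  exact: (@fmor_lin _ _ _ spread (frozen1 i p) (frozen1 j q)).
by [].
Qed.

Lemma level_comp_id c r : level_comp r r (idm c) = idm (level_ob (c, r)).
Proof.
have [i [p ->]] := frozenS_surj c; rewrite level_compE.
have -> : fmor spread (idm (frozenS i p)) = idm (spread (frozen1 i p)).
  exact: (fmor1 spread).
exact: (@mat_id_diag k Rn _ _ (@spread_ob k Q n) (frozen1 i p) r).
Qed.

Lemma level_comp_id0 c (r s : 'I_n) : r != s -> level_comp r s (idm c) = 0.
Proof.
move=> rs; have [i [p ->]] := frozenS_surj c; rewrite level_compE.
have -> : fmor spread (idm (frozenS i p)) = idm (spread (frozen1 i p)).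
  exact: (fmor1 spread).
exact: (@mat_id_off k Rn _ _ (@spread_ob k Q n) (frozen1 i p) r s rs).
Qed.

Lemma level_comp_lt c a (r s : 'I_n) (f : hom S1 c a) :
  (s < r)%N -> level_comp r s f = 0.
Proof. exact: Rfilt_lt. Qed.

Lemma level_compM c b a r s (g : hom S1 b a) (f : hom S1 c b) :
  level_comp r s (g \oc f) = \sum_t level_comp t s g \oc level_comp r t f.
Proof.
have [i [p ec]] := frozenS_surj c; have [j [q ea]] := frozenS_surj a.
have [l [m eb]] := frozenS_surj b; subst c a b.
rewrite level_compE.
pose x := frozen1 i p; pose y := frozen1 l m; pose z := frozen1 j q.
pose g' : hom R1 y z := g; pose f' : hom R1 x y := f.
transitivity ((fmor spread g' \oc fmor spread f') r s).
  by rewrite -fmorM.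
exact: (@mat_compE k Rn _ _ (@spread_ob k Q n) x y z
  (fmor spread g') (fmor spread f') r s).
Qed.

Section Generation.
Variables (i0 : fvtx Q) (p0 : int) (r : 'I_n).
Local Notation c := (frozenS i0 p0).
Variable P : forall a (s : 'I_n),
  hom Sn (level_ob (c, r)) (level_ob (a, s)) -> Prop.
Hypothesis P1 : P (idm (level_ob (c, r))).
Hypothesis P0 : forall a (s : 'I_n), @P a s 0.
Hypothesis PL : forall a (s : 'I_n) t f g, @P a s f -> P g -> P (t *: f + g).
Hypothesis PD : forall b a (t s : 'I_n) (f : hom S1 b a) g,
  @P b t g -> P (level_comp t s f \oc g).

Local Notation x := (val (level_ob (c, r)) : ob Rn).

(** Paths between frozen vertices pass through non-frozen ones, where [P] has no meaning. There the
    invariant asks for a combination of unfinished components [f], each composed with a morphism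
    satisfying [P]. *)
Definition generated_at (v : vtx Zn) : hom Rn x v -> Prop :=
  match v return hom Rn x v -> Prop with
  | (inl j, q) => span (fun h => exists i p s
      (f : hom R1 (frozen1 i p) (inl j, q))
      (g : hom Rn x (inr (i, s), p)),
      @P (frozenS i p) s g /\ h = (fmor spread f s tt
        : hom Rn (inr (i, s), p) (inl j, q)) \oc g)
  | (inr (j, s), q) => fun h => @P (frozenS j q) s h
  end.

Lemma generatedP (v : vtx Zn) (h : hom Rn x v) : generated_at h.
Proof.
move: v h; apply: Rfilt_ind => [v|v a f g||a f].
- by case: v => [[j|[j s]] q] /=; [apply: Span_0|apply: P0].
- by case: v f g => [[j|[j s]] q] f g /=; [apply: Span_lin|apply: PL].
- exact: P1.
case: a f => [[[a|[j s]] q]|[[a|[j s]] q]] f IH.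
(* An arrow between non-frozen vertices is absorbed into the unfinished component. *)
- elim: IH => {f} [u [i [p [s [f [g [Pg ->]]]]]]||t u v _ IHu _ IHv].
  + apply: Span_gen; exists i, p, s, (garr k (inl (inl a, q) : arr Z1) \oc f), g.
    split=> //; rewrite [LHS]compA; congr (_ \oc g).
    apply: esym; apply: etrans (spread_garrM (a := (inl (inl a, q) : arr Z1)) f s tt) _.
    exact: big_unit.
  + by rewrite compm0; apply: Span_0.
  + by rewrite compDr compZr; exact: (Span_lin t IHu IHv).
(* An arrow into a frozen vertex completes the component, and [PD] applies. *)
- elim: IH => {f} [u [i [p [s' [f [g [Pg ->]]]]]]||t u v _ IHu _ IHv].
  + have := @PD (frozenS i p) (frozenS j q) s' s
      (garr k (inl (inr (j, ord0), q) : arr Z1) \oc f) g Pg.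
    rewrite level_compE.
    have -> : fmor spread (garr k (inl (inr (j, ord0), q) : arr Z1) \oc f) s' s =
        garr k (inl (inr (j, s), q) : arr Zn) \oc fmor spread f s' tt.
      apply: etrans (spread_garrM (a := (inl (inr (j, ord0), q) : arr Z1)) f s' s) _.
      exact: big_unit.
    by rewrite -[X in P X -> _]compA.
  + by rewrite compm0; apply: P0.
  + by rewrite compDr compZr; exact: (@PL (frozenS j q) s t _ _ IHu IHv).
- elim: IH => {f} [u [i [p [s [f [g [Pg ->]]]]]]||t u v _ IHu _ IHv].
  + apply: Span_gen; exists i, p, s, (garr k (inr (inl a, q) : arr Z1) \oc f), g.
    split=> //; rewrite [LHS]compA; congr (_ \oc g).
    apply: esym; apply: etrans (spread_garrM (a := (inr (inl a, q) : arr Z1)) f s tt) _.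
    exact: big_unit.
  + by rewrite compm0; apply: Span_0.
  + by rewrite compDr compZr; exact: (Span_lin t IHu IHv).
(* An arrow out of a frozen vertex starts a new component, being itself an entry of the spread of
   the arrow of level 1. *)
- apply: Span_gen; exists j, (q - 1), s, (garr k (inr (inr (j, ord0), q) : arr Z1)), f.
  split; first exact: IH.
  pose b : arr Z1 := inr (inr (j, ord0), q).
  have e : fmor spread (garr k b) s tt = garr k (inr (inr (j, s), q) : arr Zn).
    exact: (congr1 (fun h : hom (mat_cat (@spread_ob k Q n)) (frozen1 j (q - 1))
      (inl j, q) => h s tt) (@spread_garr k Q n b)).
  exact: (congr1 (fun h : hom Rn (inr (j, s), q - 1) (inl j, q) => h \oc f) (esym e)).
Qed.
End Generation.

Lemma level_comp_gen c (r : 'I_n)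
    (P : forall a (s : 'I_n), hom Sn (level_ob (c, r)) (level_ob (a, s)) -> Prop) :
  P c r (idm _) -> (forall a (s : 'I_n), P a s 0) ->
  (forall a (s : 'I_n) t f g, P a s f -> P a s g -> P a s (t *: f + g)) ->
  (forall b a (t s : 'I_n) (f : hom S1 b a) g, P b t g ->
     P a s (level_comp t s f \oc g)) ->
  forall a s h, P a s h.
Proof.
have [i [p e]] := frozenS_surj c; subst c => P1 P0 PL PD a s.
have [j [q e]] := frozenS_surj a; subst a.
exact: (@generatedP i p r P P1 P0 PL PD (inr (j, s), q)).
Qed.

(** * The functor from S^n-filt to words with letters in S *)

Lemma unfold_level_ob (x : tri_ob S1 n) :
  @unfold_ob k Q n (val (level_ob x)) tt = word_ob_val x.
Proof. by case: x => a r; have [i [p ->]] := frozenS_surj a. Qed.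

(** Unfolding yields words with letters in R^1-filt between frozen vertices; [word_restr] turns them
    into words over S. *)
Definition level_word (x y : tri_ob S1 n) (h : hom Sn (level_ob x) (level_ob y)) :
    hom (word_cat BS n) x y :=
  word_restr (hcast (unfold_level_ob x) (unfold_level_ob y)
    (fmor unfold_words (h : hom Rn (val (level_ob x)) (val (level_ob y))) tt tt)).

Lemma level_word_lin x y : linear (@level_word x y).
Proof.
apply: (linear_comp (@word_restr_lin k R1 _ n x y)).
apply: (linear_comp (@hcast_lin k W _ _ _ _ (unfold_level_ob x) (unfold_level_ob y))).
move=> a f g.
exact: (congr1 (fun h => h tt tt)
  (@fmor_lin _ _ _ unfold_words (val (level_ob x)) (val (level_ob y)) a f g)).
Qed.

Lemma level_word_id x : level_word (idm (level_ob x)) = idm (x : ob (word_cat BS n)).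
Proof.
rewrite -word_restr_id /level_word; congr word_restr.
rewrite -(hcast_idm (A := W) (unfold_level_ob x)); congr hcast.
apply: etrans (congr1 (fun h => h tt tt)
  (fmor1 unfold_words (val (level_ob x)))) _.
exact: (@mat_id_diag k W _ _ (@unfold_ob k Q n) (val (level_ob x)) tt).
Qed.

Lemma level_word_comp x y z (g : hom Sn (level_ob y) (level_ob z))
    (f : hom Sn (level_ob x) (level_ob y)) :
  level_word (g \oc f) = level_word g \oc level_word f.
Proof.
rewrite /level_word -word_restr_comp; congr word_restr.
rewrite -hcast_comp; congr hcast.
apply: etrans (congr1 (fun h => h tt tt)
  (@fmorM _ _ _ unfold_words (val (level_ob x)) (val (level_ob y))
     (val (level_ob z)) g f)) _.
exact: big_unit.
Qed.

(** [unfold_spreadP] gives the formula over R^1-filt, and restriction respects each of its three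
    factors, all of which join frozen vertices. *)
Lemma level_word_D c a r s (f : hom S1 c a) :
  level_word (level_comp r s f) =
  \sum_t eps BS a t s \oc lev BS f t t \oc ieps BS c r t.
Proof.
have [i [p ec]] := frozenS_surj c; have [j [q ea]] := frozenS_surj a; subst c a.
pose x : ob R1 := frozen1 i p; pose y : ob R1 := frozen1 j q.
pose f' : hom R1 x y := f.
have e : fmor unfold_words (fmor spread f' r s
      : hom Rn (inr (i, r), p) (inr (j, s), q)) tt tt =
    \sum_t eps B y t s \oc lev B f' t t \oc ieps B x r t.
  exact: (@unfold_spreadP i p r y f' erefl s).
rewrite /level_word hcast_id level_compE.
apply: etrans (congr1 (@word_restr k R1 (@rep_frozen (framed Q 1)) n
  (frozenS i p, r) (frozenS j q, s)) e) _.
rewrite (lin_sum (@word_restr_lin k R1 _ n (frozenS i p, r) (frozenS j q, s))).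
apply: eq_bigr => t _.
rewrite (@word_restr_comp k R1 _ n (frozenS i p, r) (frozenS i p, t) (frozenS j q, s)).
rewrite (@word_restr_comp k R1 _ n (frozenS i p, t) (frozenS j q, t) (frozenS j q, s)).
rewrite (linZ (@word_restr_lin k R1 _ n (frozenS i p, r) (frozenS i p, t))).
rewrite /eps /lev !word_restr_emb !restr_ones.
by [].
Qed.
End Main.

Theorem proposition4p3 (k : fieldType) (Q : fin_quiver) (n : nat) :
  acyclic Q -> (1 <= n)%N ->
  kcat_isomorphic (Sfilt k Q n) (tri_cat (discrete_subcat (Sfilt k Q 1)) n).
Proof.
move=> _ _.
(* S^n-filt is replaced by its copy whose objects are pairs of an object of S and a level. *)
apply: kcat_isomorphic_trans (kcat_isomorphic_sym
  (pull_cat_iso (@level_ob_bij k Q n))) _.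
apply: (@filtered_criterion k (Sfilt k Q 1) n (Sfilt k Q n) (@level_ob k Q n)
  (@level_comp k Q n) _ _ _ _ _ _ (@level_word k Q n)).
- exact: level_comp_lin.
- exact: level_comp_id.
- exact: level_comp_id0.
- exact: level_comp_lt.
- exact: level_compM.
- exact: level_comp_gen.
- exact: level_word_lin.
- exact: level_word_id.
- exact: level_word_comp.
- exact: level_word_D.
Qed.
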